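(* For any $d,n\ge 1$ we have a direct decomposition of $\mathrm{Aut}(F_n)$-modules $$A_d(n)=A_dP(n)\oplus A_dQ(n).$$ This direct decomposition is indecomposable for $n\ge 2d$.
   Context: $\mathbb K$ is a fixed field of characteristic $0$; $F_n$ is the free group on $x_1,\dots,x_n$; modules are over $\mathbb K$. A direct decomposition is called indecomposable if each of its nonzero summands is indecomposable (not a direct sum of two nonzero submodules). Jacobi diagrams: $X_n$ is the disjoint union of $n$ oriented arcs numbered $1,\dots,n$. A Jacobi diagram on $X_n$ is a finite uni-trivalent graph $D$ with a cyclic order on the three half-edges at each trivalent vertex, whose univalent vertices are embedded in the interior of $X_n$ (up to orientation-preserving homeomorphisms of $X_n$ preserving each component), such that each connected component of $D$ has at least one univalent vertex. Its degree is half the number of vertices of $D$. $A_d(n)$ is the $\mathbb K$-vector space spanned by Jacobi diagrams of degree $d$ on $X_n$ modulo the STU relation: if a trivalent vertex has half-edges in cyclic order $(s,b,a)$ and the edge $s$ ends at a univalent vertex on $X_n$, then the diagram equals $D'-D''$, where $D'$ (resp. $D''$) is obtained by deleting this trivalent vertex and the edge $s$ and attaching $a,b$ to $X_n$ at two adjacent points near the former endpoint of $s$, with $a$ before $b$ (resp. $b$ before $a$) along the orientation. Functoriality: for a homomorphism $f:F_n\to F_m$ (a morphism $f\in\mathbf F^{\mathrm{op}}(m,n)$, where $\mathbf F$ is the category of finitely generated free groups) the map $A_d(f):A_d(m)\to A_d(n)$ is defined as follows. Write $f(x_j)=x_{i_1}^{\epsilon_1}\cdots x_{i_l}^{\epsilon_l}$,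 $\epsilon_p=\pm1$. For a diagram $D$ on $X_m$, the $j$-th arc of $X_n$ is formed by concatenating, along its orientation and starting with the rightmost letter, copies of the arcs $i_l,\dots,i_1$ of $X_m$, the copy for $x_{i_p}^{\epsilon_p}$ being reversed if $\epsilon_p=-1$. $A_d(f)(D)$ is the sum over all ways of placing every univalent vertex of $D$ lying on arc $i$ at the corresponding point of one of the copies of arc $i$, with sign $(-1)^{\#\{\text{vertices placed on reversed copies}\}}$. Then $u\cdot g:=A_d(g)(u)$ is a right action of $\mathrm{Aut}(F_n)$ on $A_d(n)$. For $X\in A_d(m)$ put $A_dX(n):=\mathrm{Span}_{\mathbb K}\{A_d(f)(X)\mid f\in\mathbf F^{\mathrm{op}}(m,n)\}$, an $\mathrm{Aut}(F_n)$-submodule of $A_d(n)$. Elements $P,Q\in A_d(2d)$: for a perfect matching $M$ of $\{1,\dots,2d\}$ let $D_M\in A_d(2d)$ be the diagram with no trivalent vertices consisting of $d$ chords, one chord joining arcs $i$ and $j$ for each $\{i,j\}\in M$. $P=\sum_{\sigma\in\mathfrak S_{2d}}\sigma\cdot D_{\{1,2\},\{3,4\},\dots,\{2d-1,2d\}}$, where $\sigma$ permutes the numbering of the arcs. For $d\ge 2$, $Q=D_{\{1,4\},\{2,3\},\{5,6\},\dots,\{2d-1,2d\}}-D_{\{2,4\},\{1,3\},\{5,6\},\dots,\{2d-1,2d\}}$. For $d=1$, $A_1Q(n)=0$. *)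

(* Defs.v *)
From HB Require Import structures.
From mathcomp Require Import all_boot all_order all_fingroup all_algebra.
From mathcomp Require Import boolp.

Set Implicit Arguments.
Unset Strict Implicit.
Unset Printing Implicit Defensive.

Import GRing.Theory.
Local Open Scope ring_scope.

(** * Free groups *)

Section Words.
Variable n : nat.

(* [(i, false)] stands for x_i and [(i, true)] for x_i^-1. *)
Definition letter := ('I_n * bool)%type.

Definition inv_letter (a : letter) : letter := (a.1, ~~ a.2).
Arguments inv_letter : simpl never.

Definition reduced (w : seq letter) := sorted (fun a b => b != inv_letter a) w.

Definition cons_reduced (a : letter) (w : seq letter) :=
  if w is b :: w' then if b == inv_letter a then w' else a :: w else [:: a].

Definition mul_word (u v : seq letter) := foldr cons_reduced v u.

Definition inv_word (w : seq letter) := rev (map inv_letter w).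

Lemma inv_letterK : involutive inv_letter.
Proof. by case=> i b; rewrite /inv_letter /= negbK. Qed.

Lemma reduced_behead a w : reduced (a :: w) -> reduced w.
Proof. by case: w => //= b w /andP[]. Qed.

Lemma cons_reduced_id a w : reduced (a :: w) -> cons_reduced a w = a :: w.
Proof. by case: w => //= b w /andP[/negPf -> _]. Qed.

Lemma reduced_cons a w : reduced w -> reduced (cons_reduced a w).
Proof.
case: w => // b w rw /=; case: ifP => [_|/negbT nab]; first exact: reduced_behead rw.
by apply/andP; split.
Qed.

Lemma reduced_mul u v : reduced v -> reduced (mul_word u v).
Proof. by move=> rv; elim: u => //= a u; apply: reduced_cons. Qed.

Lemma cons_reducedK a w :
  reduced w -> cons_reduced (inv_letter a) (cons_reduced a w) = w.
Proof.
case: w => [|b w] rw; rewrite {2}/cons_reduced; first by rewrite /= inv_letterK eqxx.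
case: eqP rw => [->|_] rw; last by rewrite /cons_reduced inv_letterK eqxx.
exact: cons_reduced_id.
Qed.

Lemma cons_reducedVK a w :
  reduced w -> cons_reduced a (cons_reduced (inv_letter a) w) = w.
Proof. by move=> rw; rewrite -{1}(inv_letterK a) cons_reducedK. Qed.

Lemma mul_cons_reduced a v w : reduced v -> reduced w ->
  mul_word (cons_reduced a v) w = cons_reduced a (mul_word v w).
Proof.
case: v => [|b v] //= rv rw; case: eqP => [->|_] //=.
by rewrite cons_reducedVK // reduced_mul.
Qed.

Lemma mul_wordA u v w : reduced v -> reduced w ->
  mul_word u (mul_word v w) = mul_word (mul_word u v) w.
Proof.
move=> rv rw; elim: u => //= a u ->.
by rewrite mul_cons_reduced // reduced_mul.
Qed.

Lemma mul_word1 w : reduced w -> mul_word w [::] = w.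
Proof.
elim: w => //= a w IHw raw; rewrite IHw ?(reduced_behead raw) //.
exact: cons_reduced_id.
Qed.

Lemma inv_wordK : involutive inv_word.
Proof.
by move=> w; rewrite /inv_word map_rev revK -map_comp map_id_in // => a _ /=;
   rewrite inv_letterK.
Qed.

Lemma reduced_inv w : reduced w -> reduced (inv_word w).
Proof.
rewrite /reduced /inv_word rev_sorted sorted_map.
apply: sub_sorted => a b /=; apply: contra => /eqP ->.
by rewrite inv_letterK.
Qed.

Lemma mul_inv_word_l w v : reduced v -> mul_word (inv_word w) (mul_word w v) = v.
Proof.
elim: w v => // a w IHw v rv.
rewrite /inv_word /= rev_cons /mul_word foldr_rcons /= cons_reducedK ?reduced_mul //.
exact: IHw.
Qed.

Lemma mulVword w : reduced w -> mul_word (inv_word w) w = [::].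
Proof. by move=> rw; rewrite -{2}(mul_word1 rw) mul_inv_word_l. Qed.

Definition free_group := {w : seq letter | reduced w}.

HB.instance Definition _ := Choice.on free_group.

Definition free_one : free_group := Sub [::] isT.
Definition free_mul (u v : free_group) : free_group :=
  Sub (mul_word (val u) (val v)) (reduced_mul (val u) (valP v)).
Definition free_inv (u : free_group) : free_group :=
  Sub (inv_word (val u)) (reduced_inv (valP u)).

Fact free_mulA : associative free_mul.
Proof. by move=> u v w; apply: val_inj; rewrite /= mul_wordA //; apply: valP. Qed.
Fact free_mul1 : left_id free_one free_mul.
Proof. by move=> u; apply: val_inj. Qed.
Fact free_1mul : right_id free_one free_mul.
Proof. by move=> u; apply: val_inj; rewrite /= mul_word1 //; apply: valP. Qed.
Fact free_mulV : left_inverse free_one free_inv free_mul.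
Proof. by move=> u; apply: val_inj; rewrite /= mulVword //; apply: valP. Qed.
Fact free_Vmul : right_inverse free_one free_inv free_mul.
Proof.
move=> u; apply: val_inj; rewrite /= -{1}(inv_wordK (val u)) mulVword //.
exact/reduced_inv/valP.
Qed.

HB.instance Definition _ := isGroup.Build free_group
  free_mulA free_mul1 free_1mul free_mulV free_Vmul.

Definition free_gen (i : 'I_n) : free_group := Sub [:: (i, false)] isT.

End Words.

Notation free_hom n m := {multiplicative free_group n -> free_group m}.

(** * Jacobi diagrams *)

Section JacobiDiagrams.
Variable d : nat.

(* The vertices of a diagram of degree [d] are labelled by ['I_d.*2].  A
   trivalent vertex [v] has the half-edges [(v, i)], [i : 'I_3], in the cyclic
   order 0, 1, 2; a univalent vertex [v] has the single half-edge [(v, 0)], and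
   [(v, 1)], [(v, 2)] are unused. *)
Definition vertex := 'I_d.*2.
Definition half_edge := (vertex * 'I_3)%type.

Section Raw.
Variable n : nat.

(* [legs i] lists the univalent vertices on the i-th arc along its orientation. *)
Definition univalent (legs : 'I_n -> seq vertex) (v : vertex) :=
  [exists i, v \in legs i].

Definition used (legs : 'I_n -> seq vertex) (h : half_edge) :=
  univalent legs h.1 ==> (h.2 == 0).

Definition legs_ok (legs : 'I_n -> seq vertex) :=
  [forall i, uniq (legs i)] &&
  [forall i, forall j, forall v, (v \in legs i) && (v \in legs j) ==> (i == j)].

(* [mate] exchanges the two half-edges of each edge. *)
Definition mate_ok (legs : 'I_n -> seq vertex) (mate : half_edge -> half_edge) :=
  [forall h, if used legs h
             then [&& used legs (mate h), mate h != h & mate (mate h) == h]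
             else mate h == h].

Definition adjacent (mate : half_edge -> half_edge) : rel vertex :=
  fun v w => [exists i, (mate (v, i)).1 == w].

(* Every connected component contains a univalent vertex. *)
Definition grounded (legs : 'I_n -> seq vertex) (mate : half_edge -> half_edge) :=
  [forall v, exists w, univalent legs w && connect (adjacent mate) v w].

Definition raw_diagram :=
  ({ffun 'I_n -> (d.*2).-bseq vertex} * {ffun half_edge -> half_edge})%type.

Definition is_diagram (D : raw_diagram) :=
  [&& legs_ok (fun i => D.1 i), mate_ok (fun i => D.1 i) D.2
    & grounded (fun i => D.1 i) D.2].

End Raw.

Definition diagram n := {D : raw_diagram n | is_diagram D}.

Definition legs n (D : diagram n) (i : 'I_n) : seq vertex := (val D).1 i.
Definition mate n (D : diagram n) : half_edge -> half_edge := (val D).2.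

Lemma legsP n (D : diagram n) : legs_ok (legs D).
Proof. by case/and3P: (valP D). Qed.
Lemma mateP n (D : diagram n) : mate_ok (legs D) (mate D).
Proof. by case/and3P: (valP D). Qed.
Lemma groundedP n (D : diagram n) : grounded (legs D) (mate D).
Proof. by case/and3P: (valP D). Qed.

Lemma size_legs n (L : 'I_n -> seq vertex) i : legs_ok L -> (size (L i) <= d.*2)%N.
Proof.
case/andP=> /forallP uL _; rewrite -(card_uniqP (uL i)).
by apply: leq_trans (max_card _) _; rewrite card_ord.
Qed.

Definition mk_diagram n (L : 'I_n -> seq vertex) (e : half_edge -> half_edge)
    (okL : legs_ok L) (oke : mate_ok L e) (okg : grounded L e) : diagram n.
Proof.
refine (exist _ ([ffun i => Bseq (size_legs i okL)], [ffun h => e h]) _).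
have eqL : (fun i => [ffun i => Bseq (size_legs i okL)] i : seq vertex) =1 L.
  by move=> i; rewrite ffunE.
have equ v : univalent (fun i => [ffun i => Bseq (size_legs i okL)] i) v
             = univalent L v.
  by apply: eq_existsb => i; rewrite eqL.
apply/and3P; split=> /=.
- have /andP[/forallP u1 /forallP u2] := okL.
  apply/andP; split; apply/forallP => i; first by rewrite ffunE /=.
  by apply/forallP => j; rewrite !ffunE; apply: (forallP (u2 i)).
- apply/forallP => h; move/forallP: oke => /(_ h).
  by rewrite /used !equ !ffunE.
- apply/forallP => v; move/forallP: okg => /(_ v)/existsP[w /andP[uw cw]].
  apply/existsP; exists w; rewrite equ uw /=.
  by rewrite (eq_connect (e' := adjacent e)) // => x y;
     apply: eq_existsb => i; rewrite ffunE.
Defined.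

Lemma legs_mk n L e okL oke okg : legs (@mk_diagram n L e okL oke okg) =1 L.
Proof. by move=> i; rewrite /legs /= ffunE. Qed.
Lemma mate_mk n L e okL oke okg : mate (@mk_diagram n L e okL oke okg) =1 e.
Proof. by move=> h; rewrite /mate /= ffunE. Qed.

(* Moving the univalent vertices of [D] along or between arcs. *)
Section Reattach.
Variables (m n : nat) (D : diagram m) (L : 'I_n -> seq vertex).
Hypothesis okL : legs_ok L.
Hypothesis uL : univalent L =1 univalent (legs D).

Lemma reattach_mate : mate_ok L (mate D).
Proof. by apply/forallP => h; have := forallP (mateP D) h; rewrite /used !uL. Qed.

Lemma reattach_grounded : grounded L (mate D).
Proof.
apply/forallP => v; have /existsP[w] := forallP (groundedP D) v.
by rewrite -uL => cw; apply/existsP; exists w.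
Qed.

Definition reattach : diagram n := mk_diagram okL reattach_mate reattach_grounded.
End Reattach.

(** ** Isomorphism and STU *)

(* [D'] is obtained from [D] by renaming the vertices along [s] and rotating the
   labels of the half-edges at each trivalent vertex [v] by [r v]. *)
Definition diagram_iso n (D D' : diagram n) :=
  [exists s : {perm vertex}, exists r : {ffun vertex -> 'I_3},
    let rho := fun h : half_edge => (s h.1, h.2 + r h.1) in
    [&& [forall v, univalent (legs D) v ==> (r v == 0)],
        [forall i, legs D' i == map s (legs D i)]
      & [forall h, mate D' (rho h) == rho (mate D h)]]].

(* In [D] the half-edges [(v, i)], [(v, i + 1)], [(v, i + 2)] play the roles of
   s, b, a, and the edge s ends at the leg [u].  In [D1] and [D2] the edge a ends
   at the leg [u] and the edge b at the new leg [v]; so all three diagrams have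
   the same vertices, and their mates agree up to the relabelling [phi]. *)
Definition STU n (D D1 D2 : diagram n) :=
  [exists u : vertex, exists v : vertex, exists i : 'I_3,
    let phi := fun h : half_edge =>
      if h == (v, i + 1) then (v, 0) else if h == (v, i + 2) then (u, 0) else h in
    let double x y := fun l : seq vertex =>
      flatten [seq if w == u then [:: x; y] else [:: w] | w <- l] in
    [&& univalent (legs D) u, ~~ univalent (legs D) v, mate D (u, 0) == (v, i),
        [forall k, (legs D1 k == double u v (legs D k))
                   && (legs D2 k == double v u (legs D k))]
      & [forall h, [&& used (legs D) h, h != (u, 0) & h != (v, i)] ==>
           (mate D1 (phi h) == phi (mate D h))
           && (mate D2 (phi h) == phi (mate D h))]]].

End JacobiDiagrams.

(** * Quotients and spans *)

Section Linear.
Variables (K : fieldType) (V : vectType K).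

(* The quotient of [V] by [R], modelled on a complement of [R]. *)
Definition quotv (R : {vspace V}) : vectType K := subvs_of R^C%VS.

Definition classv (R : {vspace V}) (x : V) : quotv R :=
  vsproj R^C%VS (daddv_pi R^C R x).

Definition reprv (R : {vspace V}) (x : quotv R) : V := vsval x.

Lemma complv_cap (R : {vspace V}) : (R^C :&: R = 0)%VS.
Proof. by rewrite capvC capv_compl. Qed.

Lemma classv_linear R : linear (@classv R).
Proof. by move=> a x y; rewrite /classv !linearP. Qed.

HB.instance Definition _ R :=
  GRing.isLinear.Build K V (quotv R) _ (@classv R) (@classv_linear R).

Lemma reprvK R : cancel (@reprv R) (@classv R).
Proof.
move=> x; rewrite /classv daddv_pi_id ?complv_cap ?subvsP //.
exact: vsvalK.
Qed.

Lemma classv_eq0 R x : (@classv R x == 0) = (x \in R).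
Proof.
have dx : daddv_pi R^C R x + daddv_pi R R^C x = x.
  by rewrite daddv_pi_add ?complv_cap // addvC addv_complf memvf.
have vE : vsval (@classv R x) = daddv_pi R^C R x by rewrite vsprojK ?memv_pi.
apply/eqP/idP => [c0|xR].
  by rewrite -dx -vE c0 linear0 add0r memv_pi.
apply: val_inj; rewrite /= vE.
have e : daddv_pi R R^C x = x by rewrite daddv_pi_id // capv_compl.
by apply: (addIr x); rewrite add0r -{2}e dx.
Qed.

Lemma ex_span (I : Type) (F : I -> V) : exists W : {vspace V},
  (forall i, F i \in W) /\
  (forall U : {vspace V}, (forall i, F i \in U) -> (W <= U)%VS).
Proof.
suff H k : forall s : seq I, (\dim (fullv : {vspace V}) - \dim <<map F s>> <= k)%N ->
    exists W : {vspace V}, (forall i, F i \in W) /\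
     (forall U : {vspace V}, (forall i, F i \in U) -> (W <= U)%VS).
  exact: (H _ [::] (leqnn _)).
have done_ s : (forall i, F i \in <<map F s>>%VS) -> exists W : {vspace V},
    (forall i, F i \in W) /\
    (forall U : {vspace V}, (forall i, F i \in U) -> (W <= U)%VS).
  move=> Fs; exists <<map F s>>%VS; split=> // U FU; apply/span_subvP.
  by elim: s {Fs} => //= i s IHs x; rewrite inE => /predU1P[->|/IHs].
elim: k => [|k IHk] s hk;
  (have [/done_//|nF] := pselect (forall i, F i \in <<map F s>>%VS)).
  exfalso; apply: nF => i.
  have /eqP -> : <<map F s>>%VS == fullv; last exact: memvf.
  by rewrite eqEdim subvf -subn_eq0 -leqn0.
have [i /negP nFi] : exists i, ~ F i \in <<map F s>>%VS by apply/existsNP.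
apply: (IHk (i :: s)); rewrite /= leq_subLR.
have lt : (\dim <<map F s>> < \dim <<F i :: map F s>>)%N.
  rewrite ltn_neqAle dimvS ?span_cons ?addvSr // andbT -span_cons.
  apply: contra nFi => /eqP dimE.
  have /eqP -> : (<<map F s>> == <<F i :: map F s>>)%VS.
    by rewrite eqEdim dimE span_cons addvSr /= leqnn.
  by rewrite memv_span ?mem_head.
by move: hk; rewrite leq_subLR => hk; apply: leq_trans hk _;
   rewrite addnS -addSn leq_add2r.
Qed.

(* The linear span of an arbitrary family. *)
Definition span_family (I : Type) (F : I -> V) : {vspace V} :=
  projT1 (cid (ex_span F)).

Lemma mem_span_family (I : Type) (F : I -> V) i : F i \in span_family F.
Proof. by case: (projT2 (cid (ex_span F))) => H _; apply: H. Qed.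

Lemma span_family_sub (I : Type) (F : I -> V) (U : {vspace V}) :
  (forall i, F i \in U) -> (span_family F <= U)%VS.
Proof. by case: (projT2 (cid (ex_span F))) => _; apply. Qed.

End Linear.

(** * The spaces A_d(n) *)

Section Spaces.
Variables (K : fieldType) (d : nat).

Definition free_space n : vectType K := {ffun diagram d n -> K^o}.

Definition dvec n (D : diagram d n) : free_space n := [ffun D' => (D' == D)%:R].

Definition relations n : {vspace free_space n} :=
  (<<[seq dvec p.1 - dvec p.2
      | p in [pred p : diagram d n * diagram d n | diagram_iso p.1 p.2]]>>
   + <<[seq dvec p.1.1 - (dvec p.1.2 - dvec p.2)
      | p in [pred p : diagram d n * diagram d n * diagram d n
              | STU p.1.1 p.1.2 p.2]]>>)%VS.

Definition jacobi n : vectType K := quotv (relations n).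

Definition class n (D : diagram d n) : jacobi n := classv (relations n) (dvec D).

(** * Functoriality *)

Section Functoriality.
Variables (m n : nat) (f : free_hom n m).

Definition image_word (j : 'I_n) : seq (letter m) := val (f (free_gen j)).

(* [Tagged _ p : copy] at tag [j] is the copy coming from the p-th letter of
   f(x_j) (counted from the left). *)
Definition copy := {j : 'I_n & 'I_(size (image_word j))}.

Definition copy_letter (c : copy) : letter m :=
  tnth (in_tuple (image_word (tag c))) (tagged c).
Definition copy_arc (c : copy) : 'I_m := (copy_letter c).1.
Definition copy_reversed (c : copy) : bool := (copy_letter c).2.

Section Placement.
Variable D : diagram d m.

Definition is_placement (pl : {ffun vertex d -> option copy}) :=
  [forall v, if pl v is Some c then v \in legs D (copy_arc c)
             else ~~ univalent (legs D) v].

Definition placement := {pl : {ffun vertex d -> option copy} | is_placement pl}.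

Variable pl : placement.

Definition copy_legs (c : copy) : seq (vertex d) :=
  let s := [seq v <- legs D (copy_arc c) | val pl v == Some c] in
  if copy_reversed c then rev s else s.

Definition placed_legs (j : 'I_n) : seq (vertex d) :=
  flatten [seq copy_legs (Tagged (fun j => 'I_(size (image_word j))) p)
          | p <- rev (enum 'I_(size (image_word j)))].

Definition placement_sign : K :=
  (-1) ^+ #|[set v | if val pl v is Some c then copy_reversed c else false]|.

Lemma mem_copy_legs c v :
  (v \in copy_legs c) = (v \in legs D (copy_arc c)) && (val pl v == Some c).
Proof.
by rewrite /copy_legs; case: ifP => _; rewrite ?mem_rev mem_filter andbC.
Qed.

Lemma mem_placed_legs j v : reflect
  (exists2 p, val pl v = Some (Tagged (fun j => 'I_(size (image_word j))) p)
     & v \in legs D (copy_arc (Tagged (fun j => 'I_(size (image_word j))) (i := j) p)))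
  (v \in placed_legs j).
Proof.
apply: (iffP flatten_mapP) => [[p _]|[p pv vp]].
  by rewrite mem_copy_legs => /andP[vp /eqP pv]; exists p.
exists p; first by rewrite mem_rev mem_enum.
by rewrite mem_copy_legs vp pv eqxx.
Qed.

Lemma placed_legs_ok : legs_ok placed_legs.
Proof.
apply/andP; split.
  apply/forallP => j; rewrite /placed_legs.
  have : uniq (rev (enum 'I_(size (image_word j)))) by rewrite rev_uniq enum_uniq.
  elim: rev => //= p s IHs /andP[ps us]; rewrite cat_uniq {}IHs // andbT.
  apply/andP; split.
    have /andP[/forallP uD _] := legsP D.
    by rewrite /copy_legs; case: ifP => _; rewrite ?rev_uniq filter_uniq.
  apply: contra ps => /hasP[v /flatten_mapP[q qs]] /=.
  rewrite !mem_copy_legs => /andP[_ /eqP ->] /andP[_ /eqP[]].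
  by move/eqP; rewrite eq_Tagged /= => /eqP <-.
apply/forallP => i; apply/forallP => j; apply/forallP => v; apply/implyP.
case/andP=> /mem_placed_legs[p pv _] /mem_placed_legs[q]; rewrite pv.
by case=> ij _ _; rewrite ij.
Qed.

Lemma univalent_placed_legs : univalent placed_legs =1 univalent (legs D).
Proof.
move=> v; have := forallP (valP pl) v.
case pv: (val pl v) => [[j p]|] h.
  transitivity true; last by apply/esym/existsP; exists (copy_arc (existT _ j p)).
  by apply/existsP; exists j; apply/mem_placed_legs; exists p.
rewrite (negPf h); apply/negbTE/existsPn => j.
by apply/mem_placed_legs => -[p]; rewrite pv.
Qed.

Definition place : diagram d n := reattach placed_legs_ok univalent_placed_legs.

End Placement.

Definition jacobi_map_dvec (D : diagram d m) : jacobi n :=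
  \sum_(pl : placement D) placement_sign pl *: class (place pl).

(* The map A_d(f).  The linear extension of [jacobi_map_dvec] vanishes on
   [relations m], so the choice of representatives is immaterial; likewise
   unreduced words for the f(x_j) would give the same map. *)
Definition jacobi_map (x : jacobi m) : jacobi n :=
  \sum_D reprv x D *: jacobi_map_dvec D.

End Functoriality.

(** * Aut(F_n)-submodules *)

Section Submodules.
Variable n : nat.

Definition Aut_submodule (U : {vspace jacobi n}) :=
  forall g : free_hom n n, bijective g ->
  forall u, u \in U -> jacobi_map g u \in U.

(* W is the direct sum of U1 and U2 as Aut(F_n)-modules. *)
Definition direct_decomposition (W U1 U2 : {vspace jacobi n}) :=
  [/\ Aut_submodule W, Aut_submodule U1, Aut_submodule U2,
      (U1 + U2)%VS = W & directv (U1 + U2)].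

Definition indecomposable (W : {vspace jacobi n}) :=
  W <> 0%VS /\
  ~ exists U1 U2, [/\ direct_decomposition W U1 U2, U1 <> 0%VS & U2 <> 0%VS].

Definition generated_submodule m (X : jacobi m) : {vspace jacobi n} :=
  span_family (fun f : free_hom n m => jacobi_map f X).

End Submodules.

End Spaces.

(** * The elements P and Q *)

Section ChordDiagrams.
Variable d : nat.

(* A perfect matching of [{0, ..., 2d - 1}], given by its partner function. *)
Definition matching_on (M : nat -> nat) :=
  forall i, (i < d.*2)%N -> [/\ (M i < d.*2)%N, M i <> i & M (M i) = i].

Variables (M : nat -> nat) (okM : matching_on M).

Definition partner (i : vertex d) : vertex d :=
  let: And3 lt _ _ := okM (ltn_ord i) in Ordinal lt.

Lemma val_partner i : partner i = M i :> nat.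
Proof. by rewrite /partner; case: okM. Qed.

Definition chord_legs (i : 'I_d.*2) : seq (vertex d) := [:: i].

Definition chord_mate (h : half_edge d) : half_edge d :=
  if h.2 == 0 then (partner h.1, 0) else h.

Lemma univalent_chord v : univalent chord_legs v.
Proof. by apply/existsP; exists v; rewrite mem_head. Qed.

Lemma chord_legs_ok : legs_ok chord_legs.
Proof.
apply/andP; split; apply/forallP => i //; apply/forallP => j; apply/forallP => v.
by rewrite /chord_legs !inE; apply/implyP => /andP[/eqP <-].
Qed.

Lemma chord_mate_ok : mate_ok chord_legs chord_mate.
Proof.
apply/forallP => -[v i]; rewrite /used !univalent_chord /chord_mate /=.
have [_ ne inv] := okM (ltn_ord v).
case: (altP (i =P 0)) => [->|//]; rewrite eqxx /=.
apply/andP; split; first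
  by apply: contra_notN ne => /eqP/(congr1 (fun h => val h.1)); rewrite /= val_partner.
by rewrite xpair_eqE eqxx andbT -val_eqE /= !val_partner inv.
Qed.

Lemma chord_grounded : grounded chord_legs chord_mate.
Proof. by apply/forallP => v; apply/existsP; exists v; rewrite univalent_chord /=. Qed.

(* The diagram D_M. *)
Definition chord_diagram : diagram d d.*2 :=
  mk_diagram chord_legs_ok chord_mate_ok chord_grounded.

End ChordDiagrams.

Section RenumberArcs.
Variables (d n : nat) (s : {perm 'I_n}) (D : diagram d n).

(* The arc numbered [i] in [D] is numbered [s i] in [renumber s D]. *)
Definition renumbered_legs (i : 'I_n) : seq (vertex d) := legs D (s^-1%g i).

Lemma renumbered_legs_ok : legs_ok renumbered_legs.
Proof.
have /andP[/forallP u1 /forallP u2] := legsP D.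
apply/andP; split; apply/forallP => i; first exact: u1.
apply/forallP => j; apply/forallP => v.
have /forallP/(_ (s^-1%g j))/forallP/(_ v) := u2 (s^-1%g i).
by rewrite (inj_eq perm_inj).
Qed.

Lemma univalent_renumbered : univalent renumbered_legs =1 univalent (legs D).
Proof.
move=> v; apply/existsP/existsP => -[i vi]; first by exists (s^-1%g i).
by exists (s i); rewrite /renumbered_legs permK.
Qed.

Definition renumber : diagram d n :=
  reattach renumbered_legs_ok univalent_renumbered.

End RenumberArcs.

(* {0,1}, {2,3}, {4,5}, ... *)
Definition matchP (i : nat) : nat := if odd i then i.-1 else i.+1.
(* {0,3}, {1,2}, {4,5}, ... *)
Definition matchQ1 (i : nat) : nat := if (i < 4)%N then (3 - i)%N else matchP i.
(* {1,3}, {0,2}, {4,5}, ... *)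
Definition matchQ2 (i : nat) : nat :=
  if (i < 2)%N then (i + 2)%N else if (i < 4)%N then (i - 2)%N else matchP i.

Lemma matchP_ge i k : ~~ odd k -> (k <= i)%N -> (k <= matchP i)%N.
Proof.
rewrite /matchP; case: ifP => [oi ok ki|_ _ ki]; last exact: leqW.
case: i oi ki => // i /= oi; rewrite leq_eqVlt => /predU1P[kE|//].
by rewrite kE /= oi in ok.
Qed.

Lemma matchP_lt i k : ~~ odd k -> (i < k)%N -> (matchP i < k)%N.
Proof.
rewrite /matchP; case: ifP => [_ _|oi ok ik]; first by case: i => //= i /ltnW.
rewrite ltn_neqAle ik andbT; apply: contra ok => /eqP <-.
by rewrite /= oi.
Qed.

Lemma matchP_ok d : matching_on d matchP.
Proof.
move=> i lti; split; first by apply: matchP_lt; rewrite ?odd_double.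
  rewrite /matchP; case: ifP => [|_]; last by apply/eqP; rewrite gtn_eqF.
  by case: i {lti} => // i _; apply/eqP; rewrite ltn_eqF.
rewrite /matchP; case oi: (odd i) => /=; last by rewrite oi.
by case: i oi {lti} => //= i /negPf ->.
Qed.

Lemma matchQ1_ok d : matching_on d.+2 matchQ1.
Proof.
move=> i lti; case: (ltnP i 4) => [|i4].
  by case: i lti => [|[|[|[|]]]].
have [h1 h2 h3] := matchP_ok lti.
have lt4 := matchP_ge (isT : ~~ odd 4) i4.
have E j : (4 <= j)%N -> matchQ1 j = matchP j by rewrite /matchQ1 leqNgt => /negPf ->.
by rewrite !E.
Qed.

Lemma matchQ2_ok d : matching_on d.+2 matchQ2.
Proof.
move=> i lti; case: (ltnP i 4) => [|i4].
  by case: i lti => [|[|[|[|]]]].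
have [h1 h2 h3] := matchP_ok lti.
have lt4 := matchP_ge (isT : ~~ odd 4) i4.
have E j : (4 <= j)%N -> matchQ2 j = matchP j by case: j => [|[|[|[|]]]].
by rewrite !E.
Qed.

Section PQ.
Variable K : fieldType.

Definition elemP d : jacobi K d d.*2 :=
  \sum_(s : {perm 'I_d.*2})
    class K (renumber s (chord_diagram (@matchP_ok d))).

Definition elemQ d : jacobi K d d.*2 :=
  match d with
  | d'.+2 => class K (chord_diagram (@matchQ1_ok d'))
             - class K (chord_diagram (@matchQ2_ok d'))
  | _ => 0
  end.

Definition AP d n : {vspace jacobi K d n} := generated_submodule n (elemP d).
Definition AQ d n : {vspace jacobi K d n} := generated_submodule n (elemQ d).

End PQ.

(* Main.v *)
(** A placement of the legs of a chord diagram ignores which legs are joined, so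
    A_d(f) acts on the positions of the 2d legs and commutes with changing the
    matching of the legs.  Hence replacing the matching by the sum of all matchings
    and killing the diagrams with trivalent vertices is a natural endomorphism; it is
    compatible with STU, since the two resolutions have the same leg positions up to a
    relabelling.  It is multiplication by (2d)! on AP and zero on AQ, and any two
    matchings are related by switches, i.e. agree modulo AQ; this gives the
    decomposition.

    For n >= 2d both summands are generated, over Aut(F_n), by a combination X of
    chord diagrams with one leg on each of the first 2d arcs.  It suffices that every
    q annihilated by all operators (combinations of automorphisms) annihilating X is a
    multiple of X.  Since X is odd under each x_i -> x_i^-1, i <= 2d, so is q, which
    forces q to be a combination of chord diagrams of the same shape.  For AP one
    averages over the symmetric group.  For AQ, X is alternating under (1 2) and under
    (3 4), and for each chord {a, c} shared by its two diagrams it is killed by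
    [b, a] + [b, c] (the 4T relation).  A weight system which sees one trivalent vertex
    turns this into the invariance of the coefficients of q under transpositions (a b),
    and therefore under (1 2) or (3 4), on all matchings without the chord {a, c}; so
    these coefficients vanish and q is a multiple of X. *)
From HB Require Import structures.
From mathcomp Require Import all_boot all_order all_fingroup all_algebra.
From mathcomp Require Import ring.
Require Import Defs.

Set Implicit Arguments.
Unset Strict Implicit.
Unset Printing Implicit Defensive.

Import GRing.Theory.
Local Open Scope ring_scope.

(** Why annihilators suffice: if a summand splits as U1 + U2 and X = q1 + q2 accordingly, an
    operator T with T X = 0 has T q1 = - T q2 in both U1 and U2, hence T q1 = 0. So q1 = a X, and X
    lies in U2 (a = 0) or in U1; as X generates, the other part is zero. Why oddness fixes the
    shape: q is half of q minus its flip, which cancels every diagram whose flipped arc is empty. A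
    diagram of degree d has 2d vertices, so if none of the first 2d arcs is empty, every vertex is a
    leg, alone on its arc. The obstacle for AQ: coefficients must be read in a quotient, where STU
    ties chord diagrams with two legs on one arc to diagrams with trivalent vertices. Only
    functionals compatible with STU can extract them; commuting two legs creates one trivalent
    vertex, so a weight system that stops there is enough. Matchings with all the shared chords
    leave three pairings of the legs 1, 2, 3, 4: two get opposite coefficients, and {1,2},{3,4} is
    fixed by (1 2), so its coefficient is zero. Matchings are treated as permutations, so that
    renaming vertices becomes conjugation. *)

Section Quotients.
Variables (K : fieldType) (V W : vectType K).

Lemma mem_lker_linfun (f : {linear V -> W}) x : f x = 0 -> x \in lker (linfun f).
Proof. by move=> fx; rewrite memv_ker lfunE /= fx. Qed.

Lemma lker_linfun_mem (f : {linear V -> W}) x : x \in lker (linfun f) -> f x = 0.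
Proof. by rewrite memv_ker lfunE => /eqP. Qed.

Lemma eq_classv (R : {vspace V}) x y : x - y \in R -> classv R x = classv R y.
Proof. by rewrite -classv_eq0 linearB subr_eq0 => /eqP. Qed.

Lemma classv_reprv (R : {vspace V}) x : reprv (classv R x) - x \in R.
Proof. by rewrite -classv_eq0 linearB /= reprvK subrr. Qed.

End Quotients.

(** * Linear maps on the quotient, defined diagram by diagram *)

Section Lift.
Variables (K : fieldType) (d n : nat) (W : vectType K) (F : diagram d n -> W).

Definition jacobi_lift (x : jacobi K d n) : W := \sum_D reprv x D *: F D.

Lemma jacobi_lift_linear : linear jacobi_lift.
Proof.
move=> a x y; rewrite /jacobi_lift scaler_sumr -big_split; apply: eq_bigr => D _.
by rewrite /reprv linearP !ffunE scalerDl scalerA.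
Qed.

HB.instance Definition _ :=
  GRing.isLinear.Build K (jacobi K d n) W _ jacobi_lift jacobi_lift_linear.

Hypothesis F_iso : forall D D', diagram_iso D D' -> F D = F D'.
Hypothesis F_STU : forall D D1 D2, STU D D1 D2 -> F D = F D1 - F D2.

(** Both families spanning [relations] lie in the kernel of the linear extension of [F] to the free
    space, and the representative of [class K D] differs from [dvec K D] by a relation. *)
Lemma jacobi_liftE D : jacobi_lift (class K D) = F D.
Proof.
pose G (x : free_space K d n) : W := \sum_D x D *: F D.
have G_lin : linear G.
  move=> a x y; rewrite /G scaler_sumr -big_split; apply: eq_bigr => E _.
  by rewrite !ffunE scalerDl scalerA.
pose G' := GRing.isLinear.Build K _ W _ G G_lin.
pose GL : {linear free_space K d n -> W} := HB.pack G G'.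
have GB : {morph G : x y / x - y} by exact: (raddfB GL).
have Gd E : G (dvec K E) = F E.
  rewrite /G (bigD1 E) //= big1 ?addr0 => [|E' /negPf E'E]; rewrite ffunE ?eqxx ?scale1r //.
  by rewrite E'E scale0r.
have relG : (relations K d n <= lker (linfun GL))%VS.
  rewrite /relations subv_add; apply/andP; split; apply/span_subvP => _ /imageP[p hp ->];
    apply: mem_lker_linfun; apply: etrans (GB _ _) _; rewrite Gd.
    by rewrite (F_iso hp) Gd; apply: subrr.
  by rewrite (F_STU hp) GB (Gd p.1.2) (Gd p.2); apply: subrr.
have /(subvP relG)/lker_linfun_mem := classv_reprv (relations K d n) (dvec K D).
by rewrite [LHS]GB Gd => /eqP; rewrite subr_eq0 => /eqP.
Qed.

End Lift.

(** * Classes of diagrams given by raw legs and mates *)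

Section Classes.
Variables (K : fieldType) (d n : nat).
Implicit Types (D : diagram d n).

Lemma class_iso D D' : diagram_iso D D' -> class K D = class K D'.
Proof.
move=> h; apply: eq_classv; apply: (subvP (addvSl _ _)).
by apply/memv_span/imageP; exists (D, D').
Qed.

Lemma class_STU D D1 D2 : STU D D1 D2 -> class K D = class K D1 - class K D2.
Proof.
move=> h; rewrite /class -linearB; apply: eq_classv; apply: (subvP (addvSr _ _)).
by apply/memv_span/imageP; exists (D, D1, D2).
Qed.

Lemma class_span (x : jacobi K d n) : x = \sum_D reprv x D *: class K D.
Proof.
rewrite -{1}(reprvK x) -[X in X = _]/(classv (relations K d n) (reprv x)).
have {1}-> : reprv x = \sum_D reprv x D *: dvec K D.
  apply/ffunP => D; rewrite sum_ffunE (bigD1 D) //= big1 ?addr0 => [|E /negPf ED].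
    by rewrite !ffunE eqxx; exact: esym (mulr1 _).
  by rewrite !ffunE eq_sym ED; exact: mulr0.
by rewrite linear_sum; apply: eq_bigr => D _; rewrite linearZ.
Qed.

Lemma diagram_eq D D' :
  (forall i, legs D i = legs D' i) -> mate D =1 mate D' -> D = D'.
Proof.
case: D D' => [[l e] h] [[l' e'] h']; rewrite /legs /mate /= => ll ee.
apply: val_inj; congr pair; last exact/ffunP.
by apply/ffunP => i; apply/val_inj/ll.
Qed.

(* Junk value [0] when [L] and [e] are not the legs and the mate of a diagram. *)
Definition dclass (L : 'I_n -> seq (vertex d)) (e : half_edge d -> half_edge d) :
    jacobi K d n :=
  \sum_(D : diagram d n | [forall i, legs D i == L i] && [forall h, mate D h == e h])
     class K D.

Lemma eq_dclass L L' e e' : L =1 L' -> e =1 e' -> dclass L e = dclass L' e'.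
Proof.
move=> LL ee; apply: eq_bigl => D.
by congr andb; apply: eq_forallb => h; rewrite ?LL ?ee.
Qed.

Lemma dclassE D L e : legs D =1 L -> mate D =1 e -> dclass L e = class K D.
Proof.
move=> lL me; rewrite /dclass (big_pred1 D) // => D' /=.
apply/idP/eqP => [/andP[/forallP l /forallP m]| ->].
  by apply: diagram_eq => h; rewrite ?(eqP (l h)) ?(eqP (m h)) ?lL ?me.
by apply/andP; split; apply/forallP => h; rewrite ?lL ?me.
Qed.

Lemma dclass_mem L e : dclass L e != 0 -> exists D, legs D =1 L /\ mate D =1 e.
Proof.
have [D /andP[/forallP l /forallP m]|no] := pickP [pred D : diagram d n
   | [forall i, legs D i == L i] && [forall h, mate D h == e h]].
  by exists D; split=> h; apply/eqP.
by rewrite /dclass big_pred0 ?eqxx.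
Qed.

End Classes.

(** * Placements as plain functions *)

Section RawPlacements.
Variables (K : fieldType) (d m n : nat) (f : free_hom n m).
Implicit Types (s : {perm vertex d}) (L : 'I_m -> seq (vertex d)) (pl : {ffun vertex d -> option (copy f)}).

(** The type [placement f D] varies with [D]; functions from vertices to copies can be compared
    between the diagrams of an isomorphism or of an STU relation. *)
Definition placing L pl :=
  [forall v, if pl v is Some c then v \in L (copy_arc c) else ~~ univalent L v].

Definition clegs L pl (c : copy f) : seq (vertex d) :=
  let s := [seq v <- L (copy_arc c) | pl v == Some c] in
  if copy_reversed c then rev s else s.

Definition plegs L pl (j : 'I_n) : seq (vertex d) :=
  flatten [seq clegs L pl (Tagged (fun j => 'I_(size (image_word f j))) p)
          | p <- rev (enum 'I_(size (image_word f j)))].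

Definition psign pl : K :=
  (-1) ^+ #|[set v | if pl v is Some c then copy_reversed c else false]|.

Lemma jacobi_map_dvecE (D : diagram d m) :
  jacobi_map_dvec K f D =
  \sum_(pl | placing (legs D) pl) psign pl *: dclass K (plegs (legs D) pl) (mate D).
Proof.
rewrite [RHS](reindex_omap (val : placement f D -> _) insub); last first.
  by move=> pl plP; rewrite insubT.
apply: eq_big => [pl|pl _].
  by rewrite valK eqxx andbT; apply/esym/(valP pl).
by congr (_ *: _); apply/esym/dclassE => h; rewrite ?legs_mk ?mate_mk.
Qed.

Lemma eq_plegs L L' pl : L =1 L' -> plegs L pl =1 plegs L' pl.
Proof.
by move=> LL j; rewrite /plegs; congr flatten; apply: eq_map => p; rewrite /clegs LL.
Qed.

Lemma eq_placing L L' pl : L =1 L' -> placing L pl = placing L' pl.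
Proof.
move=> LL; apply: eq_forallb => v; case: (pl v) => [c|]; first by rewrite LL.
by congr negb; apply: eq_existsb => i; rewrite LL.
Qed.

Lemma placed (D : diagram d m) pl : placing (legs D) pl ->
  exists D', legs D' =1 plegs (legs D) pl /\ mate D' =1 mate D.
Proof.
move=> plP; exists (place (Sub pl plP : placement f D)).
by split=> h; rewrite ?legs_mk ?mate_mk.
Qed.

Lemma univalent_map (s : {perm vertex d}) L L' v :
  (forall i, L' i = map s (L i)) -> univalent L' (s v) = univalent L v.
Proof. by move=> LL; apply: eq_existsb => i; rewrite LL mem_map //; apply: perm_inj. Qed.

Definition transport (s : {perm vertex d}) pl : {ffun vertex d -> option (copy f)} :=
  [ffun v => pl (s^-1%g v)].

Lemma transportE s pl v : transport s pl v = pl (s^-1%g v).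
Proof. exact: ffunE. Qed.

Lemma transportK s : cancel (transport s) (transport s^-1%g).
Proof. by move=> pl; apply/ffunP => v; rewrite !transportE invgK permK. Qed.

Lemma psign_transport s pl : psign (transport s pl) = psign pl.
Proof.
congr (_ ^+ _); rewrite -[RHS](card_imset _ (@perm_inj _ s)); apply: eq_card => v.
rewrite inE transportE; apply/idP/imsetP => [h|[w]]; last by rewrite inE => h ->; rewrite permK.
by exists (s^-1%g v); rewrite ?permKV ?inE.
Qed.

Section Transport.
Variables (s : {perm vertex d}) (L L' : 'I_m -> seq (vertex d)).
Hypothesis LL : forall i, L' i = map s (L i).

Lemma placing_transport pl : placing L' (transport s pl) = placing L pl.
Proof.
apply/forallP/forallP => h v.
  have := h (s v); rewrite transportE permK; case: (pl v) => [c|].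
    by rewrite LL mem_map //; apply: perm_inj.
  by rewrite (univalent_map v LL).
have := h (s^-1%g v); rewrite transportE; case: (pl _) => [c|].
  by rewrite LL -{2}(permKV s v) mem_map //; apply: perm_inj.
by rewrite -(univalent_map _ LL) permKV.
Qed.

Lemma plegs_transport pl j : plegs L' (transport s pl) j = map s (plegs L pl j).
Proof.
rewrite /plegs map_flatten -map_comp; congr flatten; apply: eq_map => p /=.
rewrite /clegs LL filter_map.
under eq_filter => v do rewrite /= transportE permK.
by case: ifP => //; rewrite map_rev.
Qed.

End Transport.

(** [transport s] is a sign-preserving bijection between the placements of the two diagrams, and the
    pair [(s, r)] is also an isomorphism between the placed diagrams. *)
Lemma jacobi_map_dvec_iso (D D' : diagram d m) :
  diagram_iso D D' -> jacobi_map_dvec K f D = jacobi_map_dvec K f D'.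
Proof.
move=> /existsP[s /existsP[r /and3P[/forallP rP /forallP sP /forallP mP]]].
have LL i : legs D' i = map s (legs D i) by apply/eqP.
rewrite !jacobi_map_dvecE [RHS](reindex (transport s)); last first.
  exists (transport s^-1%g) => pl _; first exact: transportK.
  by rewrite -{1}(invgK s); apply: transportK.
apply: eq_big => [pl|pl plP]; first by rewrite (placing_transport LL).
have [E [lE mE]] := placed plP.
have [|E' [lE' mE']] := @placed D' (transport s pl); first by rewrite (placing_transport LL).
congr (_ *: _); first by rewrite psign_transport.
apply: etrans (dclassE K lE mE) _; apply: etrans _ (esym (dclassE K lE' mE')).
apply: class_iso; apply/existsP; exists s; apply/existsP; exists r.
apply/and3P; split; apply/forallP => v.
- apply/implyP => uv; apply: (implyP (rP v)); move: uv.
  have [E0 [lE0 _]] := placed plP.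
  rewrite /univalent; under eq_existsb do rewrite lE.
  by have := univalent_placed_legs (Sub pl plP : placement f D) v; rewrite /univalent => <-.
- by rewrite lE' lE (plegs_transport LL).
- by rewrite mE' mE; apply: mP.
Qed.

End RawPlacements.

(** * The action on classes of diagrams *)

Section Subst2.
Variable T : eqType.
Implicit Types (u v x y w : T) (l : seq T).

(** This is the list surgery called [double] in [STU]. *)
Definition subst2 u x y l := flatten [seq if w == u then [:: x; y] else [:: w] | w <- l].

Lemma subst2_cons u x y w l :
  subst2 u x y (w :: l) = (if w == u then [:: x; y] else [:: w]) ++ subst2 u x y l.
Proof. by []. Qed.

Lemma subst2_cat u x y l1 l2 : subst2 u x y (l1 ++ l2) = subst2 u x y l1 ++ subst2 u x y l2.
Proof. by rewrite /subst2 map_cat flatten_cat. Qed.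

Lemma subst2_flatten u x y (ss : seq (seq T)) :
  subst2 u x y (flatten ss) = flatten (map (subst2 u x y) ss).
Proof. by elim: ss => //= l ss <-; apply: subst2_cat. Qed.

Lemma subst2_id u x y l : u \notin l -> subst2 u x y l = l.
Proof.
elim: l => // w l IHl; rewrite inE negb_or subst2_cons eq_sym => /andP[/negPf -> /IHl ->].
by [].
Qed.

Lemma rev_subst2 u x y l : rev (subst2 u x y l) = subst2 u y x (rev l).
Proof.
elim: l => // w l IHl; rewrite subst2_cons rev_cat IHl rev_cons -cats1 subst2_cat.
by congr cat; rewrite subst2_cons cats0; case: ifP.
Qed.

Lemma filter_subst2 u x y (p q : pred T) l :
  p x = q u -> p y = q u -> {in l, forall w, w != u -> p w = q w} ->
  filter p (subst2 u x y l) = subst2 u x y (filter q l).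
Proof.
move=> px py; elim: l => // w l IHl h; rewrite subst2_cons filter_cat IHl; last first.
  by move=> z zl; apply: h; rewrite inE zl orbT.
rewrite [filter q _]/=; case: eqP => [->|/eqP wu] /=.
  by rewrite px py; case: (q u) => //=; rewrite subst2_cons eqxx.
by rewrite h ?mem_head //; case: (q w) => //=; rewrite subst2_cons (negPf wu).
Qed.

(** Once at most one of the two new entries survives the filter, their order is lost. *)
Lemma filter_subst2C u x y (p : pred T) l :
  ~~ (p x && p y) -> filter p (subst2 u x y l) = filter p (subst2 u y x l).
Proof.
move=> pxy; elim: l => // w l IHl; rewrite !subst2_cons !filter_cat IHl; congr cat.
by case: ifP => //= _; case: (p x) (p y) pxy => [] [].
Qed.

Lemma mem_subst2 u x y l w :
  (w \in subst2 u x y l) = (u \in l) && (w \in [:: x; y]) || (w \in l) && (w != u).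
Proof.
elim: l => // z l IHl; rewrite subst2_cons mem_cat IHl !(in_cons z l).
have [->|zu] := eqVneq z u.
  rewrite /=; case: (w \in [:: x; y]) => //=; rewrite andbF /=.
  by case: (w =P u) => [->|]; rewrite ?andbF ?orbF.
rewrite mem_seq1 /=; case: eqP => [->|_] //=.
by rewrite zu orbT.
Qed.

End Subst2.

(** * The two resolutions in an STU relation *)

Section STUFacts.
Variables (d n : nat) (D D1 D2 : diagram d n) (u v : vertex d) (i : 'I_3).

Definition STU_shift (h : half_edge d) : half_edge d :=
  if h == (v, i + 1) then (v, 0) else if h == (v, i + 2) then (u, 0) else h.

Hypothesis uu : univalent (legs D) u.
Hypothesis vv : ~~ univalent (legs D) v.
Hypothesis l1 : forall k, legs D1 k = subst2 u u v (legs D k).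
Hypothesis l2 : forall k, legs D2 k = subst2 u v u (legs D k).

Lemma STU_neq : u != v.
Proof. by apply: contraNneq vv => <-. Qed.

Lemma STU_new_leg k : v \notin legs D k.
Proof. by apply: contra vv => vk; apply/existsP; exists k. Qed.

Lemma STU_mem_legs k w :
  (w \in legs D1 k = (w \in legs D k) || (w == v) && (u \in legs D k))
  * (w \in legs D2 k = (w \in legs D k) || (w == v) && (u \in legs D k)).
Proof.
rewrite l1 l2 !mem_subst2 !inE; have [->|wu] /= := eqVneq w u.
  by rewrite (negPf STU_neq) /= !andbT !andbF !orbF.
by rewrite orbF andbT orbC [_ && (w == v)]andbC.
Qed.

Lemma STU_univalent w :
  (univalent (legs D1) w = univalent (legs D) w || (w == v))
  * (univalent (legs D2) w = univalent (legs D) w || (w == v)).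
Proof.
have E k : (w \in legs D1 k) = (w \in legs D2 k) by rewrite !STU_mem_legs.
suff H : univalent (legs D1) w = univalent (legs D) w || (w == v).
  by split=> //; rewrite -H; apply: eq_existsb => k; rewrite E.
apply/existsP/orP => [[k]|[/existsP[k wk]|/eqP ->]].
- rewrite STU_mem_legs => /orP[wk|/andP[-> _]]; last by right.
  by left; apply/existsP; exists k.
- by exists k; rewrite STU_mem_legs wk.
- by have /existsP[k uk] := uu; exists k; rewrite STU_mem_legs eqxx uk orbT.
Qed.

Hypothesis mm : forall h, [&& used (legs D) h, h != (u, 0) & h != (v, i)] ->
  (mate D1 (STU_shift h) = STU_shift (mate D h))
  /\ (mate D2 (STU_shift h) = STU_shift (mate D h)).

(** The mate equations of [STU] therefore reach every used half-edge, so they determine the mates of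
    [D1] and [D2], which must agree. *)
Lemma STU_shift_onto h : used (legs D1) h ->
  exists2 h0, [&& used (legs D) h0, h0 != (u, 0) & h0 != (v, i)] & STU_shift h0 = h.
Proof.
have ord3 : ((i + 1 == i) = false) * ((i + 2 == i) = false) * ((i + 2 == i + 1) = false).
  by case: i => -[|[|[]]].
case: h => w k; rewrite /used STU_univalent /= => hu.
have [wv|wv] := eqVneq w v.
  move: hu; rewrite wv eqxx orbT /= => /eqP ->; exists (v, i + 1).
    by rewrite (negPf vv) !xpair_eqE [v == u]eq_sym (negPf STU_neq) /= ord3 eqxx.
  by rewrite /STU_shift eqxx.
have [wu|wu] := eqVneq w u.
  move: hu; rewrite wu uu /= => /eqP ->; exists (v, i + 2).
    by rewrite (negPf vv) !xpair_eqE [v == u]eq_sym (negPf STU_neq) /= ord3 eqxx.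
  by rewrite /STU_shift xpair_eqE eqxx ord3 eqxx.
exists (w, k); last by rewrite /STU_shift !xpair_eqE (negPf wv).
by rewrite !xpair_eqE (negPf wu) (negPf wv) /= andbT; move: hu; rewrite (negPf wv) orbF.
Qed.

Lemma STU_mate : mate D1 =1 mate D2.
Proof.
have uE h : used (legs D1) h = used (legs D2) h by rewrite /used !STU_univalent.
move=> h; have [uh|nuh] := boolP (used (legs D1) h).
  by have [h0 /mm[m1 m2] <-] := STU_shift_onto uh; rewrite m1 m2.
have := forallP (mateP D1) h; have := forallP (mateP D2) h.
by rewrite -uE (negPf nuh) => /eqP -> /eqP ->.
Qed.

End STUFacts.

(** * Compatibility of A_d(f) with STU *)

Section STUPlacements.
Variables (K : fieldType) (d m n : nat) (f : free_hom n m).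
Implicit Types (pl : {ffun vertex d -> option (copy f)}).

Definition leg_sign (x : option (copy f)) : K :=
  if x is Some c then (-1) ^+ copy_reversed c else 1.

Lemma psignE pl : psign K pl = \prod_w leg_sign (pl w).
Proof.
rewrite /psign -prodr_const big_mkcond; apply: eq_bigr => w _.
by rewrite inE /leg_sign; case: (pl w) => // c; case: copy_reversed.
Qed.

Lemma univalent_plegs (D : diagram d m) pl : placing (legs D) pl ->
  univalent (plegs (legs D) pl) =1 univalent (legs D).
Proof. by move=> plP; apply: (univalent_placed_legs (Sub pl plP : placement f D)). Qed.

Variables (D D1 D2 : diagram d m) (u v : vertex d) (i : 'I_3).
Hypothesis uu : univalent (legs D) u.
Hypothesis vv : ~~ univalent (legs D) v.
Hypothesis l1 : forall k, legs D1 k = subst2 u u v (legs D k).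
Hypothesis l2 : forall k, legs D2 k = subst2 u v u (legs D k).
Hypothesis ui : mate D (u, 0) = (v, i).
Hypothesis mm : forall h, [&& used (legs D) h, h != (u, 0) & h != (v, i)] ->
  (mate D1 (STU_shift u v i h) = STU_shift u v i (mate D h))
  /\ (mate D2 (STU_shift u v i h) = STU_shift u v i (mate D h)).

(** [dup_place] sends the new leg [v] to the copy chosen for [u]. It turns placements of [D] into
    the placements of [D1] that keep [u] and [v] together; [cut_place] is its inverse there. *)
Definition dup_place pl : {ffun vertex d -> option (copy f)} :=
  [ffun w => if w == v then pl u else pl w].
Definition cut_place pl : {ffun vertex d -> option (copy f)} :=
  [ffun w => if w == v then None else pl w].

Lemma dup_placeE pl w : dup_place pl w = if w == v then pl u else pl w.
Proof. exact: ffunE. Qed.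

Lemma cut_placeE pl w : cut_place pl w = if w == v then None else pl w.
Proof. exact: ffunE. Qed.

Let uv : u != v := STU_neq uu vv.
Let mem_legs := STU_mem_legs uu vv l1 l2.

Lemma psign_dup pl : pl v = None -> psign K (dup_place pl) = leg_sign (pl u) * psign K pl.
Proof.
move=> plv; rewrite !psignE (bigD1 v) //= [in RHS](bigD1 v) //= plv mul1r.
rewrite dup_placeE eqxx; congr (_ * _); apply: eq_bigr => w /negPf wv.
by rewrite dup_placeE wv.
Qed.

Lemma placing_STU pl : placing (legs D2) pl = placing (legs D1) pl.
Proof.
apply: eq_forallb => w; case: (pl w) => [c|]; first by rewrite !mem_legs.
by rewrite !(STU_univalent uu vv l1 l2).
Qed.

Lemma placing_dup pl : placing (legs D1) (dup_place pl) && (cut_place (dup_place pl) == pl)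
  = placing (legs D) pl.
Proof.
have uD := STU_univalent uu vv l1 l2.
apply/idP/idP => [/andP[/forallP plP /eqP cutP]|/forallP plP].
  have plv : pl v = None by rewrite -cutP cut_placeE eqxx.
  apply/forallP => w; have := plP w; rewrite dup_placeE.
  have [-> _|wv] := eqVneq w v; first by rewrite plv.
  by case: (pl w) => [c|]; rewrite ?mem_legs ?uD (negPf wv) ?orbF.
have plv : pl v = None.
  have := plP v; case: (pl v) => // c vc.
  by case/negP: vv; apply/existsP; exists (copy_arc c).
apply/andP; split.
  apply/forallP => w; rewrite dup_placeE; have [->|wv] := eqVneq w v.
    by have := plP u; case: (pl u) => [c uc|]; rewrite ?uu // mem_legs eqxx uc orbT.
  by have := plP w; case: (pl w) => [c|]; rewrite ?mem_legs ?uD (negPf wv) ?orbF.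
by apply/eqP/ffunP => w; rewrite cut_placeE dup_placeE; case: eqP => // ->.
Qed.

Lemma plegs_split pl : pl u != pl v -> plegs (legs D1) pl =1 plegs (legs D2) pl.
Proof.
move=> pluv j; rewrite /plegs; congr flatten; apply: eq_map => p.
rewrite /clegs l1 l2 filter_subst2C //=.
by apply: contra pluv => /andP[/eqP -> /eqP ->].
Qed.

Lemma plegs_dup pl c0 j : pl v = None -> pl u = Some c0 ->
  let x := if copy_reversed c0 then v else u in let y := if copy_reversed c0 then u else v in
  (plegs (legs D1) (dup_place pl) j = subst2 u x y (plegs (legs D) pl j))
  * (plegs (legs D2) (dup_place pl) j = subst2 u y x (plegs (legs D) pl j)).
Proof.
move=> plv plu x y; rewrite /plegs !subst2_flatten -!map_comp.
have E p z t : z \in [:: u; v] -> t \in [:: u; v] ->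
  filter (fun w => dup_place pl w == Some p) (subst2 u z t (legs D (copy_arc p)))
  = subst2 u z t (filter (fun w => pl w == Some p) (legs D (copy_arc p))).
  have dE w : w \in [:: u; v] -> dup_place pl w = pl u.
    by rewrite !inE dup_placeE => /orP[/eqP->|/eqP->]; rewrite ?eqxx ?(negPf uv).
  move=> zuv tuv; apply: filter_subst2; rewrite ?dE // => w wD wu.
  rewrite dup_placeE ifN //; apply: contraTneq wD => ->.
  exact: STU_new_leg vv _.
have G p : (clegs (legs D1) (dup_place pl) p = subst2 u x y (clegs (legs D) pl p))
    * (clegs (legs D2) (dup_place pl) p = subst2 u y x (clegs (legs D) pl p)).
  rewrite /clegs l1 l2 !E ?inE ?eqxx ?orbT //; have [->|pc0] := eqVneq p c0.
    by rewrite /x /y; case: copy_reversed; rewrite // !rev_subst2.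
  have U : u \notin [seq w <- legs D (copy_arc p) | pl w == Some p].
    by rewrite mem_filter plu; apply: contra pc0 => /andP[/eqP[->]].
  by case: copy_reversed; rewrite !subst2_id ?mem_rev.
by split; congr flatten; apply: eq_map => p; rewrite /= G.
Qed.

(** A reversed copy receives the two new legs in the opposite order, which exchanges the roles of
    [D1] and [D2]; but the additional leg on it also contributes a sign -1, and the two effects
    cancel. *)
Lemma class_place_STU pl : placing (legs D) pl ->
  psign K pl *: dclass K (plegs (legs D) pl) (mate D) =
  psign K (dup_place pl) *: dclass K (plegs (legs D1) (dup_place pl)) (mate D1)
  - psign K (dup_place pl) *: dclass K (plegs (legs D2) (dup_place pl)) (mate D2).
Proof.
move=> plP; have := plP; rewrite -placing_dup => /andP[plP1 /eqP cutP].
have plv : pl v = None by rewrite -cutP cut_placeE eqxx.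
have [c0 plu] : exists c0, pl u = Some c0.
  by have := forallP plP u; case: (pl u) => [c _|]; [exists c | rewrite uu].
have [E [lE mE]] := placed plP.
have [E1 [lE1 mE1]] := placed plP1.
have [|E2 [lE2 mE2]] := @placed _ _ _ _ D2 (dup_place pl); first by rewrite placing_STU.
have uE w : univalent (legs E) w = univalent (legs D) w.
  by rewrite -(univalent_plegs plP); apply: eq_existsb => k; rewrite lE.
have STU_E F1 F2 : (forall k, legs F1 k = subst2 u u v (legs E k)) ->
    (forall k, legs F2 k = subst2 u v u (legs E k)) -> mate F1 =1 mate D1 -> mate F2 =1 mate D2 ->
    STU E F1 F2.
  move=> h1 h2 m1 m2; apply/existsP; exists u; apply/existsP; exists v; apply/existsP; exists i.
  apply/and5P; split; rewrite ?uE // ?mE ?ui //.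
    by apply/forallP => k; rewrite h1 h2 !eqxx.
  apply/forallP => h; apply/implyP => hh.
  have [|e1 e2] := @mm h; first by move: hh; rewrite /used uE.
  by rewrite m1 m2 mE; apply/andP; split; apply/eqP.
rewrite -scalerBr psign_dup // plu mulrC -scalerA; congr (_ *: _).
rewrite (dclassE K lE mE) (dclassE K lE1 mE1) (dclassE K lE2 mE2) /=.
have := plegs_dup _ plv plu; case: copy_reversed => /= H.
  rewrite expr1 scaleN1r opprB; apply: class_STU; apply: STU_E => k.
  - by rewrite lE2 H lE.
  - by rewrite lE1 H lE.
  - by rewrite mE2 (STU_mate uu vv l1 l2 mm).
  - by rewrite mE1 (STU_mate uu vv l1 l2 mm).
by rewrite scale1r; apply: class_STU; apply: STU_E => // k; rewrite ?lE1 ?lE2 H lE.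
Qed.

Lemma jacobi_map_dvec_STU_at :
  jacobi_map_dvec K f D = jacobi_map_dvec K f D1 - jacobi_map_dvec K f D2.
Proof.
rewrite !jacobi_map_dvecE [X in _ - X](eq_bigl (placing (legs D1))); last exact: placing_STU.
(* Placements that separate [u] and [v] give the same diagram for [D1] and [D2], so they cancel; the
   others are indexed by placements of [D]. *)
rewrite -sumrB [RHS](bigID (fun pl => pl u == pl v)) /= [X in _ + X]big1 ?addr0; last first.
  move=> pl /andP[_ /plegs_split E].
  by rewrite -scalerBr (eq_dclass K E (STU_mate uu vv l1 l2 mm)) subrr scaler0.
rewrite [RHS](reindex_onto dup_place cut_place) /=; last first.
  move=> pl /andP[_ /eqP pluv]; apply/ffunP => w.
  by rewrite dup_placeE !cut_placeE (negPf uv) pluv; case: eqP => // ->.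
apply: eq_big => [pl|]; last exact: class_place_STU.
by rewrite -placing_dup !dup_placeE eqxx (negPf uv) eqxx andbT.
Qed.

End STUPlacements.

Section JacobiMap.
Variables (K : fieldType) (d m n : nat) (f : free_hom n m).

Lemma STU_witness n' (D D1 D2 : diagram d n') : STU D D1 D2 ->
  exists u v i, [/\ univalent (legs D) u, ~~ univalent (legs D) v, mate D (u, 0) = (v, i),
    (forall k, legs D1 k = subst2 u u v (legs D k)) /\
    (forall k, legs D2 k = subst2 u v u (legs D k))
  & forall h, [&& used (legs D) h, h != (u, 0) & h != (v, i)] ->
     (mate D1 (STU_shift u v i h) = STU_shift u v i (mate D h))
     /\ (mate D2 (STU_shift u v i h) = STU_shift u v i (mate D h))].
Proof.
case/existsP=> u /existsP[v /existsP[i /and5P[uu vv /eqP ui /forallP l /forallP mm]]].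
exists u, v, i; split=> //; first by split=> k; have /andP[/eqP h1 /eqP h2] := l k.
by move=> h hh; have /andP[/eqP h1 /eqP h2] := implyP (mm h) hh.
Qed.

Lemma jacobi_map_dvec_STU (D D1 D2 : diagram d m) : STU D D1 D2 ->
  jacobi_map_dvec K f D = jacobi_map_dvec K f D1 - jacobi_map_dvec K f D2.
Proof.
by case/STU_witness=> u [v [i [uu vv ui [l1 l2] mm]]]; apply: (jacobi_map_dvec_STU_at K f uu vv l1 l2 ui mm).
Qed.

(** Invariance under isomorphism and STU makes the choice of representative in [jacobi_map]
    irrelevant. *)
Lemma jacobi_map_class (D : diagram d m) :
  jacobi_map f (class K D) =
  \sum_(pl : {ffun vertex d -> option (copy f)} | placing (legs D) pl) psign K pl *: dclass K (plegs (legs D) pl) (mate D).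
Proof.
rewrite -jacobi_map_dvecE.
exact: (jacobi_liftE (@jacobi_map_dvec_iso K d m n f) jacobi_map_dvec_STU D).
Qed.

HB.instance Definition _ := GRing.isLinear.Build K (jacobi K d m) (jacobi K d n) _
  (@jacobi_map K d m n f) (jacobi_lift_linear (jacobi_map_dvec K f)).

End JacobiMap.

(** * Chord diagrams span *)

Section Resolution.
Variables (d n : nat) (D : diagram d n) (u v : vertex d) (i : 'I_3).
Hypothesis uu : univalent (legs D) u.
Hypothesis vv : ~~ univalent (legs D) v.
Hypothesis ui : mate D (u, 0) = (v, i).

Notation shift := (STU_shift u v i).

(** Inverse of [STU_shift], from the used half-edges of a resolution to those of [D] off the removed
    edge. *)
Definition STU_unshift (h : half_edge d) : half_edge d :=
  if h == (v, 0) then (v, i + 1) else if h == (u, 0) then (v, i + 2) else h.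
Notation unshift := STU_unshift.

Definition resolved_mate (h : half_edge d) : half_edge d :=
  if (h.1 == v) && (h.2 != 0) then h else shift (mate D (unshift h)).

Let good (h : half_edge d) := [&& used (legs D) h, h != (u, 0) & h != (v, i)].

Let uv : u != v := STU_neq uu vv.

Let ord3 : ((i + 1 == i) = false) * ((i + 2 == i) = false) * ((i + 2 == i + 1) = false).
Proof. by case: i => -[|[|[]]]. Qed.

Let ord3_cases (k : 'I_3) : k != i -> k != i + 1 -> k = i + 2.
Proof. by move=> ki ki1; apply/eqP; move: ki ki1; case: i k => -[|[|[|//]]] ? [[|[|[|//]]] ?]. Qed.

Lemma mate_used (E : diagram d n) h : used (legs E) h ->
  [/\ used (legs E) (mate E h), mate E h != h & mate E (mate E h) = h].
Proof. by move=> uh; have := forallP (mateP E) h; rewrite uh => /and3P[? ? /eqP]. Qed.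

Lemma mate_unused (E : diagram d n) h : ~~ used (legs E) h -> mate E h = h.
Proof. by move=> /negPf uh; have := forallP (mateP E) h; rewrite uh => /eqP. Qed.

Let used_v k : used (legs D) (v, k).
Proof. by rewrite /used (negPf vv). Qed.

Let used_u : used (legs D) (u, 0).
Proof. by rewrite /used uu. Qed.

Let vi : mate D (v, i) = (u, 0).
Proof. by have [_ _] := mate_used used_u; rewrite ui. Qed.

Let good_mate h : good h -> good (mate D h).
Proof.
case/and3P=> uh hu hv; have [umh _ mmh] := mate_used uh; rewrite /good umh /=.
apply/andP; split.
  by apply: contra hv => /eqP E; rewrite -mmh E ui.
by apply: contra hu => /eqP E; rewrite -mmh E vi.
Qed.

Variables (x y : vertex d).
Hypothesis xy : (x == u) && (y == v) || (x == v) && (y == u).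

(** [(x, y)] is [(u, v)] or [(v, u)], so that both resolutions are built at once. *)
Definition resolved_legs k := subst2 u x y (legs D k).
Notation L := resolved_legs.

Lemma mem_resolved_legs k w : (w \in L k) = (w \in legs D k) || (w == v) && (u \in legs D k).
Proof.
rewrite mem_subst2 !inE; have -> : (w == x) || (w == y) = (w == u) || (w == v).
  by case/orP: xy => /andP[/eqP -> /eqP ->] //; rewrite orbC.
have [->|wu] /= := eqVneq w u; first by rewrite (negPf uv) andbT !andbF !orbF.
by rewrite andbT orbC [_ && (w == v)]andbC.
Qed.

Lemma univalent_resolved w : univalent L w = univalent (legs D) w || (w == v).
Proof.
apply/existsP/orP => [[k]|[/existsP[k wk]|/eqP ->]].
- rewrite mem_resolved_legs => /orP[wk|/andP[-> _]]; last by right.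
  by left; apply/existsP; exists k.
- by exists k; rewrite mem_resolved_legs wk.
- by have /existsP[k uk] := uu; exists k; rewrite mem_resolved_legs eqxx uk orbT.
Qed.

Lemma uniq_resolved k : uniq (L k).
Proof.
have uk : uniq (legs D k) by have /andP[/forallP h _] := legsP D; apply: h.
have vk : v \notin legs D k := STU_new_leg vv k.
rewrite /L; elim: (legs D k) uk vk => // w l IHl /andP[wl ul].
rewrite in_cons negb_or => /andP[vw vl]; rewrite subst2_cons cat_uniq IHl // andbT.
have [wu|wu] := eqVneq w u.
  rewrite subst2_id -?wu //=; apply/andP; split.
    by case/orP: xy => /andP[/eqP -> /eqP ->]; rewrite mem_seq1 ?[v == u]eq_sym ?(negPf uv).
  apply/hasPn => z zl; rewrite !inE.
  by case/orP: xy => /andP[/eqP -> /eqP ->]; rewrite -wu negb_or;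
    apply/andP; split; apply: contraTneq zl => -> .
rewrite /=; apply: contra wl => /hasP[z] /[swap]; rewrite mem_seq1 => /eqP ->.
rewrite mem_subst2 => /orP[/andP[_]|/andP[]//].
by case/orP: xy => /andP[/eqP -> /eqP ->]; rewrite !inE (negPf wu) eq_sym (negPf vw).
Qed.

Lemma resolved_legs_ok : legs_ok L.
Proof.
have /andP[_ /forallP dis] := legsP D.
have disj k k' w : w \in legs D k -> w \in legs D k' -> k = k'.
  by move=> h h'; have /forallP/(_ k')/forallP/(_ w) := dis k; rewrite h h' => /eqP.
apply/andP; split; apply/forallP => k; first exact: uniq_resolved.
apply/forallP => k'; apply/forallP => w; apply/implyP; rewrite !mem_resolved_legs.
have vk j := STU_new_leg vv j.
have [->|wv] /= := eqVneq w v.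
  by rewrite !(negPf (vk _)) /= => /andP[h h']; apply/eqP/(disj _ _ _ h h').
by rewrite !orbF => /andP[h h']; apply/eqP/(disj _ _ _ h h').
Qed.

Lemma STU_shiftK h : good h -> unshift (shift h) = h.
Proof.
case/and3P=> uh hu hv; rewrite /STU_shift; case: ifP => [/eqP ->|h1].
  by rewrite /unshift eqxx.
case: ifP => [/eqP ->|h2].
  by rewrite /unshift xpair_eqE (negPf uv) /= eqxx.
rewrite /unshift (negPf hu); case: eqP => // hv0.
move: hv h1 h2 {hu uh}; rewrite hv0 !xpair_eqE eqxx /= => a /negbT b c.
by move: c; rewrite (ord3_cases a b) eqxx.
Qed.

Lemma used_shift h : good h -> used L (shift h).
Proof.
case/and3P=> uh hu hv; rewrite /used univalent_resolved /STU_shift.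
case: ifP => [_|h1] /=; first by rewrite eqxx implybT.
case: ifP => [_|h2] /=; first by rewrite eqxx implybT.
have [hv1|hv1] := eqVneq h.1 v; last by rewrite orbF.
exfalso; move: hv h1 h2 {hu uh}; case: h hv1 => w k /= ->.
by rewrite !xpair_eqE !eqxx /= => a /negbT b; rewrite (ord3_cases a b) eqxx.
Qed.

Lemma good_unshift h : used L h -> good (unshift h) && (shift (unshift h) == h).
Proof.
case: h => w k; rewrite /used univalent_resolved /= /unshift => hu.
case: ifP => [/eqP ->|h1].
  by rewrite /good used_v /STU_shift !xpair_eqE !eqxx [v == u]eq_sym (negPf uv) /= ord3.
case: ifP => [/eqP ->|h2].
  by rewrite /good used_v /STU_shift !xpair_eqE !eqxx [v == u]eq_sym (negPf uv) /= !ord3 /= eqxx.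
have wv : w != v.
  apply: contraFneq h1 => wv; move: hu; rewrite wv eqxx orbT => /eqP ->.
  by rewrite eqxx.
rewrite /good h2 /STU_shift !xpair_eqE (negPf wv) !eqxx /= andbT.
by rewrite ?andbT /used /=; move: hu; rewrite (negPf wv) orbF.
Qed.

Lemma resolved_mate_used h : used L h -> resolved_mate h = shift (mate D (unshift h)).
Proof.
rewrite /resolved_mate /used univalent_resolved; case: eqP => [->|//].
by rewrite orbT /= => /eqP ->; rewrite eqxx.
Qed.

Lemma resolved_mate_ok : mate_ok L resolved_mate.
Proof.
apply/forallP => h; case: ifPn => uh.
  have /andP[gh /eqP sh] := good_unshift uh; have gm := good_mate gh.
  have um := used_shift gm; rewrite (resolved_mate_used uh) um /=.
  have /and3P[/mate_used[_ ne mm] _ _] := gh; apply/andP; split.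
    by apply: contra ne => /eqP E; rewrite -{1}(STU_shiftK gm) E.
  by rewrite resolved_mate_used // STU_shiftK // mm sh.
rewrite /resolved_mate; case: ifP => // hv.
move: uh; rewrite /used univalent_resolved negb_imply => /andP[uh1 h2].
have hv1 : h.1 != v by move: hv; rewrite h2 andbT => ->.
move: uh1; rewrite (negPf hv1) orbF => uh1.
have E w : h == (w, 0) = false by case: h h2 {hv uh1 hv1} => a b /= b0; rewrite xpair_eqE (negPf b0) andbF.
have E' k : h == (v, k) = false by case: h hv1 {hv uh1 h2 E} => a b /= b0; rewrite xpair_eqE (negPf b0).
rewrite /unshift !E mate_unused ?/STU_shift ?E' //.
by rewrite /used uh1 (negPf h2).
Qed.

(** A path of [D] to a leg either survives or is cut at an edge that now ends at [u] or [v], and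
    these are legs. *)
Lemma resolved_grounded : grounded L resolved_mate.
Proof.
apply/forallP => w; have /existsP[z /andP[uz /connectP[p wp zE]]] := forallP (groundedP D) w.
elim: p w wp zE => [|w' p IHp] w /= => [_ zE|/andP[/existsP[k /eqP wk] w'p] zE].
  by apply/existsP; exists z; rewrite univalent_resolved uz zE connect0.
have [uw|nuw] := boolP (univalent L w); first by apply/existsP; exists w; rewrite uw connect0.
have /andP[nuwD wv] : ~~ univalent (legs D) w && (w != v) by rewrite -negb_or -univalent_resolved.
have uk : used L (w, k) by rewrite /used (negPf nuw).
have adj : adjacent resolved_mate w (shift (mate D (w, k))).1.
  apply/existsP; exists k; rewrite resolved_mate_used // /unshift.
  have wu : w != u by apply: contraNneq nuwD => ->.
  by rewrite !xpair_eqE (negPf wv) (negPf wu).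
have [w's|] := boolP ((shift (mate D (w, k))).1 == w').
  have /existsP[t /andP[ut ct]] := IHp w' w'p zE.
  apply/existsP; exists t; rewrite ut; apply: connect_trans ct; apply: connect1.
  by rewrite -(eqP w's).
move=> ne; apply/existsP; exists (shift (mate D (w, k))).1; rewrite connect1 // andbT.
move: ne; rewrite -wk /STU_shift; case: ifP => [|_]; first by rewrite univalent_resolved eqxx orbT.
case: ifP => [|_]; last by rewrite eqxx.
by rewrite univalent_resolved uu.
Qed.

Definition resolved : diagram d n :=
  mk_diagram resolved_legs_ok resolved_mate_ok resolved_grounded.

Lemma resolved_STU h : good h -> mate resolved (shift h) = shift (mate D h).
Proof. by move=> gh; rewrite mate_mk resolved_mate_used ?used_shift // STU_shiftK. Qed.

End Resolution.

Section Span.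
Variables (d n : nat).
Implicit Types D : diagram d n.

Lemma STU_resolve D u v i : univalent (legs D) u -> ~~ univalent (legs D) v ->
  mate D (u, 0) = (v, i) ->
  exists D1 D2, [/\ STU D D1 D2, legs D1 =1 (fun k => subst2 u u v (legs D k)),
    legs D2 =1 (fun k => subst2 u v u (legs D k)),
    mate D1 =1 resolved_mate D u v i & mate D2 =1 resolved_mate D u v i].
Proof.
move=> uu vv ui.
have xy1 : (u == u) && (v == v) || (u == v) && (v == u) by rewrite !eqxx.
have xy2 : (v == u) && (u == v) || (v == v) && (u == u) by rewrite !eqxx orbT.
exists (resolved uu vv ui xy1), (resolved uu vv ui xy2).
split; try by [move=> h; rewrite mate_mk | move=> k; rewrite legs_mk].
apply/existsP; exists u; apply/existsP; exists v; apply/existsP; exists i.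
apply/and5P; split=> //; first by rewrite ui.
  by apply/forallP => k; rewrite !legs_mk !eqxx.
by apply/forallP => h; apply/implyP => gh; rewrite -!/(STU_shift u v i _) !resolved_STU // !eqxx.
Qed.

Definition chordal D := [forall v, univalent (legs D) v].

(** On a path from a trivalent vertex to a leg, take the last trivalent vertex before the first
    leg. *)
Lemma trivalent_next_to_leg D : ~~ chordal D ->
  exists u v i, [/\ univalent (legs D) u, ~~ univalent (legs D) v & mate D (u, 0) = (v, i)].
Proof.
case/forallPn=> v0 vv0; have /existsP[z /andP[uz /connectP[p vp zE]]] := forallP (groundedP D) v0.
elim: p v0 vv0 vp zE => [|w p IHp] v vv /=; first by move=> _ zv; rewrite -zv uz in vv.
case/andP=> /existsP[k /eqP vk] wp zE.
have [uw|/IHp] := boolP (univalent (legs D) w); last exact.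
have uk : used (legs D) (v, k) by rewrite /used (negPf vv).
have [+ _ mm] := mate_used uk.
move: vk mm; case: (mate D (v, k)) => w' k' /= -> mm; rewrite /used uw /= => /eqP k0.
by exists w, v, k; split=> //; rewrite -k0.
Qed.

(** Induction on the number of trivalent vertices: resolving one that is adjacent to a leg makes it
    univalent in both terms. *)
Lemma chordal_span (K : fieldType) (W : {vspace jacobi K d n}) :
  (forall D, chordal D -> class K D \in W) -> W = fullv.
Proof.
move=> cW; suff H D : class K D \in W.
  apply/eqP; rewrite eqEsubv subvf; apply/subvP => x _; rewrite (class_span x).
  by apply: memv_suml => D _; apply/memvZ/H.
have [k] := ubnP #|[pred v | ~~ univalent (legs D) v]|.
elim: k D => // k IHk D; rewrite ltnS => hk.
have [/cW //|/trivalent_next_to_leg[u [v [i [uu vv ui]]]]] := boolP (chordal D).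
have [D1 [D2 [stu l1 l2 _ _]]] := STU_resolve uu vv ui.
have lt (E : diagram d n) : (forall w, univalent (legs E) w = univalent (legs D) w || (w == v)) ->
    (#|[pred w | ~~ univalent (legs E) w]| < k)%N.
  move=> uE; apply: leq_trans hk; apply: proper_card; apply/properP; split.
    by apply/subsetP => w; rewrite !inE uE negb_or => /andP[].
  by exists v; rewrite !inE ?uE ?vv // eqxx orbT.
rewrite (class_STU K stu) rpredB //; apply: IHk; apply: lt => w.
  by rewrite (STU_univalent uu vv l1 l2).
by rewrite (STU_univalent uu vv l1 l2).
Qed.

End Span.

(** * Homomorphisms of free groups *)

Section FreeHom.
Variables (n m : nat).
Local Open Scope group_scope.

Section Extend.
Variable ws : 'I_n -> free_group m.

Definition letter_image (a : letter n) : free_group m := if a.2 then (ws a.1)^-1 else ws a.1.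

Definition word_image (w : seq (letter n)) : free_group m :=
  foldr (fun a x => letter_image a * x) 1 w.

Lemma letter_image_inv a : letter_image (inv_letter a) = (letter_image a)^-1.
Proof. by case: a => i [] //=; rewrite /letter_image /= invgK. Qed.

Lemma word_image_cons a w : word_image (cons_reduced a w) = letter_image a * word_image w.
Proof.
case: w => //= b w; case: eqP => [->|//].
by rewrite letter_image_inv mulgA mulgV mul1g.
Qed.

Lemma word_image_mul u v : word_image (mul_word u v) = word_image u * word_image v.
Proof.
elim: u => [|a u IHu] /=; first by rewrite mul1g.
by rewrite word_image_cons IHu mulgA.
Qed.

Definition free_extend (u : free_group n) : free_group m := word_image (val u).

Lemma free_extendM : {morph free_extend : u v / u * v}.
Proof. by move=> u v; rewrite /free_extend -word_image_mul. Qed.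

HB.instance Definition _ :=
  isMultiplicative.Build (free_group n) (free_group m) free_extend free_extendM.

End Extend.

Definition free_ext ws : free_hom n m := free_extend ws.

Lemma free_ext_gen ws i : free_ext ws (free_gen i) = ws i.
Proof. by rewrite /free_ext /= /free_extend /= /letter_image /= mulg1. Qed.

Lemma free_hom1 (f : free_hom n m) : f 1 = 1.
Proof. by apply: (mulgI (f 1)); rewrite -gmulfM !mulg1. Qed.

Lemma free_homV (f : free_hom n m) u : f u^-1 = (f u)^-1.
Proof. by apply: (mulgI (f u)); rewrite -gmulfM !mulgV free_hom1. Qed.

Lemma free_hom_ext (f : free_hom n m) u : f u = free_ext (fun i => f (free_gen i)) u.
Proof.
case: u => w rw; rewrite /free_ext /= /free_extend /=.
elim: w rw => [|a w IHw] rw /=.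
  by rewrite -[RHS](free_hom1 f); congr (f _); apply: val_inj.
rewrite -(IHw (reduced_behead rw)).
have -> : letter_image (fun i => f (free_gen i)) a = f (Sub [:: a] isT).
  case: a {rw} => i []; rewrite /letter_image //= -free_homV; congr (f _).
  exact: val_inj.
rewrite -gmulfM; congr (f _); apply: val_inj.
by rewrite [RHS]/= cons_reduced_id.
Qed.

End FreeHom.

Section FreeAut.
Variable n : nat.
Implicit Types (i j e k : 'I_n) (s : {perm 'I_n}).
Local Open Scope group_scope.

Lemma eq_free_ext (ws ws' : 'I_n -> free_group n) : ws =1 ws' -> free_ext ws =1 free_ext ws'.
Proof.
move=> E u; rewrite /free_ext /= /free_extend; elim: (val u) => //= a w ->.
by congr (_ * _); rewrite /letter_image E.
Qed.

Lemma free_ext_cancel (ws ws' : 'I_n -> free_group n) :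
  (forall i, free_ext ws' (ws i) = free_gen i) -> cancel (free_ext ws) (free_ext ws').
Proof.
move=> E u; pose f : free_hom n n := free_ext ws' \o free_ext ws.
rewrite -[LHS]/(f u) free_hom_ext.
have -> : free_ext (fun i => f (free_gen i)) u = free_ext (@free_gen n) u.
  by apply: eq_free_ext => i; exact: etrans (congr1 (free_ext ws') (free_ext_gen ws i)) (E i).
by rewrite -(free_hom_ext (idfun : free_hom n n)).
Qed.

Lemma free_ext_bij (ws ws' : 'I_n -> free_group n) :
  (forall i, free_ext ws' (ws i) = free_gen i) -> (forall i, free_ext ws (ws' i) = free_gen i) ->
  bijective (free_ext ws).
Proof. by move=> E E'; exists (free_ext ws'); apply: free_ext_cancel. Qed.

Definition perm_hom s : free_hom n n := free_ext (fun i => free_gen (s i)).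

Lemma perm_hom_bij s : bijective (perm_hom s).
Proof.
by apply: (@free_ext_bij _ (fun i => free_gen (s^-1 i))) => i;
   rewrite free_ext_gen ?permK ?permKV.
Qed.

Definition flip_hom k : free_hom n n :=
  free_ext (fun i => if i == k then (free_gen i)^-1 else free_gen i).

Lemma flip_hom_bij k : bijective (flip_hom k).
Proof.
have E i : flip_hom k (if i == k then (free_gen i)^-1 else free_gen i) = free_gen i.
  case: eqP => [->|/eqP/negPf ik]; rewrite ?free_homV free_ext_gen ?eqxx ?invgK ?ik //.
exact: (free_ext_bij E E).
Qed.

(** A Nielsen automorphism. Arcs are concatenated from the rightmost letter, so [b = true] (the word
    x_e x_j) puts the legs of arc [e] after those of arc [j]. *)
Definition slide_hom (b : bool) j e : free_hom n n :=
  free_ext (fun i => if i == j then (if b then free_gen e * free_gen j else free_gen j * free_gen e)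
                     else free_gen i).

Lemma slide_hom_bij b j e : e != j -> bijective (slide_hom b j e).
Proof.
move=> /negPf ej; pose ws i := if i == j then
  (if b then (free_gen e)^-1 * free_gen j else free_gen j * (free_gen e)^-1) else free_gen i.
apply: (@free_ext_bij _ ws) => i; rewrite /ws; have [->|/negPf ij] := eqVneq i j;
  rewrite ?free_ext_gen ?ij //; case: (b); rewrite gmulfM ?free_homV !free_ext_gen ej eqxx.
- by rewrite mulgA mulgV mul1g.
- by rewrite -mulgA mulVg mulg1.
- by rewrite mulgA mulVg mul1g.
- by rewrite -mulgA mulgV mulg1.
Qed.

Lemma image_perm_hom s j : image_word (perm_hom s) j = [:: (s j, false)].
Proof. by rewrite /image_word free_ext_gen. Qed.

Lemma image_flip_hom k j : image_word (flip_hom k) j = [:: (j, j == k)].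
Proof. by rewrite /image_word free_ext_gen; case: eqP. Qed.

Lemma image_slide_hom b j e i : image_word (slide_hom b j e) i =
  if i == j then (if b then [:: (e, false); (j, false)] else [:: (j, false); (e, false)])
  else [:: (i, false)].
Proof.
rewrite /image_word free_ext_gen; case: eqP => // _.
by case: b; rewrite /= xpair_eqE andbF.
Qed.

End FreeAut.

(** * Homomorphisms realizing a given arrangement of legs *)

Section ArrangementHom.
Variables (n m : nat) (L : 'I_n -> seq 'I_m).

Lemma reduced_positive (l : seq 'I_m) : reduced [seq (v, false) | v <- l].
Proof.
by case: l => //= v l; elim: l v => //= w l IHl v; rewrite xpair_eqE andbF IHl.
Qed.

(** The list is reversed because the arcs are concatenated from the rightmost letter: the legs then
    appear along arc [i] in the order of [L i]. *)
Definition arrangement_hom : free_hom n m :=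
  free_ext (fun i => Sub [seq (v, false) | v <- rev (L i)] (reduced_positive (rev (L i)))).

Lemma image_arrangement_hom j :
  image_word arrangement_hom j = [seq (v, false) | v <- rev (L j)].
Proof. by rewrite /image_word free_ext_gen. Qed.

End ArrangementHom.

(** * A_d(f) when no arc repeats in an image word *)

Section SimpleMap.
Variables (K : fieldType) (d m n : nat) (f : free_hom n m) (L : 'I_m -> seq (vertex d)).
Implicit Types (t : {ffun vertex d -> option 'I_n}) (pl : {ffun vertex d -> option (copy f)}).
(* When no arc occurs twice in an image word, a placement amounts to a choice of
   the target arc of each leg. *)
Definition tag_placing t := [forall v,
  if t v is Some j then has (fun a => v \in L a.1) (image_word f j) else ~~ univalent L v].

Definition tag_legs t j : seq (vertex d) :=
  flatten [seq let s := [seq v <- L a.1 | t v == Some j] in if a.2 then rev s else s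
          | a <- rev (image_word f j)].

Definition tag_sign t : K :=
  \prod_v (if t v is Some j then
             (-1) ^+ has (fun a => (v \in L a.1) && a.2) (image_word f j) else 1).

End SimpleMap.

Section SimpleMapClass.
Variables (K : fieldType) (d m n : nat) (f : free_hom n m) (D : diagram d m).
Implicit Types (t : {ffun vertex d -> option 'I_n}) (pl : {ffun vertex d -> option (copy f)}).
Hypothesis f_simple : forall j, uniq (unzip1 (image_word f j)).

Notation L := (legs D).

Definition tags_of pl : {ffun vertex d -> option 'I_n} := [ffun v => omap (@tag _ _) (pl v)].

Definition of_tags t : {ffun vertex d -> option (copy f)} :=
  [ffun v => if t v is Some j then [pick c : copy f | (tag c == j) && (v \in L (copy_arc c))]
             else None].

Lemma legs_inj i j v : v \in L i -> v \in L j -> i = j.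
Proof.
have /andP[_ /forallP/(_ i)/forallP/(_ j)/forallP/(_ v)] := legsP D.
by move=> /implyP h vi vj; apply/eqP/h; rewrite vi vj.
Qed.

(** A leg lies on a single arc, which occurs at most once in each image word; so the target arc
    alone determines the copy. *)
Lemma copy_inj (c c' : copy f) v :
  tag c = tag c' -> v \in L (copy_arc c) -> v \in L (copy_arc c') -> c = c'.
Proof.
case: c c' => j p [j' p'] /= jj; rewrite -{j'}jj in p' *.
move=> /legs_inj h /h; rewrite /copy_arc /copy_letter /=.
have x0 := tnth (in_tuple (image_word f j)) p.
rewrite !(tnth_nth x0) /= => E; congr existT; apply/val_inj/eqP.
rewrite -(nth_uniq x0.1 _ _ (f_simple j)) ?size_map ?ltn_ord //.
by rewrite !(nth_map x0) ?ltn_ord //; apply/eqP.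
Qed.

Lemma has_copy (p : pred (letter m)) j :
  reflect (exists2 c : copy f, tag c = j & p (copy_letter c)) (has p (image_word f j)).
Proof.
apply: (iffP hasP) => [[a aj pa]|[c <- pc]]; last first.
  by exists (copy_letter c) => //; apply/(tnthP (in_tuple _)); exists (tagged c).
have /(tnthP (in_tuple _))[k ak] := aj.
by exists (Tagged (fun j => 'I_(size (image_word f j))) k) => //; rewrite /copy_letter /= -ak.
Qed.

Lemma of_tagsE t v j (c : copy f) : t v = Some j -> tag c = j -> v \in L (copy_arc c) ->
  of_tags t v = Some c.
Proof.
move=> tv cj vc; rewrite ffunE tv; case: pickP => [c' /andP[/eqP c'j vc']|/(_ c)].
  by congr Some; apply: copy_inj vc' vc; rewrite c'j.
by rewrite cj eqxx vc.
Qed.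

Lemma jacobi_map_simple :
  jacobi_map f (class K D) =
  \sum_(t | tag_placing f L t) tag_sign K f L t *: dclass K (tag_legs f L t) (mate D).
Proof.
rewrite jacobi_map_class (reindex_onto of_tags tags_of) /=; last first.
  move=> pl /forallP plP; apply/ffunP => v; have := plP v.
  case plv : (pl v) => [c|] vc; last by rewrite !ffunE plv.
  by apply: (@of_tagsE _ _ (tag c)) => //; rewrite ffunE plv.
apply: eq_big => [t|t /andP[/forallP plP /eqP tP]].
  apply/andP/forallP => [[/forallP plP /eqP tP] v|tP].
    have := plP v; have -> : t v = omap (@tag _ _) (of_tags t v) by rewrite -{1}tP ffunE.
    by case: (of_tags t v) => //= c vc; apply/has_copy; exists c.
  have H v : if t v is Some j then exists c, [/\ of_tags t v = Some c, tag c = j & v \in L (copy_arc c)]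
             else of_tags t v = None.
    have := tP v; case tv : (t v) => [j|]; last by rewrite ffunE tv.
    by case/has_copy => c cj vc; exists c; split=> //; apply: (of_tagsE tv).
  split; last first.
    apply/eqP/ffunP => v; rewrite ffunE; have := H v.
    by case: (t v) => [j [c [-> <- _]]|->].
  apply/forallP => v; have := H v; have := tP v.
  by case: (t v) => [j _ [c [-> _ vc]]|+ ->].
have H v : if of_tags t v is Some c then t v = Some (tag c) /\ v \in L (copy_arc c)
           else t v = None.
  have := plP v; have -> : t v = omap (@tag _ _) (of_tags t v) by rewrite -{1}tP ffunE.
  by case: (of_tags t v).
congr (_ *: _).
  rewrite psignE; apply: eq_bigr => v _; have := H v; rewrite /leg_sign.
  case: (of_tags t v) => [c [-> vc]|-> //]; congr (_ ^+ nat_of_bool _).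
  apply/idP/has_copy => [rc|[c' cc' /andP[vc' rc']]]; first by exists c => //; rewrite vc.
  by rewrite (copy_inj (esym cc') vc vc').
apply: eq_dclass => // j; rewrite /plegs /tag_legs.
rewrite -[image_word f j in RHS](map_tnth_enum (in_tuple (image_word f j))) -map_rev -map_comp.
congr flatten; apply: eq_map => p; rewrite /clegs /=.
set c : copy f := Tagged _ _.
rewrite -/(copy_letter c).
suff -> : [seq v <- L (copy_arc c) | of_tags t v == Some c] = [seq v <- L (copy_letter c).1 | t v == Some j] by [].
apply: eq_in_filter => v vc; have := H v; case: (of_tags t v) => [c' [-> vc']|-> //].
apply/eqP/eqP => [[->]//|[cj]]; congr Some; exact: copy_inj vc' vc.
Qed.

End SimpleMapClass.

(** * Chord diagrams *)

Section Chords.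
Variables (K : fieldType) (d : nat).
Implicit Types (m s : {perm vertex d}) (x : {perm vertex d} -> K).

Definition perfect m := [forall v, (m v != v) && (m (m v) == v)].

Lemma perfectP m : reflect (forall v, m v != v /\ m (m v) = v) (perfect m).
Proof.
apply: (iffP forallP) => H v; first by have /andP[? /eqP] := H v.
by have [-> ->] := H v; rewrite eqxx.
Qed.

Lemma perfectJ m s : perfect (m ^ s)%g = perfect m.
Proof.
apply/perfectP/perfectP => H v.
  by have [] := H (s v); rewrite !permJ (inj_eq perm_inj) => ? /perm_inj.
by rewrite -(permKV s v) !permJ (inj_eq perm_inj); have [? ->] := H (s^-1%g v).
Qed.

Definition perm_mate m (h : half_edge d) : half_edge d := if h.2 == 0 then (m h.1, 0) else h.

Section Arrangements.
Variable n : nat.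
Implicit Types (L : 'I_n -> seq (vertex d)) (D : diagram d n).

Definition arrangement L := legs_ok L && [forall v, univalent L v].

Lemma eq_legs_ok L L' : L =1 L' -> legs_ok L = legs_ok L'.
Proof.
move=> LL; congr andb; apply: eq_forallb => i; rewrite ?LL //.
by apply: eq_forallb => j; apply: eq_forallb => v; rewrite ?LL.
Qed.

Lemma eq_univalent L L' : L =1 L' -> univalent L =1 univalent L'.
Proof. by move=> LL v; apply: eq_existsb => i; rewrite LL. Qed.

Lemma eq_arrangement L L' : L =1 L' -> arrangement L = arrangement L'.
Proof.
move=> LL; rewrite /arrangement (eq_legs_ok LL); congr andb.
by apply: eq_forallb => v; apply: eq_univalent.
Qed.

Lemma legs_arrangement D : arrangement (legs D) = chordal D.
Proof. by rewrite /arrangement legsP. Qed.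

Lemma chord_exists L m : arrangement L -> perfect m ->
  exists D, legs D =1 L /\ mate D =1 perm_mate m.
Proof.
case/andP=> okL /forallP uL /perfectP mP.
have okm : mate_ok L (perm_mate m).
  apply/forallP => -[v k]; rewrite /used uL /perm_mate /=; case: (altP (k =P 0)) => [->|//].
  have [mv mm] := mP v.
  by rewrite eqxx /= uL mm !eqxx xpair_eqE (negPf mv).
have okg : grounded L (perm_mate m).
  by apply/forallP => v; apply/existsP; exists v; rewrite uL connect0.
by exists (mk_diagram okL okm okg); split=> h; rewrite ?legs_mk ?mate_mk.
Qed.

(* Junk value [0] when [m] is not a perfect matching or [L] is not an arrangement. *)
Definition chord L m : jacobi K d n := if perfect m then dclass K L (perm_mate m) else 0.

Lemma chordE L m D : legs D =1 L -> mate D =1 perm_mate m -> perfect m -> chord L m = class K D.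
Proof. by move=> lD mD pm; rewrite /chord pm; apply: dclassE. Qed.

Lemma eq_chord L L' m : L =1 L' -> chord L m = chord L' m.
Proof. by move=> LL; rewrite /chord; case: ifP => // _; apply: eq_dclass. Qed.

Lemma chordalP D : chordal D ->
  exists m, [/\ perfect m, mate D =1 perm_mate m & class K D = chord (legs D) m].
Proof.
move=> /forallP uD; pose g v := (mate D (v, 0)).1.
have used0 v : used (legs D) (v, 0) by rewrite /used uD.
have gE v : mate D (v, 0) = (g v, 0).
  have [+ _ _] := mate_used (used0 v); rewrite /g.
  by case: (mate D (v, 0)) => w k; rewrite /used uD /= => /eqP ->.
have gK v : g (g v) = v by have [_ _] := mate_used (used0 v); rewrite !gE => -[].
pose m := perm (can_inj gK); have mE v : m v = g v by rewrite permE.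
have mD : mate D =1 perm_mate m.
  case=> v k; rewrite /perm_mate /=; case: eqP => [->|/eqP k0]; first by rewrite gE mE.
  by rewrite mate_unused // /used uD.
have pm : perfect m.
  apply/perfectP => v; rewrite !mE gK; split=> //.
  have [_ + _] := mate_used (used0 v); rewrite gE.
  by apply: contra => /eqP ->.
by exists m; split=> //; rewrite (chordE _ mD pm).
Qed.

(** Renaming the vertices along [s], with no rotation of half-edges, is a diagram isomorphism. *)
Lemma chord_conj L L' m s : arrangement L -> (forall i, L' i = map s (L i)) ->
  chord L' (m ^ s)%g = chord L m.
Proof.
move=> aL LL; rewrite {1}/chord perfectJ; case: ifP => pm; last by rewrite /chord pm.
have pms : perfect (m ^ s)%g by rewrite perfectJ.
have [D [lD mD]] := chord_exists aL pm.
have aL' : arrangement L'.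
  have /andP[/andP[/forallP u1 /forallP u2] /forallP uL] := aL.
  apply/andP; split; first (apply/andP; split).
  - by apply/forallP => i; rewrite LL map_inj_uniq //; apply: perm_inj.
  - apply/forallP => i; apply/forallP => j; apply/forallP => v; rewrite !LL -(permKV s v).
    by rewrite !(mem_map (@perm_inj _ s)); have /forallP/(_ j)/forallP := u2 i; apply.
  - by apply/forallP => v; rewrite -(permKV s v) (univalent_map _ LL).
have [D' [lD' mD']] := chord_exists aL' pms.
apply: etrans (dclassE K lD' mD') _; apply: etrans _ (esym (chordE lD mD pm)).
apply/esym/class_iso.
apply/existsP; exists s; apply/existsP; exists [ffun=> 0].
apply/and3P; split; apply/forallP => v.
- by rewrite ffunE eqxx implybT.
- by rewrite lD' lD LL.
- rewrite mD mD' !ffunE !addr0 /perm_mate /=.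
  by case: ifP => //= _; rewrite permJ.
Qed.

(** The sum runs over all permutations; those that are not perfect matchings contribute zero. *)
Definition chords L x : jacobi K d n := \sum_m x m *: chord L m.

Lemma eq_chords L L' x y : L =1 L' -> (forall m, perfect m -> x m = y m) ->
  chords L x = chords L' y.
Proof.
move=> LL xy; apply: eq_bigr => m _; rewrite (eq_chord _ LL).
by have [/xy ->|/negPf pm] := boolP (perfect m); rewrite // /chord pm !scaler0.
Qed.

Lemma chordsZ L x a : chords L (fun m => a * x m) = a *: chords L x.
Proof. by rewrite scaler_sumr; apply: eq_bigr => m _; rewrite scalerA. Qed.

Lemma chordsB L x y : chords L (fun m => x m - y m) = chords L x - chords L y.
Proof. by rewrite -sumrB; apply: eq_bigr => m _; rewrite scalerBl. Qed.

Lemma chordsD L x y : chords L (fun m => x m + y m) = chords L x + chords L y.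
Proof. by rewrite -big_split; apply: eq_bigr => m _; rewrite scalerDl. Qed.

Lemma chords_sum (I : finType) L (F : I -> {perm vertex d} -> K) :
  chords L (fun m => \sum_i F i m) = \sum_i chords L (F i).
Proof. by rewrite exchange_big; apply: eq_bigr => m _; rewrite scaler_suml. Qed.

Lemma chords_delta L m0 : chords L (fun m => (m == m0)%:R) = chord L m0.
Proof.
rewrite /chords (bigD1 m0) //= eqxx scale1r big1 ?addr0 // => m /negPf ->.
by rewrite scale0r.
Qed.

Lemma chords_conj L L' x s : arrangement L -> (forall i, L' i = map s (L i)) ->
  chords L' x = chords L (fun m => x (m ^ s)%g).
Proof.
move=> aL LL; rewrite /chords (reindex_inj (conjg_inj s)); apply: eq_bigr => m _.
by rewrite (chord_conj _ aL LL).
Qed.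

End Arrangements.

Section Maps.
Variables (m n : nat) (f : free_hom n m).
Implicit Types (L : 'I_m -> seq (vertex d)) (pl : {ffun vertex d -> option (copy f)}).

Lemma jacobi_map_chord L e : arrangement L ->
  jacobi_map f (chord L e) =
  \sum_(pl : {ffun vertex d -> option (copy f)} | placing L pl) psign K pl *: chord (plegs L pl) e.
Proof.
move=> aL; rewrite {1}/chord; case: ifP => pe; last first.
  by rewrite linear0 big1 // => pl _; rewrite /chord pe scaler0.
have [D [lD mD]] := chord_exists aL pe.
rewrite (dclassE K lD mD) jacobi_map_class; apply: eq_big => [pl|pl _]; first exact: eq_placing.
by rewrite /chord pe; congr (_ *: _); apply: eq_dclass => //; apply: eq_plegs.
Qed.

Lemma jacobi_map_chords L x : arrangement L ->
  jacobi_map f (chords L x) =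
  \sum_(pl : {ffun vertex d -> option (copy f)} | placing L pl) psign K pl *: chords (plegs L pl) x.
Proof.
move=> aL; rewrite /chords linear_sum /=.
under eq_bigr do rewrite linearZ /= (jacobi_map_chord _ aL) scaler_sumr.
rewrite exchange_big; apply: eq_bigr => pl _; rewrite scaler_sumr; apply: eq_bigr => e _.
by rewrite !scalerA mulrC.
Qed.

Lemma jacobi_map_chords_simple L x : arrangement L ->
  (forall j, uniq (unzip1 (image_word f j))) ->
  jacobi_map f (chords L x) =
  \sum_(t : {ffun vertex d -> option 'I_n} | tag_placing f L t)
     tag_sign K f L t *: chords (tag_legs f L t) x.
Proof.
move=> aL fs; rewrite /chords linear_sum /=.
transitivity (\sum_e \sum_(t : {ffun vertex d -> option 'I_n} | tag_placing f L t)
     x e *: (tag_sign K f L t *: chord (tag_legs f L t) e)); last first.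
  rewrite exchange_big; apply: eq_bigr => t _; rewrite scaler_sumr; apply: eq_bigr => e _.
  by rewrite !scalerA mulrC.
apply: eq_bigr => e _; rewrite linearZ /= -scaler_sumr; congr (_ *: _).
rewrite {1}/chord; case: ifP => pe; last first.
  by rewrite linear0 big1 // => t _; rewrite /chord pe scaler0.
have [D [lD mD]] := chord_exists aL pe.
rewrite (dclassE K lD mD) jacobi_map_simple //; apply: eq_big => [t|t _].
  apply: eq_forallb => v; case: (t v) => [j|]; last by rewrite (eq_univalent lD).
  by apply: eq_has => a; rewrite lD.
rewrite /chord pe; congr (_ *: _).
  apply: eq_bigr => v _; case: (t v) => // j; congr (_ ^+ nat_of_bool _).
  by apply: eq_has => a; rewrite lD.
by apply: eq_dclass => // j; congr flatten; apply: eq_map => a; rewrite lD.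
Qed.

End Maps.
End Chords.

(** * Matchings as fixed-point-free involutions *)

Section MatchingPerm.
Variables (d : nat) (M : nat -> nat) (okM : matching_on d M).

Lemma partner_inj : injective (partner okM).
Proof.
move=> v w /(congr1 (fun z : vertex d => M z)); rewrite !val_partner.
by have [_ _ ->] := okM (ltn_ord v); have [_ _ ->] := okM (ltn_ord w) => /val_inj.
Qed.

Definition matching_perm : {perm vertex d} := perm partner_inj.

Lemma val_matching_perm v : matching_perm v = M v :> nat.
Proof. by rewrite permE val_partner. Qed.

Lemma perfect_matching_perm : perfect matching_perm.
Proof.
apply/perfectP => v; have [_ ne inv] := okM (ltn_ord v).
split; last by apply: ord_inj; rewrite !val_matching_perm inv.
by apply: contra_notN ne => /eqP/(congr1 (@nat_of_ord _)); rewrite val_matching_perm.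
Qed.

Lemma chord_diagram_chord (K : fieldType) (s : {perm vertex d}) (D : diagram d d.*2) :
  legs D =1 (fun i => [:: s^-1%g i]) -> mate D =1 mate (chord_diagram okM) ->
  class K D = chord K (@chord_legs d) (matching_perm ^ s)%g.
Proof.
have arrS : arrangement (@chord_legs d).
  by rewrite /arrangement chord_legs_ok; apply/forallP => v; apply: univalent_chord.
move=> lD mD.
have -> : chord K (@chord_legs d) (matching_perm ^ s)%g = chord K (fun i => [:: s^-1%g i]) matching_perm.
  rewrite -[in RHS](conjgK s matching_perm); apply/esym.
  by apply: (chord_conj _ _ arrS).
rewrite (chordE _ lD) ?perfect_matching_perm // => h.
rewrite mD mate_mk /chord_mate /perm_mate; case: ifP => // _; congr pair.
by apply: ord_inj; rewrite val_matching_perm val_partner.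
Qed.

End MatchingPerm.

(** * Perfect matchings form one conjugacy class *)

Section PerfectEnum.
Variable d : nat.
Implicit Types (m s : {perm vertex d}) (S : {set vertex d}).

Lemma matchPSS i : matchP i.+2 = (matchP i).+2.
Proof. by rewrite /matchP /= negbK; case: ifP => //; case: i. Qed.

(** Removing one chord [{x, m x}] at a time and listing its ends side by side turns [m] into
    [matchP] on positions. *)
Lemma perfect_enum m S (x0 : vertex d) : perfect m -> (forall v, v \in S -> m v \in S) ->
  exists l, [/\ uniq l, l =i S, ~~ odd (size l)
    & forall i, (i < size l)%N -> nth x0 l (matchP i) = m (nth x0 l i)].
Proof.
move=> /perfectP pm; have [k] := ubnP #|S|; elim: k S => // k IHk S hk closed.
have [->|[x xS]] := set_0Vmem S; first by exists [::]; split=> // v; rewrite inE.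
have [mx mmx] := pm x.
have [||l [ul lS ol lm]] := IHk (S :\: [set x; m x]).
- rewrite -ltnS; apply: leq_trans hk; rewrite ltnS; apply: proper_card.
  apply/properP; split; first exact: subsetDl.
  by exists x; rewrite // !inE eqxx.
- move=> v; rewrite !inE !negb_or => /andP[/andP[vx vmx] vS].
  rewrite closed // andbT (inj_eq perm_inj) vx andbT.
  by apply: contra vmx => /eqP <-; rewrite (pm v).2.
exists [:: x, m x & l]; split=> //=.
- by rewrite ul andbT !inE !lS !inE !eqxx !orbT /= andbT eq_sym negb_or mx.
- move=> v; rewrite !inE lS !inE; have [->|vx] /= := eqVneq v x; first by rewrite xS.
  by have [->|vmx] := eqVneq v (m x); rewrite ?closed.
- by rewrite negbK.
case=> [|[|i]]; rewrite /= ?mmx //.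
by rewrite !ltnS => /lm <-; rewrite matchPSS.
Qed.

Lemma perm_of_enum m M (okM : matching_on d M) (l : seq (vertex d)) x0 : uniq l ->
  (forall v, v \in l) ->
  (forall i, (i < d.*2)%N -> nth x0 l (M i) = m (nth x0 l i)) ->
  exists s, m = (matching_perm okM ^ s)%g /\ forall v : vertex d, s v = nth x0 l v.
Proof.
move=> ul lV lm.
have sl : size l = d.*2 by rewrite -(card_uniqP ul) (eq_card (B := predT)) ?card_ord // => v; rewrite lV.
have inj : injective (fun v : vertex d => nth x0 l v).
  by move=> v w /eqP; rewrite nth_uniq ?sl ?ltn_ord // => /eqP/val_inj.
exists (perm inj); split=> [|v]; last by rewrite permE.
apply/permP => v; rewrite -(permKV (perm inj) v) permJ; move: ((perm inj)^-1%g v) => w.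
by rewrite !permE val_partner lm.
Qed.

Lemma perfect_conj m m' : perfect m -> perfect m' -> exists s, m' = (m ^ s)%g.
Proof.
move=> pm pm'; have [x0|noV] := pickP (fun _ : vertex d => true); last first.
  by exists 1%g; apply/permP => v; have := noV v.
have H e : perfect e -> exists s, e = (matching_perm (@matchP_ok d) ^ s)%g.
  move=> pe; have [|l [ul lS ol le]] := @perfect_enum e [set: vertex d] x0 pe.
    by move=> v _; rewrite inE.
  have lV v : v \in l by rewrite lS inE.
  have [|s [-> _]] := @perm_of_enum e matchP (@matchP_ok d) l x0 ul lV; last by exists s.
  move=> i id; apply: le.
  by rewrite -(card_uniqP ul) (eq_card (B := predT)) ?card_ord // => v; rewrite lV.
have [s ->] := H m pm; have [s' ->] := H m' pm'.
by exists (s^-1 * s')%g; rewrite -conjgM mulKVg.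
Qed.

End PerfectEnum.

(** Any two distinct chords can thus be moved to the first two chords of [matchQ1], which turns the
    switch by [tperm x y] into the one defining Q. *)
Lemma perfect_frame d (m : {perm vertex d.+2}) x y : perfect m -> x != y -> m x != y ->
  exists s, [/\ m = (matching_perm (@matchQ1_ok d) ^ s)%g, s (inord 0) = x & s (inord 1) = y].
Proof.
move=> /[dup] pm /perfectP mP xy mxy.
have [mx mmx] := mP x; have [my mmy] := mP y.
have mE a b : (m a == b) = (a == m b) by rewrite -[RHS](inj_eq (@perm_inj _ m)) (mP b).2.
pose S := ~: [set x; y; m y; m x].
have [|l [ul lS ol lm]] := @perfect_enum _ m S x pm.
  move=> v; rewrite !inE !negb_or => /andP[/andP[/andP[vx vy] vmy] vmx].
  by rewrite !(inj_eq perm_inj) vx vy !mE vmx vmy.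
(* [matchQ1] pairs position 0 with 3 and position 1 with 2. *)
pose l4 := [:: x, y, m y, m x & l].
have ul4 : uniq l4.
  rewrite /= ul andbT !inE !lS !inE !eqxx ?orbT /= !andbT !negb_or !(inj_eq perm_inj).
  by rewrite -mE [y == m y]eq_sym [y == m x]eq_sym [x == m x]eq_sym [y == x]eq_sym
             (negPf mx) (negPf my) (negPf mxy) (negPf xy).
have l4V v : v \in l4 by rewrite !in_cons lS !inE; do 4 case: (v == _) => //.
have [i id|s [mQ sE]] := @perm_of_enum _ m _ (@matchQ1_ok d) l4 x ul4 l4V.
  have sl : size l4 = d.+2.*2.
    by rewrite -(card_uniqP ul4) (eq_card (B := predT)) ?card_ord // => v; rewrite l4V.
  case: i id => [|[|[|[|i]]]] id; rewrite /= ?mmx ?mmy //.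
  have -> : matchQ1 i.+4 = (matchP i).+4 by rewrite /matchQ1 /= !matchPSS.
  by rewrite /= lm // -(ltn_add2r 4) !addn4 -[X in (_ < X)%N]/(size l4) sl.
by exists s; split=> //; rewrite sE inordK.
Qed.

(** * The decomposition *)

Section Coefficients.
Variables (K : fieldType).

Definition matP d : {perm vertex d} := matching_perm (@matchP_ok d).
Definition matQ1 d : {perm vertex d.+2} := matching_perm (@matchQ1_ok d).
Definition matQ2 d : {perm vertex d.+2} := matching_perm (@matchQ2_ok d).

(** Constant on perfect matchings: its value is the order of the centralizer of [matP d], that is
    2^d d!. *)
Definition coefP d (m : {perm vertex d}) : K := \sum_s (m == matP d ^ s)%g%:R.

Definition coefQ d : {perm vertex d} -> K :=
  match d with
  | d'.+2 => fun m => (m == matQ1 d')%:R - (m == matQ2 d')%:R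
  | _ => fun=> 0
  end.

Lemma coefPJ d (m s : {perm vertex d}) : coefP (m ^ s)%g = coefP m.
Proof.
rewrite /coefP (reindex_inj (mulIg s)); apply: eq_bigr => t _.
by rewrite conjgM (inj_eq (conjg_inj s)).
Qed.

Lemma chords_coefP d n (L : 'I_n -> seq (vertex d)) :
  chords L (@coefP d) = \sum_s chord K L (matP d ^ s)%g.
Proof. by rewrite chords_sum; apply: eq_bigr => s _; apply: chords_delta. Qed.

Lemma chords_coefQ d n (L : 'I_n -> seq (vertex d.+2)) :
  chords L (@coefQ d.+2) = chord K L (matQ1 d) - chord K L (matQ2 d).
Proof. by rewrite /coefQ chordsB !chords_delta. Qed.

Lemma elemPE d : elemP K d = chords (@chord_legs d) (@coefP d).
Proof.
rewrite chords_coefP; apply: eq_bigr => s _; apply: chord_diagram_chord => h.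
  by rewrite legs_mk /renumbered_legs legs_mk.
by rewrite mate_mk.
Qed.

Lemma elemQE d : elemQ K d = chords (@chord_legs d) (@coefQ d).
Proof.
case: d => [|[|d]]; rewrite /elemQ.
- by rewrite /chords big1 // => m _; rewrite scale0r.
- by rewrite /chords big1 // => m _; rewrite scale0r.
rewrite chords_coefQ; congr (_ - _).
  rewrite -[matQ1 d]conjg1; apply: chord_diagram_chord => h; last by [].
  by rewrite legs_mk invg1 perm1.
rewrite -[matQ2 d]conjg1; apply: chord_diagram_chord => h; last by [].
by rewrite legs_mk invg1 perm1.
Qed.

Lemma val_tperm01 d (v : vertex d.+2) :
  tperm (inord 0) (inord 1) v = (match v : nat with 0%N => 1%N | 1%N => 0%N | k => k end) :> nat.
Proof.
have E k : (k < 4)%N -> (v == inord k) = (v == k :> nat).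
  by move=> k4; rewrite -val_eqE /= inordK //; apply: leq_trans k4 _.
rewrite permE /= !E //; move vE : (nat_of_ord v) => k.
by case: k vE => [|[|k]] vE /=; rewrite ?inordK.
Qed.

Lemma matQ2E d : matQ2 d = (matQ1 d ^ tperm (inord 0) (inord 1))%g.
Proof.
apply/permP => v; rewrite -{2}[v](tpermK (inord 0) (inord 1)) permJ.
apply: ord_inj; rewrite val_tperm01 !val_matching_perm val_tperm01.
case: (v : nat) => [|[|[|[|i]]]] //.
by rewrite (_ : matchQ1 i.+4 = (matchP i).+4) -?matchPSS // -matchPSS.
Qed.

End Coefficients.

(** * Submodules generated by combinations of chord diagrams *)

Section Generated.
Variables (K : fieldType) (d n : nat) (x : {perm vertex d} -> K).
Implicit Types (L : 'I_n -> seq (vertex d)).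

Lemma std_arrangement : arrangement (@chord_legs d).
Proof. by rewrite /arrangement chord_legs_ok; apply/forallP => v; apply: univalent_chord. Qed.

Lemma arrangement_legs m (L : 'I_m -> seq (vertex d)) :
  arrangement L -> exists D, legs D =1 L.
Proof.
move=> aL; have [D [lD _]] := chord_exists aL (perfect_matching_perm (@matchP_ok d)).
by exists D.
Qed.

Lemma arrangement_plegs m (f : free_hom n m) (L : 'I_m -> seq (vertex d))
    (pl : {ffun vertex d -> option (copy f)}) :
  arrangement L -> placing L pl -> arrangement (plegs L pl).
Proof.
move=> aL plP; have [D lD] := arrangement_legs aL.
have plD : placing (legs D) pl by rewrite (eq_placing _ lD).
have [E [lE _]] := placed plD.
rewrite -(eq_arrangement (eq_plegs pl lD)) -(eq_arrangement lE) legs_arrangement.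
apply/forallP => v; rewrite (eq_univalent lE) univalent_plegs // (eq_univalent lD).
by have /andP[_ /forallP] := aL; apply.
Qed.

Definition generated := generated_submodule n (chords (@chord_legs d) x).

Lemma generated_ind (W : {vspace jacobi K d n}) :
  (forall L, arrangement L -> chords L x \in W) -> (generated <= W)%VS.
Proof.
move=> LW; apply: span_family_sub => f; rewrite (jacobi_map_chords _ _ std_arrangement).
apply: memv_suml => pl plP; apply/memvZ/LW; apply: arrangement_plegs plP.
exact: std_arrangement.
Qed.

Lemma tag_sign_positive m (f : free_hom n m) (L : 'I_m -> seq (vertex d))
    (t : {ffun vertex d -> option 'I_n}) :
  (forall j, all (fun a => ~~ a.2) (image_word f j)) -> tag_sign K f L t = 1.
Proof.
move=> pos; rewrite /tag_sign big1 // => v _; case: (t v) => // j.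
rewrite (_ : has _ _ = false) //; apply/hasPn => a aj.
by rewrite negb_and (allP (pos j)) ?orbT.
Qed.

Lemma arrangement_arc L v : arrangement L -> exists2 j, v \in L j & forall i, v \in L i -> i = j.
Proof.
case/andP=> /andP[_ /forallP dis] /forallP/(_ v)/existsP[j vj]; exists j => // i vi.
by have /forallP/(_ j)/forallP/(_ v) := dis i; rewrite vi vj => /eqP.
Qed.

Lemma arrangement_uniq L j : arrangement L -> uniq (L j).
Proof. by case/andP=> /andP[/forallP h _] _; apply: h. Qed.

(** In the words of [arrangement_hom L] every letter occurs exactly once and positively, so there is
    a single placement, of sign 1. With [generated_ind] this makes [generated] the span of all
    [chords L x]. *)
Lemma mem_generated L : arrangement L -> chords L x \in generated.
Proof.
move=> aL; suff <- : jacobi_map (arrangement_hom L) (chords (@chord_legs d) x) = chords L x.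
  exact: (mem_span_family (fun f : free_hom n d.*2 => jacobi_map f (chords (@chord_legs d) x))).
have simple j : uniq (unzip1 (image_word (arrangement_hom L) j)).
  by rewrite image_arrangement_hom /unzip1 -map_comp map_id rev_uniq arrangement_uniq.
have hasE v j : has (fun a => v \in chord_legs a.1) (image_word (arrangement_hom L) j) = (v \in L j).
  rewrite image_arrangement_hom has_map -mem_rev -has_pred1; apply: eq_has => w.
  by rewrite /= inE eq_sym.
rewrite (jacobi_map_chords_simple _ std_arrangement simple).
pose t0 := [ffun v => [pick j | v \in L j]] : {ffun vertex d -> option 'I_n}.
have t0E v j : v \in L j -> t0 v = Some j.
  move=> vj; rewrite ffunE; case: pickP => [i vi|/(_ j)]; last by rewrite vj.
  by have [k _ H] := arrangement_arc v aL; rewrite (H _ vi) (H _ vj).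
rewrite (big_pred1 t0) => [|t].
  rewrite tag_sign_positive ?scale1r => [|j]; last by rewrite image_arrangement_hom all_map all_predT.
  apply: eq_chords => // j; rewrite /tag_legs image_arrangement_hom -map_rev revK -map_comp.
  have : {subset L j <= L j} by [].
  elim: {1 3 4}(L j) => //= v l IHl sub; rewrite IHl => [|w wl]; last by rewrite sub ?inE ?wl ?orbT.
  by rewrite (t0E _ j) ?sub ?mem_head // eqxx.
apply/forallP/eqP => [tP|-> v].
  apply/ffunP => v; have := tP v; case tv: (t v) => [j|]; first by rewrite hasE => /t0E ->.
  by rewrite univalent_chord.
have [j vj _] := arrangement_arc v aL.
by rewrite (t0E _ _ vj) hasE.
Qed.

Lemma generated_stable (g : free_hom n n) u : u \in generated -> jacobi_map g u \in generated.
Proof.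
move=> ug; rewrite -[jacobi_map g u]lfunE memv_preim; move: u ug.
apply/subvP/generated_ind => L aL; rewrite -memv_preim lfunE /= jacobi_map_chords //.
apply: memv_suml => pl plP; apply/memvZ/mem_generated; exact: arrangement_plegs.
Qed.

End Generated.

(** * The symmetrizing endomorphism *)

Section Decomposition.
Variables (K : fieldType) (d n : nat).
Implicit Types (L : 'I_n -> seq (vertex d)) (D : diagram d n).

Lemma generatedP : AP K d n = generated n (@coefP K d).
Proof. by rewrite /AP elemPE. Qed.

Lemma generatedQ : AQ K d n = generated n (@coefQ K d).
Proof. by rewrite /AQ elemQE. Qed.

Lemma arrangement_map s L L' : arrangement L -> (forall i, L' i = map (s : {perm vertex d}) (L i)) ->
  arrangement L'.
Proof.
move=> /andP[/andP[/forallP u1 /forallP u2] /forallP uL] LL.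
apply/andP; split; first (apply/andP; split).
- by apply/forallP => i; rewrite LL map_inj_uniq //; apply: perm_inj.
- apply/forallP => i; apply/forallP => j; apply/forallP => v; rewrite !LL -(permKV s v).
  by rewrite !(mem_map (@perm_inj _ s)); have /forallP/(_ j)/forallP := u2 i; apply.
- by apply/forallP => v; rewrite -(permKV s v) (univalent_map _ LL).
Qed.

(* Up to the factor (2d)!, the projection onto AP along AQ. *)
Definition symmetrize_diagram D : jacobi K d n :=
  if chordal D then chords (legs D) (@coefP K d) else 0.

Lemma symmetrize_iso D D' : diagram_iso D D' -> symmetrize_diagram D = symmetrize_diagram D'.
Proof.
case/existsP=> s /existsP[r /and3P[_ /forallP l _]].
have LL i : legs D' i = map s (legs D i) by apply/eqP.
have cE : chordal D' = chordal D.
  apply/forallP/forallP => uD v; first by rewrite -(univalent_map v LL).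
  by rewrite -(permKV s v) (univalent_map _ LL).
rewrite /symmetrize_diagram cE; case: ifP => // cD.
rewrite (chords_conj _ _ LL) ?legs_arrangement //.
by apply: eq_chords => // m _; rewrite coefPJ.
Qed.

Lemma subst2_tperm (u v : vertex d) l : v \notin l ->
  subst2 u v u l = map (tperm u v) (subst2 u u v l).
Proof.
elim: l => // w l IHl; rewrite in_cons negb_or => /andP[vw vl].
rewrite !subst2_cons map_cat IHl //; congr cat.
by case: eqP => [_|/eqP wu] /=; rewrite ?tpermL ?tpermR // tpermD // eq_sym.
Qed.

Lemma symmetrize_STU D D1 D2 : STU D D1 D2 ->
  symmetrize_diagram D = symmetrize_diagram D1 - symmetrize_diagram D2.
Proof.
case/STU_witness=> u [v [i [uu vv ui [l1 l2] _]]].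
have cD : chordal D = false by apply: contraNF vv => /forallP.
have cE : chordal D2 = chordal D1.
  by apply: eq_forallb => w; rewrite !(STU_univalent uu vv l1 l2).
rewrite /symmetrize_diagram cD cE; case: ifP => cD1; last by rewrite subrr.
have LL k : legs D2 k = map (tperm u v) (legs D1 k).
  by rewrite l1 l2 subst2_tperm // STU_new_leg.
rewrite [X in _ - X](chords_conj _ _ LL) ?legs_arrangement //.
rewrite [X in _ - X](@eq_chords _ _ _ _ (legs D1) _ (@coefP K d)) ?subrr // => m _.
by rewrite coefPJ.
Qed.

Definition symmetrize : {linear jacobi K d n -> jacobi K d n} := jacobi_lift symmetrize_diagram.

Lemma symmetrize_chord L m : arrangement L -> perfect m ->
  symmetrize (chord K L m) = chords L (@coefP K d).
Proof.
move=> aL pm; have [D [lD mD]] := chord_exists aL pm.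
rewrite (chordE K lD mD pm).
apply: etrans (jacobi_liftE symmetrize_iso symmetrize_STU D) _.
rewrite /symmetrize_diagram -legs_arrangement (eq_arrangement lD) aL.
exact: eq_chords.
Qed.

Lemma perfect_matP : perfect (matP d).
Proof. exact: perfect_matching_perm. Qed.

(** On a generator, each of the (2d)! chord diagrams of the sum is sent to the whole sum. *)
Lemma symmetrizeP u : u \in AP K d n -> symmetrize u = u *+ #|{perm vertex d}|.
Proof.
rewrite generatedP => uP; apply/eqP; rewrite -subr_eq0 -scaler_nat.
pose f : {linear jacobi K d n -> jacobi K d n} := symmetrize \- ( *:%R #|{perm vertex d}|%:R).
rewrite -[_ - _]/(f u) -[f u]lfunE -memv_ker; move: u uP; apply/subvP/generated_ind => L aL.
rewrite memv_ker lfunE /= scaler_nat {1}chords_coefP linear_sum /=.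
rewrite (eq_bigr (fun=> chords L (@coefP K d))) => [|s _].
  by rewrite sumr_const subrr.
by rewrite symmetrize_chord ?perfectJ ?perfect_matP.
Qed.

End Decomposition.

Lemma symmetrizeQ (K : fieldType) d n u : u \in AQ K d n -> symmetrize K d n u = 0.
Proof.
rewrite generatedQ => uQ; apply/eqP; rewrite -[symmetrize _ _ _ u]lfunE -memv_ker.
move: u uQ; apply/subvP/generated_ind => L aL; rewrite memv_ker lfunE /=.
case: d L aL => [|[|d]] L aL; try by rewrite /chords big1 ?linear0 // => m _; rewrite scale0r.
rewrite chords_coefQ linearB /= !symmetrize_chord ?subrr //; exact: perfect_matching_perm.
Qed.

(** * AP and AQ span and are independent *)

Section Sum.
Variables (K : fieldType) (d n : nat).
Hypothesis charK : [pchar K]%R =i pred0.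
Implicit Types (L : 'I_n -> seq (vertex d)) (D : diagram d n).

Lemma tperm_fix_matching (m : {perm vertex d}) x y : perfect m -> m x = y -> (m ^ tperm x y = m)%g.
Proof.
move=> /perfectP mP mxy; have myx : m y = x by rewrite -mxy (mP x).2.
apply/permP => v; rewrite -{1}[v](tpermK x y) permJ.
have [->|vx] := eqVneq v x; first by rewrite tpermL myx tpermL mxy.
have [->|vy] := eqVneq v y; first by rewrite tpermR mxy tpermR myx.
rewrite (@tpermD _ x y v) 1?eq_sym // tpermD // eq_sym.
  by rewrite -myx (inj_eq perm_inj).
by rewrite -mxy (inj_eq perm_inj).
Qed.

Lemma chord_tperm_mod_Q L m x y : arrangement L -> perfect m ->
  chord K L m - chord K L (m ^ tperm x y)%g \in AQ K d n.
Proof.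
move=> aL /[dup] pm /perfectP mP.
have [<-|xy] := eqVneq x y; first by rewrite tperm1 conjg1 subrr mem0v.
have [mxy|mxy] := eqVneq (m x) y; first by rewrite tperm_fix_matching // subrr mem0v.
rewrite generatedQ.
case: d L m x y aL pm mP xy mxy => [|[|e]] L m x y aL pm mP xy mxy; first by case: x xy mxy.
  (* In degree 1 there are only two vertices, so three distinct ones are impossible. *)
  have u3 : uniq [:: x; y; m x].
    by rewrite /= !inE negb_or xy [x == m x]eq_sym (mP x).1 [y == m x]eq_sym mxy.
  by have := max_card (mem [:: x; y; m x]); rewrite (card_uniqP u3) card_ord.
have [s [mE sx sy]] := perfect_frame pm xy mxy.
have mE2 : (m ^ tperm x y = matQ2 e ^ s)%g by rewrite matQ2E -sx -sy -tpermJ mE -!conjgM -conjgC.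
pose L' i := map (s^-1)%g (L i).
have aL' : arrangement L' by apply: (arrangement_map (s := s^-1%g) aL).
have LL i : L i = map s (L' i) by rewrite -map_comp map_id_in // => v _ /=; rewrite permKV.
rewrite mE2 mE !(chord_conj _ _ aL' LL) -chords_coefQ; exact: mem_generated.
Qed.

(** The permutation conjugating [m] to [m'] is a product of transpositions, each of which switches
    two chords or leaves the matching unchanged. *)
Lemma chord_mod_Q L m m' : arrangement L -> perfect m -> perfect m' ->
  chord K L m - chord K L m' \in AQ K d n.
Proof.
move=> aL pm pm'; have [s ->] := perfect_conj pm pm'.
have [ts -> _] := prod_tpermP s; elim: ts m pm {pm'} => [|[x y] ts IHts] m pm.
  by rewrite big_nil conjg1 subrr mem0v.
rewrite big_cons conjgM /= -(subrK (chord K L (m ^ tperm x y)%g) (chord K L m)) -addrA.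
by apply: rpredD; [apply: chord_tperm_mod_Q | apply: IHts; rewrite perfectJ].
Qed.

Lemma card_perm_unit : #|{perm vertex d}|%:R != 0 :> K.
Proof. by have /pcharf0P -> := charK; rewrite -lt0n; apply/card_gt0P; exists 1%g. Qed.

Lemma AP_AQ_full : (AP K d n + AQ K d n)%VS = fullv.
Proof.
apply: chordal_span => D cD; have [m [pm _ ->]] := chordalP K cD.
have aL : arrangement (legs D) by rewrite legs_arrangement.
(* (2d)! times the chord diagram is the symmetrized sum plus differences of chord diagrams with
   equal legs, which lie in AQ. *)
rewrite -(scalerK card_perm_unit (chord K _ m)); apply: memvZ.
rewrite scaler_nat -sumr_const -(subrK (chords (legs D) (@coefP K d)) (\sum_(_ in _) _)) addrC.
apply: memv_add; first by rewrite generatedP mem_generated.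
rewrite chords_coefP -sumrB; apply: memv_suml => s _; apply: chord_mod_Q => //.
by rewrite perfectJ perfect_matP.
Qed.

Lemma AP_AQ_direct : directv (AP K d n + AQ K d n).
Proof.
apply/directv_addP/eqP; rewrite -subv0; apply/subvP => u; rewrite memv_cap memv0 => /andP[uP uQ].
have := symmetrizeP uP; rewrite symmetrizeQ // -scaler_nat => /esym/eqP.
by rewrite scaler_eq0 (negPf card_perm_unit).
Qed.

Lemma AP_AQ_decomposition : @direct_decomposition K d n fullv (AP K d n) (AQ K d n).
Proof.
split; first by move=> *; apply: memvf.
- by move=> g _ u; rewrite generatedP; apply: generated_stable.
- by move=> g _ u; rewrite generatedQ; apply: generated_stable.
- exact: AP_AQ_full.
- exact: AP_AQ_direct.
Qed.

End Sum.

(** * Generation by automorphisms *)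

Section Arcs.
Variables (d n : nat).
Implicit Types (L : 'I_n -> seq (vertex d)) (D : diagram d n).

Definition arc L (v : vertex d) : option 'I_n := [pick j | v \in L j].

Lemma arcP L v j : legs_ok L -> reflect (arc L v = Some j) (v \in L j).
Proof.
case/andP=> _ /forallP dis; rewrite /arc; case: pickP => [i vi|/(_ j) ->]; last by constructor.
apply: (iffP idP) => [vj|[<-] //].
by have /forallP/(_ j)/forallP/(_ v) := dis i; rewrite vi vj => /eqP ->.
Qed.

Lemma arcN L v : (arc L v == None) = ~~ univalent L v.
Proof.
rewrite /arc; case: pickP => [i vi|no]; first by apply/esym/negbTE; rewrite negbK; apply/existsP; exists i.
by rewrite eqxx; apply/esym/existsPn => i; rewrite no.
Qed.

Lemma eq_arc L L' : L =1 L' -> arc L =1 arc L'.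
Proof. by move=> LL v; apply: eq_pick => j; rewrite /= LL. Qed.

Lemma arc_map L L' s v : (forall i, L' i = map (s : {perm vertex d}) (L i)) -> arc L' (s v) = arc L v.
Proof. by move=> LL; apply: eq_pick => j; rewrite /= LL mem_map //; apply: perm_inj. Qed.

End Arcs.

(** * Automorphisms that permute or invert generators *)

Section SignedPerm.
Variables (K : fieldType) (d n : nat) (f : free_hom n n) (s : {perm 'I_n}) (b : 'I_n -> bool).
Hypothesis fE : forall j, image_word f j = [:: (s j, b j)].

Lemma jacobi_map_signed_perm (D : diagram d n) :
  jacobi_map f (class K D) =
  (\prod_(v : vertex d) (if arc (legs D) v is Some i then (-1) ^+ b (s^-1%g i) else 1)) *:
  dclass K (fun j => if b j then rev (legs D (s j)) else legs D (s j)) (mate D).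
Proof.
have okL := legsP D.
rewrite jacobi_map_simple => [|j]; last by rewrite fE.
pose t0 := [ffun v => omap (s^-1)%g (arc (legs D) v)] : {ffun vertex d -> option 'I_n}.
rewrite (big_pred1 t0) => [|t].
  congr (_ *: _).
    apply: eq_bigr => v _; rewrite ffunE; case E : (arc _ v) => [i|//] /=.
    by rewrite fE /= permKV orbF (introT (arcP _ _ okL) E).
  apply: eq_dclass => // j; rewrite /tag_legs fE /= cats0.
  have -> : [seq v <- legs D (s j) | t0 v == Some j] = legs D (s j) by
    apply/all_filterP/allP => v /(arcP _ _ okL) E; rewrite ffunE E /= permK.
  by [].
apply/forallP/eqP => [tP|-> v].
  apply/ffunP => v; rewrite ffunE; have := tP v; case: (t v) => [j|].
    by rewrite fE /= orbF => /(arcP _ _ okL) ->; rewrite /= permK.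
  by rewrite -arcN => /eqP ->.
rewrite ffunE; case E : (arc _ v) => [i|] /=; last by rewrite -arcN E.
by rewrite fE /= permKV orbF; apply/(arcP _ _ okL).
Qed.

End SignedPerm.

Section AutActions.
Variables (K : fieldType) (d n : nat).
Implicit Types (L : 'I_n -> seq (vertex d)) (D : diagram d n) (x : {perm vertex d} -> K).

Lemma jacobi_map_perm s L x : arrangement L ->
  jacobi_map (perm_hom s) (chords L x) = chords (fun j => L (s j)) x.
Proof.
move=> aL; rewrite /chords linear_sum /=; apply: eq_bigr => m _; rewrite linearZ /=; congr (_ *: _).
rewrite /chord; case: ifP => pm; last by rewrite linear0.
have [D [lD mD]] := chord_exists aL pm.
rewrite (dclassE K lD mD) (@jacobi_map_signed_perm _ _ _ _ s xpred0); last exact: image_perm_hom.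
rewrite big1 ?scale1r => [|v _]; last by case: arc.
by apply: eq_dclass => // j; apply: lD.
Qed.

Lemma jacobi_map_flip k D :
  jacobi_map (flip_hom k) (class K D) =
  (-1) ^+ size (legs D k) *: dclass K (fun j => if j == k then rev (legs D j) else legs D j) (mate D).
Proof.
have okL := legsP D.
rewrite (@jacobi_map_signed_perm _ _ _ _ 1%g (eq_op^~ k)) => [|j]; last by rewrite perm1 image_flip_hom.
congr (_ *: _); last by apply: eq_dclass => // j; rewrite perm1.
have /andP[/forallP/(_ k)/card_uniqP <- _] := okL.
rewrite -prodr_const [RHS]big_mkcond; apply: eq_bigr => v _.
case E: (arc _ v) => [i|].
  rewrite invg1 perm1; have vi := introT (arcP _ _ okL) E.
  have -> : (v \in legs D k) = (i == k); last by case: ifP.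
  by apply/idP/eqP => [/(arcP _ _ okL)|<-//]; rewrite E => -[].
by rewrite ifN //; apply: contra_eqN E => /(arcP _ _ okL) ->.
Qed.

Definition slide_legs (b : bool) (j e : 'I_n) (l : vertex d) L (i : 'I_n) : seq (vertex d) :=
  if i == e then [::] else if i == j then (if b then rcons (L j) l else l :: L j) else L i.

(** Only the leg [l] has a choice: it stays on arc [e] (placement [t1]) or goes to the copy of [e]
    inside arc [j] (placement [t2]). *)
Lemma jacobi_map_slide b j e l L x : e != j -> arrangement L -> L e = [:: l] ->
  jacobi_map (slide_hom b j e) (chords L x) = chords L x + chords (slide_legs b j e l L) x.
Proof.
move=> ej aL Le; have /andP[okL /forallP uL] := aL.
have le : arc L l = Some e by apply/(arcP _ _ okL); rewrite Le mem_head.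
have neq : e == j = false by apply/negbTE.
have mE v i : (v \in L i) = (arc L v == Some i) by apply/(arcP _ _ okL)/eqP.
have arcl v : (arc L v == Some e) = (v == l) by rewrite -mE Le mem_seq1.
rewrite (jacobi_map_chords_simple _ aL) => [|i]; last first.
  by rewrite image_slide_hom; case: eqP => // _; case: b; rewrite /= inE ?neq // eq_sym neq.
pose t1 := [ffun v => arc L v] : {ffun vertex d -> option 'I_n}.
pose t2 := [ffun v => if v == l then Some j else arc L v] : {ffun vertex d -> option 'I_n}.
have t12 : t2 != t1.
  by apply/eqP => /ffunP/(_ l); rewrite !ffunE eqxx le => -[/eqP]; rewrite eq_sym neq.
have sign1 t : tag_sign K (slide_hom b j e) L t = 1.
  apply: tag_sign_positive => i; rewrite image_slide_hom; case: eqP => // _.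
  by case: b.
have placeE t : tag_placing (slide_hom b j e) L t = (t == t1) || (t == t2).
  have hasE v i : has (fun a => v \in L a.1) (image_word (slide_hom b j e) i)
      = (v \in L i) || (i == j) && (v == l).
    rewrite image_slide_hom; case: eqP => [->|_] /=; last by rewrite !orbF.
    by case: (b); rewrite /= orbF ?[(v \in L e) || _]orbC !mE arcl.
  apply/forallP/orP => [tP|].
    have tv v : v != l -> t v = arc L v.
      move=> vl; have := tP v; case: (t v) => [i|]; last by rewrite uL.
      by rewrite hasE (negPf vl) andbF orbF mE => /eqP.
    have := tP l; case tl : (t l) => [i|]; last by rewrite uL.
    rewrite hasE eqxx andbT => /orP[li|/eqP ij].
      left; apply/eqP/ffunP => v; rewrite ffunE; have [->|/tv //] := eqVneq v l.
      by rewrite tl; apply/esym/(arcP _ _ okL).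
    right; apply/eqP/ffunP => v; rewrite ffunE; have [->|/tv //] := eqVneq v l.
    by rewrite tl ij.
  case=> /eqP -> v; rewrite ffunE; last case: eqP => [->|_]; last 2 first.
  - by rewrite hasE !eqxx orbT.
  - by have := uL v; rewrite -[univalent _ _]negbK -arcN; case E: arc => [i|//] _; rewrite hasE mE E eqxx.
  - by have := uL v; rewrite -[univalent _ _]negbK -arcN; case E: arc => [i|//] _; rewrite hasE mE E eqxx.
rewrite (bigD1 t1) ?placeE ?eqxx //= (bigD1 t2) /=; last by rewrite placeE eqxx orbT.
rewrite big1 ?addr0 => [|t]; last by rewrite placeE => /andP[/andP[/orP[|] -> //]]; rewrite ?andbF.
have F1 i k : [seq v <- L i | t1 v == Some k] = if i == k then L i else [::].
  rewrite (eq_in_filter (a2 := fun=> i == k)) => [|v]; last by rewrite ffunE mE => /eqP ->.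
  by case: (i == k); rewrite ?filter_predT ?filter_pred0.
have F2 i k : [seq v <- L i | t2 v == Some k] =
    if i == e then (if j == k then [:: l] else [::]) else if i == k then L i else [::].
  have [->|ie] := eqVneq i e; first by rewrite Le /= ffunE eqxx.
  rewrite (eq_in_filter (a2 := fun=> i == k)) => [|v vi].
    by case: (i == k); rewrite ?filter_predT ?filter_pred0.
  have vl : v != l by rewrite -arcl; move: vi; rewrite mE => /eqP ->.
  by rewrite ffunE (negPf vl); move: vi; rewrite mE => /eqP ->.
rewrite !sign1 !scale1r; congr (_ + _); apply: eq_chords => // i;
  rewrite /tag_legs image_slide_hom.
  have [->|ij] := eqVneq i j; last by rewrite /= F1 eqxx cats0.
  by case: (b); rewrite /= ?F1 ?eqxx neq ?cats0.
rewrite /slide_legs; have [->|ij] := eqVneq i j.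
  rewrite [j == e]eq_sym neq; case: (b); rewrite /= ?F2 ?eqxx [j == e]eq_sym neq ?cats0 //.
  by rewrite cats1.
by rewrite /= F2 eqxx [j == i]eq_sym (negPf ij) cats0; case: eqP.
Qed.

Lemma arrangement_slide b j e l L : e != j -> arrangement L -> L e = [:: l] ->
  arrangement (slide_legs b j e l L).
Proof.
move=> /negPf neq aL Le; have /andP[okL /forallP uL] := aL.
have mE v i : (v \in L i) = (arc L v == Some i) by apply/(arcP _ _ okL)/eqP.
have le : arc L l = Some e by apply/(arcP _ _ okL); rewrite Le mem_head.
have arcl v : (arc L v == Some e) = (v == l) by rewrite -mE Le mem_seq1.
have memE v i : (v \in slide_legs b j e l L i) = (if v == l then i == j else v \in L i).
  rewrite /slide_legs; have [->|ie] := eqVneq i e.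
    by rewrite neq in_nil mE arcl; case: eqP.
  have [->|ij] := eqVneq i j.
    by case: (b); rewrite ?mem_rcons in_cons; case: eqP.
  have [->|//] := eqVneq v l; rewrite mE le; apply: contra_neqF ie => /eqP[->].
  by [].
apply/andP; split; first (apply/andP; split).
- apply/forallP => i; rewrite /slide_legs; case: eqP => // ie; case: eqP => [ij|_]; last first.
    exact: arrangement_uniq.
  have lj : l \notin L j by rewrite mE le (inj_eq Some_inj) neq.
  by case: (b); rewrite ?rcons_uniq ?cons_uniq lj arrangement_uniq.
- apply/forallP => i; apply/forallP => i'; apply/forallP => v; apply/implyP; rewrite !memE.
  case: eqP => _ /andP[]; first by move=> /eqP -> /eqP ->.
  by rewrite !mE => /eqP -> /eqP[->].
apply/forallP => v; apply/existsP; have /existsP[i vi] := uL v.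
by have [->|vl] := eqVneq v l; [exists j | exists i]; rewrite memE ?eqxx // (negPf vl).
Qed.

End AutActions.

(** * Diagrams with at most one leg per arc *)

Section Spread.
Variables (d n : nat).

Lemma extend_inj (T : finType) (f g : T -> 'I_n) : injective f -> injective g ->
  exists s : {perm 'I_n}, forall v, s (f v) = g v.
Proof.
(* Each list starts with the values of the injection and ends with the remaining arcs; matching
   positions in the two lists gives the permutation. *)
move=> fI gI; pose ext (h : T -> 'I_n) := codom h ++ [seq i <- enum 'I_n | i \notin codom h].
have uext h : injective h -> uniq (ext h).
  move=> hI; rewrite cat_uniq (map_inj_uniq hI) enum_uniq filter_uniq ?enum_uniq // andbT /=.
  by apply/hasPn => i; rewrite mem_filter => /andP[].
have mext h i : i \in ext h by rewrite mem_cat mem_filter mem_enum andbT orbN.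
have sext h : injective h -> size (ext h) = n.
  by move=> /uext/card_uniqP <-; rewrite (eq_card (B := predT)) ?card_ord // => i; rewrite mext.
have [v0|noT] := pickP (fun _ : T => true); last by exists 1%g => v; have := noT v.
pose i0 := f v0.
have sI : injective (fun i => nth i0 (ext g) (index i (ext f))).
  have lt i : (index i (ext f) < size (ext g))%N.
    have -> : size (ext g) = size (ext f) by rewrite !sext.
    by rewrite index_mem.
  move=> i j /eqP; rewrite nth_uniq ?uext //.
  by move=> /eqP/(congr1 (nth i0 (ext f))); rewrite !nth_index.
exists (perm sI) => v; rewrite permE /ext index_cat codom_f nth_cat.
have vlt : (index (f v) (codom f) < size (codom g))%N.
  by rewrite !size_codom -[X in (_ < X)%N](size_codom f) index_mem codom_f.
rewrite vlt /codom /image_mem index_map // (nth_map v) ?nth_index ?mem_enum //.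
by rewrite index_mem mem_enum.
Qed.

Definition spread (f : vertex d -> 'I_n) (i : 'I_n) : seq (vertex d) := [seq v <- enum 'I_d.*2 | f v == i].

Lemma mem_spread f v i : (v \in spread f i) = (f v == i).
Proof. by rewrite mem_filter mem_enum andbT. Qed.

Lemma spread_arrangement f : arrangement (spread f).
Proof.
apply/andP; split; first (apply/andP; split).
- by apply/forallP => i; rewrite filter_uniq ?enum_uniq.
- apply/forallP => i; apply/forallP => j; apply/forallP => v; rewrite !mem_spread.
  by apply/implyP => /andP[/eqP -> /eqP ->].
- by apply/forallP => v; apply/existsP; exists (f v); rewrite mem_spread.
Qed.

Lemma spread_inj f v : injective f -> spread f (f v) = [:: v].
Proof.
move=> fI; rewrite /spread (eq_filter (a2 := pred1 v)) => [|w]; last by rewrite /= (inj_eq fI).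
by rewrite filter_pred1_uniq ?enum_uniq ?mem_enum.
Qed.

Lemma spread_nil f i : (forall v, f v != i) -> spread f i = [::].
Proof. by move=> fi; rewrite /spread (eq_filter (a2 := pred0)) ?filter_pred0 // => v; apply/negbTE. Qed.

End Spread.

(** * Generation and indecomposability from one leg per arc *)

Section Generation.
Variables (K : fieldType) (d n : nat).
Hypothesis dn : (d.*2 <= n)%N.
Implicit Types (L : 'I_n -> seq (vertex d)) (x : {perm vertex d} -> K).

Definition base_legs : 'I_n -> seq (vertex d) := spread (widen_ord dn).

Lemma widen_inj : injective (widen_ord dn).
Proof. by move=> v w /(congr1 (@nat_of_ord _)) /= /ord_inj. Qed.

(** Otherwise the first legs of the arcs give an injection of the n arcs into the 2d legs; as 2d <=
    n it is onto, but the second leg of arc [j] is not the first leg of any arc. *)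
Lemma empty_arc L j : arrangement L -> (1 < size (L j))%N -> exists e, L e = [::].
Proof.
move=> aL; case Lj : (L j) => [|a [|a' l]] // _; have /andP[okL _] := aL.
have [e /eqP|ne] := pickP (fun e => L e == [::]); first by exists e.
pose h i := head a (L i).
have hL i : h i \in L i by rewrite /h; have := ne i; case: (L i) => //= b l' _; apply: mem_head.
have hI : injective h.
  move=> i i' hh; have := hL i'; rewrite -hh => /(arcP _ _ okL) E.
  by have /(arcP _ _ okL) := hL i; rewrite E => -[].
have /imageP[i _ hi] : a' \in codom h.
  by apply: inj_card_onto => //; rewrite !card_ord.
have E : i = j.
  have /(arcP _ _ okL) := hL i; rewrite -hi.
  have /(arcP _ _ okL) -> : a' \in L j by rewrite Lj !inE eqxx orbT.
  by case.
have := arrangement_uniq j aL; rewrite Lj /=.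
by rewrite hi E /h Lj /= !inE eqxx.
Qed.

(* A chord diagram with two legs on some arc is g u - u, where u has a leg of
   that arc moved to an empty arc e and g slides that leg back. *)
Lemma Aut_generation x (U : {vspace jacobi K d n}) : Aut_submodule U ->
  chords base_legs x \in U -> forall L, arrangement L -> chords L x \in U.
Proof.
move=> UA xU L; have [k] := ubnP #|[pred e | L e == [::]]|; elim: k L => // k IHk L.
rewrite ltnS => hk aL; have /andP[okL /forallP uL] := aL.
have [j lt1|small] := pickP (fun j => 1 < size (L j))%N; last first.
  (* When every arc carries at most one leg, a permutation of the arcs carries [base_legs] to
     [L]. *)
  have arcE v : exists i, L i == [:: v].
    have /existsP[i vi] := uL v; exists i; have := small i; move: vi.
    by case: (L i) => [|w [|//]] //; rewrite mem_seq1 => /eqP ->.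
  pose f v := xchoose (arcE v); have fE v : L (f v) = [:: v] by apply/eqP/(xchooseP (arcE v)).
  have fI : injective f by move=> v w vw; have := fE v; rewrite vw fE => -[].
  have [s sf] := extend_inj fI widen_inj.
  have -> : chords L x = chords (fun j => base_legs (s j)) x.
    apply: eq_chords => // i; case Li : (L i) (small i) => [|v [|//]] _.
      rewrite /base_legs spread_nil // => v; rewrite -sf (inj_eq perm_inj).
      by apply: contra_eqN Li => /eqP <-; rewrite fE.
    have -> : i = f v.
      have vi : v \in L i by rewrite Li mem_head.
      have vf : v \in L (f v) by rewrite fE mem_head.
      by move: vi vf => /(arcP _ _ okL) vi /(arcP _ _ okL); rewrite vi => -[].
    by rewrite sf /base_legs spread_inj //; apply: widen_inj.
  rewrite -(jacobi_map_perm s) ?spread_arrangement //.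
  by apply: UA => //; apply: perm_hom_bij.
have [e Le] := empty_arc aL lt1.
case Lj : (L j) lt1 => [//|l lj] lj0.
have ej : e != j by apply: contra_eqN Le => /eqP ->; rewrite Lj.
pose L' i := if i == e then [:: l] else if i == j then lj else L i.
have aL' : arrangement L'.
  have neq := negPf ej.
  have mE v i : (v \in L i) = (arc L v == Some i) by apply/(arcP _ _ okL)/eqP.
  have := arrangement_uniq j aL; rewrite Lj => /andP[ll ulj].
  have arcl : arc L l = Some j by apply/(arcP _ _ okL); rewrite Lj mem_head.
  have memE v i : (v \in L' i) = (if v == l then i == e else v \in L i).
    rewrite /L'; have [->|ie] := eqVneq i e; first by rewrite mem_seq1 Le; case: eqP.
    have [->|ij] := eqVneq i j; first by rewrite Lj in_cons; case: eqP => [->|//]; rewrite (negPf ll).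
    by case: eqP => // ->; rewrite mE arcl (inj_eq Some_inj) eq_sym (negPf ij).
  apply/andP; split; first (apply/andP; split).
  - by apply/forallP => i; rewrite /L'; case: eqP => // _; case: eqP => // _; apply: arrangement_uniq.
  - apply/forallP => i; apply/forallP => i'; apply/forallP => v; apply/implyP; rewrite !memE.
    case: eqP => _ /andP[]; first by move=> /eqP -> /eqP ->.
    by rewrite !mE => /eqP -> /eqP[->].
  apply/forallP => v; apply/existsP; have /existsP[i vi] := uL v.
  by have [->|vl] := eqVneq v l; [exists e | exists i]; rewrite memE ?eqxx // (negPf vl).
have L'U : chords L' x \in U.
  apply: IHk aL'; apply: leq_trans hk; apply: proper_card; apply/properP; split.
    apply/subsetP => i; rewrite !inE /L'; have [//|_] := eqVneq i e; have [_|//] := eqVneq i j.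
    by case: (lj) lj0.
  by exists e; rewrite !inE ?Le // /L' eqxx.
have -> : chords L x = jacobi_map (slide_hom false j e) (chords L' x) - chords L' x.
  rewrite (jacobi_map_slide false x ej aL' (l := l)); last by rewrite /L' eqxx.
  rewrite addrC addKr; apply: eq_chords => // i; rewrite /slide_legs /L'.
  case: eqP => [->//|_]; case: eqP => [->|//].
  by rewrite eq_sym (negPf ej) eqxx Lj.
by apply: rpredB => //; apply: UA => //; apply: slide_hom_bij.
Qed.

Definition preserves_submodules (T : jacobi K d n -> jacobi K d n) :=
  forall U : {vspace jacobi K d n}, Aut_submodule U -> forall u, u \in U -> T u \in U.

(* An idempotent endomorphism commuting with Aut(F_n) maps the generator to an
   element annihilated by everything that annihilates the generator. *)
Lemma indecomposable_generated x :
  (forall q : jacobi K d n,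
     (forall T : {linear jacobi K d n -> jacobi K d n}, preserves_submodules T ->
        T (chords base_legs x) = 0 -> T q = 0) ->
     exists a, q = a *: chords base_legs x) ->
  generated n x <> 0%VS -> indecomposable (generated n x).
Proof.
move=> scal ne0; split=> // -[U1 [U2 [[_ A1 A2 sumU dir] n1 n2]]].
have aB : arrangement base_legs := spread_arrangement _.
have dU u : u \in U1 -> u \in U2 -> u = 0.
  move=> u1 u2; apply/eqP; rewrite -memv0.
  by have /directv_addP <- := dir; rewrite memv_cap u1.
have /memv_addP[q1 q1U [q2 q2U Xq]] : chords base_legs x \in (U1 + U2)%VS by rewrite sumU mem_generated.
(* If [T] kills the generator, then [T q1 = - T q2] lies in both summands. *)
have [|a q1a] := scal q1.
  move=> T TP; rewrite Xq linearD /= => /eqP; rewrite addr_eq0 => /eqP TE.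
  by apply: dU; [apply: TP | rewrite TE rpredN; apply: TP].
have sub1 U : Aut_submodule U -> chords base_legs x \in U -> (generated n x <= U)%VS.
  by move=> UA xU; apply: generated_ind; apply: Aut_generation.
have [a0|a0] := eqVneq a 0.
  have XU : chords base_legs x \in U2 by rewrite Xq q1a a0 scale0r add0r.
  apply: n1; apply/eqP; rewrite -subv0; apply/subvP => u uU; rewrite memv0; apply/eqP/dU => //.
  by apply: (subvP (sub1 _ A2 XU)); rewrite -sumU (subvP (addvSl _ _)).
have XU : chords base_legs x \in U1.
  by rewrite -[chords _ _](scalerK a0) -q1a; apply: memvZ.
apply: n2; apply/eqP; rewrite -subv0; apply/subvP => u uU; rewrite memv0; apply/eqP/dU => //.
by apply: (subvP (sub1 _ A1 XU)); rewrite -sumU (subvP (addvSr _ _)).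
Qed.

End Generation.

(** * Indecomposability of AP *)

Section Parity.
Variables (K : fieldType) (d n : nat).
Hypothesis charK : [pchar K]%R =i pred0.
Hypothesis dn : (d.*2 <= n)%N.
Implicit Types (D : diagram d n) (q : jacobi K d n) (u x : {perm vertex d} -> K).

Notation B := (base_legs dn).
Notation wid := (widen_ord dn).

Lemma natr_char0_neq0 k : (0 < k)%N -> k%:R != 0 :> K.
Proof. by have /pcharf0P -> := charK; rewrite lt0n. Qed.

Definition span_avoiding_empty (s : seq 'I_n) : {vspace jacobi K d n} :=
  <<[seq class K D | D in [pred D | all (fun k => legs D k != [::]) s]]>>%VS.

Lemma mem_span_avoiding_empty s D :
  all (fun k => legs D k != [::]) s -> class K D \in span_avoiding_empty s.
Proof. by move=> sD; apply/memv_span/imageP; exists D. Qed.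

(** Twice [q] is its image under the identity minus the flip. That operator kills the diagrams with
    arc [k] empty and keeps the nonempty arcs of the others nonempty. *)
Lemma flip_odd_step s k q : q \in span_avoiding_empty s -> jacobi_map (flip_hom k) q = - q ->
  q \in span_avoiding_empty (k :: s).
Proof.
move=> qs fq; have two0 : 2%:R != 0 :> K by apply: natr_char0_neq0.
pose T : {linear jacobi K d n -> jacobi K d n} := idfun \- jacobi_map (flip_hom k).
have Tq : T q = 2%:R *: q by rewrite /T /= fq opprK scaler_nat.
rewrite -[q](scalerK two0) -Tq; apply: memvZ; rewrite -[T q]lfunE memv_preim.
move: q qs {fq Tq}; apply/subvP/span_subvP => _ /imageP[D sD ->].
rewrite -memv_preim lfunE /T /= jacobi_map_flip.
have [Dk|Dk] := eqVneq (legs D k) [::].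
  rewrite Dk expr0 scale1r (@dclassE _ _ _ D) ?subrr ?mem0v // => j.
  by case: eqP => // ->; rewrite Dk.
apply: rpredB; first by apply: mem_span_avoiding_empty; rewrite /= Dk.
apply: memvZ; set L' := (X in dclass K X _).
have [->|/dclass_mem[D' [lD' mD']]] := eqVneq (dclass K L' (mate D)) 0; first exact: mem0v.
have L'0 j : (L' j == [::]) = (legs D j == [::]).
  by rewrite /L'; case: (j == k); rewrite // -!size_eq0 size_rev.
rewrite (dclassE K lD' mD'); apply: mem_span_avoiding_empty => /=.
rewrite lD' L'0 Dk /=; apply/allP => j js; rewrite lD' L'0.
by move/allP: sD; apply.
Qed.

Lemma flip_odd_span s q : (forall k, k \in s -> jacobi_map (flip_hom k) q = - q) ->
  q \in span_avoiding_empty s.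
Proof.
elim: s => [_|k s IHs odd]; last first.
  apply: flip_odd_step; last by apply: odd; rewrite mem_head.
  by apply: IHs => j js; apply: odd; rewrite inE js orbT.
by rewrite (class_span q); apply: memv_suml => D _; apply/memvZ/mem_span_avoiding_empty.
Qed.

(* At most 2d legs are spread over 2d arcs, so each of these arcs has exactly one. *)
Lemma base_legs_diagram D : (forall v, legs D (wid v) != [::]) ->
  exists m, class K D = chord K B m.
Proof.
move=> ne; have okL := legsP D.
pose h v := head v (legs D (wid v)).
have hL v : h v \in legs D (wid v).
  by rewrite /h; have := ne v; case: (legs D (wid v)) => //= b l' _; apply: mem_head.
have hI : injective h.
  move=> v w vw; have := hL w; rewrite -vw => /(arcP _ _ okL) E.
  by have /(arcP _ _ okL) := hL v; rewrite E => -[] /ord_inj.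
pose s := perm hI; have sE v : s v = h v by rewrite permE.
have mE v i : (s v \in legs D i) = (i == wid v).
  have E : arc (legs D) (s v) = Some (wid v) by apply/(arcP _ _ okL); rewrite sE.
  by apply/(arcP _ _ okL)/eqP => [|->//]; rewrite E => -[].
have cD : chordal D.
  apply/forallP => v; apply/existsP; exists (wid (s^-1%g v)).
  by rewrite -{1}(permKV s v) mE.
have LL i : legs D i = map s (B i).
  have uD : uniq (legs D i) by apply: arrangement_uniq; rewrite legs_arrangement.
  have [/imageP[v _ iE]|iN] := boolP (i \in codom wid).
    rewrite iE in uD *; rewrite /base_legs spread_inj; last exact: widen_inj.
    apply: perm_small_eq => //; apply: uniq_perm => //.
    move=> w; rewrite -(permKV s w) mE mem_seq1 (inj_eq perm_inj) eq_sym.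
    by rewrite (inj_eq (@widen_inj _ _ dn)).
  have nowid v : wid v != i by apply: contraNneq iN => <-; apply: codom_f.
  rewrite /base_legs spread_nil //; case E: (legs D i) => [//|w l].
  have : w \in legs D i by rewrite E mem_head.
  by rewrite -(permKV s w) mE eq_sym (negPf (nowid _)).
have [m [pm _ ->]] := chordalP K cD; exists (m ^ s^-1)%g.
by rewrite -{1}(conjgKV s m) (chord_conj _ _ (spread_arrangement _) LL).
Qed.

Lemma flip_odd_base q : (forall v, jacobi_map (flip_hom (wid v)) q = - q) ->
  exists u, q = chords B u.
Proof.
move=> odd; have : q \in span_avoiding_empty (codom wid).
  by apply: flip_odd_span => _ /imageP[v _ ->].
pose F (u : {ffun {perm vertex d} -> K^o}) : jacobi K d n := @chords K d n B u.
have F_lin : linear F.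
  move=> a u1 u2; rewrite /F -chordsZ -chordsD; apply: eq_chords => // m _.
  by rewrite !ffunE.
pose F' := GRing.isLinear.Build K _ _ _ F F_lin.
pose FL : {linear {ffun {perm vertex d} -> K^o} -> jacobi K d n} := HB.pack F F'.
move=> qs; suff /memv_imgP[u _ qE] : q \in limg (linfun FL) by exists (u : _ -> K); rewrite qE lfunE.
move: q qs {odd}; apply/subvP/span_subvP => _ /imageP[D /allP sD ->].
have [|m ->] := @base_legs_diagram D; first by move=> v; apply/sD/codom_f.
have <- : linfun FL [ffun m' => (m' == m)%:R] = chord K B m.
  by rewrite lfunE -chords_delta; apply: eq_chords => // m' _; rewrite ffunE.
by apply: memv_img; apply: memvf.
Qed.

Lemma flip_base v x : jacobi_map (flip_hom (wid v)) (chords B x) = - chords B x.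
Proof.
rewrite /chords linear_sum /= -sumrN; apply: eq_bigr => m _.
rewrite linearZ /= -scalerN; congr (_ *: _).
rewrite /chord; case: ifP => pm; last by rewrite linear0 oppr0.
have [D [lD mD]] := chord_exists (spread_arrangement wid) pm.
have Bv : B (wid v) = [:: v] by apply: spread_inj; apply: widen_inj.
rewrite (dclassE K lD mD) jacobi_map_flip lD -/B Bv expr1 scaleN1r; congr (- _).
apply: dclassE => // j; case: eqP => // ->.
by rewrite lD -/B Bv.
Qed.

(** The permutation of the arcs moves the leg of each base arc to another one; renaming the legs
    back turns this into conjugation of the matchings. *)
Lemma perm_base (s : {perm vertex d}) : exists s' : {perm 'I_n},
  forall x, jacobi_map (perm_hom s') (chords B x) = chords B (fun m => x (m ^ s)%g).
Proof.
have [s' s'E] := @extend_inj _ _ wid (fun v => wid (s v)) (@widen_inj _ _ dn)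
  (inj_comp (@widen_inj _ _ dn) (@perm_inj _ s)).
exists s' => x; rewrite jacobi_map_perm ?spread_arrangement //.
apply: chords_conj; first exact: spread_arrangement.
move=> i; have [/imageP[v _ ->]|iN] := boolP (i \in codom wid).
  by rewrite s'E /base_legs !spread_inj //; apply: widen_inj.
rewrite /base_legs !spread_nil // => v; first by apply: contraNneq iN => <-; apply: codom_f.
rewrite -[v](permKV s) -s'E (inj_eq perm_inj).
by apply: contraNneq iN => <-; apply: codom_f.
Qed.

Lemma indecomposable_AP : AP K d n <> 0%VS -> indecomposable (AP K d n).
Proof.
rewrite generatedP; apply: (@indecomposable_generated K d n dn) => q qP.
have [v|u qu] := @flip_odd_base q.
  apply/eqP; rewrite -addr_eq0; apply/eqP; apply: (qP (jacobi_map (flip_hom (wid v)) \+ idfun)).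
    by move=> U UA w wU; apply: rpredD => //; apply: UA => //; apply: flip_hom_bij.
  by rewrite /= flip_base addNr.
have qs (s : {perm vertex d}) : q = chords B (fun m => u (m ^ s)%g).
  have [s' s'E] := perm_base s; rewrite -s'E -qu; apply/esym/eqP; rewrite -subr_eq0; apply/eqP.
  apply: (qP (jacobi_map (perm_hom s') \- idfun)).
    by move=> U UA w wU; apply: rpredB => //; apply: UA => //; apply: perm_hom_bij.
  rewrite /= s'E (eq_chords (L' := B) (y := @coefP K d)) ?subrr // => m _.
  exact: coefPJ.
(* Averaging [q] over all [s] makes its coefficients constant, equal to [C / N], on perfect
   matchings; [c] is the constant value of [coefP]. *)
pose N : K := #|{perm vertex d}|%:R; pose C := \sum_s u (matP d ^ s)%g; pose c := coefP K (matP d).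
have c0 : c != 0.
  rewrite /c /coefP -natr_sum; apply: natr_char0_neq0.
  by rewrite (bigD1 1%g) //= conjg1 eqxx.
have N0 : N != 0 by apply: natr_char0_neq0; apply/card_gt0P; exists 1%g.
exists (N^-1 * (C / c)).
have Nq : N *: q = (C / c) *: chords B (@coefP K d).
  rewrite scaler_nat -sumr_const (eq_bigr _ (fun s _ => qs s)) -(chords_sum B (fun s m => u (m ^ s)%g)) -chordsZ.
  apply: eq_chords => // m pm; have [t ->] := perfect_conj (perfect_matP d) pm.
  rewrite coefPJ -mulrA mulVf // mulr1 (reindex_inj (mulgI t^-1%g)).
  by apply: eq_bigr => s _; rewrite -conjgM mulKVg.
by rewrite -scalerA -Nq scalerK.
Qed.

End Parity.

(** * A weight system of level one *)

Section Before.
Variable T : eqType.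
Implicit Types (p q u v : T) (s : seq T).

Lemma subseq2_cat p q s1 s2 : subseq [:: p; q] (s1 ++ s2) =
  [|| subseq [:: p; q] s1, (p \in s1) && (q \in s2) | subseq [:: p; q] s2].
Proof.
have sub1 (z : T) s : subseq [:: z] s = (z \in s) by rewrite sub1seq.
elim: s1 => //= w s1 IHs; have [->|pw] := eqVneq p w.
  rewrite -/(subseq [:: q] _) -/(subseq [:: q] _) !sub1 mem_cat in_cons eqxx /=.
  case: (q \in s1) => //=; case qs: (q \in s2) => //=.
  by apply/esym/negP => /mem_subseq/(_ q); rewrite !inE eqxx orbT qs => /(_ isT).
by rewrite IHs in_cons (negPf pw).
Qed.

(** Exchanging two neighbours changes the relative order of no other pair. *)
Lemma subseq2_swap u v p q s1 s2 : (p, q) != (u, v) -> (p, q) != (v, u) ->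
  subseq [:: p; q] (s1 ++ [:: u; v] ++ s2) = subseq [:: p; q] (s1 ++ [:: v; u] ++ s2).
Proof.
move=> ne1 ne2; rewrite !subseq2_cat; congr [|| _, _ | _].
  by rewrite !mem_cat !inE [(q == u) || _]orbC.
congr [|| _, _ | _]; last by rewrite !inE [(p == u) || _]orbC.
by move: ne1 ne2; rewrite /= !xpair_eqE; do !case: eqP => //=.
Qed.

End Before.

Section Weight.
Variables (K : fieldType) (d n : nat).
Hypothesis two0 : 2%:R != 0 :> K.
Variables (eps : option 'I_n -> option 'I_n -> option 'I_n -> K) (kap : rel (option 'I_n)).
Hypothesis eps_cyclic : forall x y z, eps x y z = eps y z x.
Hypothesis eps_anti : forall x y z, eps x z y = - eps x y z.
Implicit Types (D : diagram d n) (u v w p q : vertex d).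

Lemma eps_diag x y : eps x y y = 0.
Proof.
apply/eqP; have := eps_anti x y y => /eqP; rewrite -addr_eq0 -mulr2n -mulr_natl mulf_eq0.
by rewrite (negPf two0).
Qed.

Lemma eps_shift (F : 'I_3 -> option 'I_n) k :
  eps (F 0) (F 1) (F 2) = eps (F k) (F (k + 1)) (F (k + 2)).
Proof.
have [->|[->|->]] : k = 0 \/ k = 1 \/ k = 2.
- by case: k => -[|[|[|//]]] lt; [left | right; left | right; right]; apply: val_inj.
- by rewrite !add0r.
- have -> : 1 + 1 = 2 :> 'I_3 by apply: val_inj.
  have -> : 1 + 2 = 0 :> 'I_3 by apply: val_inj.
  exact: eps_cyclic.
have -> : 2 + 1 = 0 :> 'I_3 by apply: val_inj.
have -> : 2 + 2 = 1 :> 'I_3 by apply: val_inj.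
by rewrite -eps_cyclic.
Qed.

Definition leg_end D v (k : 'I_3) : option 'I_n := arc (legs D) (mate D (v, k)).1.

(** [S] is meant for the ends of the two chords that merge into a tripod; the other chords must join
    arcs related by [kap], and edges at a trivalent vertex are exempt. *)
Definition chords_match D (S : pred (vertex d)) :=
  [forall w, [&& univalent (legs D) w, univalent (legs D) (mate D (w, 0)).1 & ~~ S w]
     ==> kap (arc (legs D) w) (leg_end D w 0)].

Definition before D p q := [exists i, subseq [:: p; q] (legs D i)].

(** The tripod obtained by commuting legs [p] and [q] on a common arc: its half-edges (s, b, a) end
    at that arc, at the partner of [q] and at the partner of [p]. *)
Definition pair_weight D p q : K :=
  eps (arc (legs D) p) (leg_end D q 0) (leg_end D p 0)
  * (chords_match D (mem [:: p; q; (mate D (p, 0)).1; (mate D (q, 0)).1]))%:R.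

(** The factor 1/2: exchanging two neighbouring legs replaces the term of one order by that of the
    other, its negative, so the sum changes by twice a pair weight. *)
Definition chordal_weight D : K :=
  2%:R^-1 * \sum_p \sum_q (before D p q)%:R * pair_weight D p q.

Definition tripod_weight D : K :=
  \sum_(v | ~~ univalent (legs D) v)
    eps (leg_end D v 0) (leg_end D v 1) (leg_end D v 2) * (chords_match D pred0)%:R.

(* A weight system of level one: up to the chords, it sees a tripod through the
   alternating function [eps] and a chord diagram through the tripods that arise
   by commuting pairs of legs on a common arc. *)
Definition weight D : K :=
  match #|[pred v | ~~ univalent (legs D) v]| with
  | 0%N => chordal_weight D
  | 1%N => tripod_weight D
  | _ => 0
  end.

Lemma weight_iso D D' : diagram_iso D D' -> weight D = weight D'.
Proof.
case/existsP=> s /existsP[r /and3P[/forallP rP /forallP l /forallP m]].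
have LL i : legs D' i = map s (legs D i) by apply/eqP.
have uE v : univalent (legs D') (s v) = univalent (legs D) v by apply: univalent_map.
have endE v k : leg_end D' (s v) (k + r v) = leg_end D v k.
  by rewrite /leg_end; have /eqP /= -> := m (v, k); rewrite (arc_map _ LL).
have r0 v : univalent (legs D) v -> r v = 0 by move=> uv; apply/eqP/(implyP (rP v)).
have end0 v : univalent (legs D) v -> leg_end D' (s v) 0 = leg_end D v 0.
  by move=> uv; rewrite -(endE v 0) r0 ?addr0.
have mate0 v : univalent (legs D) v -> (mate D' (s v, 0)).1 = s (mate D (v, 0)).1.
  by move=> uv; have /eqP /= := m (v, 0); rewrite r0 // addr0 => ->.
have matchE (S S' : pred (vertex d)) : (forall w, S' (s w) = S w) -> chords_match D S = chords_match D' S'.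
  move=> SS; have core w :
    [&& univalent (legs D') (s w), univalent (legs D') (mate D' (s w, 0)).1 & ~~ S' (s w)]
       ==> kap (arc (legs D') (s w)) (leg_end D' (s w) 0)
    = ([&& univalent (legs D) w, univalent (legs D) (mate D (w, 0)).1 & ~~ S w]
       ==> kap (arc (legs D) w) (leg_end D w 0)).
    rewrite SS uE (arc_map _ LL); case uw: (univalent _ _) => //=.
    by rewrite mate0 ?uE // end0.
  apply/forallP/forallP => h w; last by rewrite -core.
  by rewrite -(permKV s w) core.
have -> : weight D = match #|[pred v | ~~ univalent (legs D') v]| with
  | 0%N => chordal_weight D | 1%N => tripod_weight D | _ => 0 end.
  congr (match _ with 0%N => _ | _ => _ end).
  rewrite -[LHS](card_image (@perm_inj _ s)); apply: eq_card => v; rewrite !inE.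
  apply/imageP/idP => [[w wD ->]|vD]; first by rewrite uE.
  by exists (s^-1%g v); rewrite ?permKV // inE -uE permKV.
rewrite /weight; case E: #|_| => [|[|//]].
  have uD v : univalent (legs D) v.
    by have := card0_eq E (s v); rewrite !inE uE => /negbFE.
  congr (_ * _); rewrite [RHS](reindex_inj (@perm_inj _ s)); apply: eq_bigr => p _.
  rewrite [RHS](reindex_inj (@perm_inj _ s)); apply: eq_bigr => q _.
  congr ((nat_of_bool _)%:R * _).
    apply: eq_existsb => i; rewrite LL -[ [:: s p; s q]]/(map s [:: p; q]).
    apply/idP/idP; first exact: map_subseq.
    by move=> /(map_subseq (s^-1)%g); rewrite !(mapK (permK s)).
  rewrite /pair_weight (arc_map _ LL) !end0 // !mate0 //; congr (_ * (nat_of_bool _)%:R).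
  by apply: matchE => w; rewrite /= !inE !(inj_eq perm_inj).
rewrite /tripod_weight [RHS](reindex_inj (@perm_inj _ s)).
apply: eq_big => [v|v nuv]; first by rewrite uE.
rewrite (matchE pred0 pred0) //; congr (_ * _).
by rewrite -!endE (eps_shift (leg_end D' (s v)) (r v)) add0r [1 + _]addrC [2 + _]addrC.
Qed.

Section Triple.
Variables (D D1 D2 : diagram d n) (u v : vertex d) (i : 'I_3).
Hypothesis uu : univalent (legs D) u.
Hypothesis vv : ~~ univalent (legs D) v.
Hypothesis l1 : forall k, legs D1 k = subst2 u u v (legs D k).
Hypothesis l2 : forall k, legs D2 k = subst2 u v u (legs D k).
Hypothesis ui : mate D (u, 0) = (v, i).
Hypothesis mm : forall h, [&& used (legs D) h, h != (u, 0) & h != (v, i)] ->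
  (mate D1 (STU_shift u v i h) = STU_shift u v i (mate D h))
  /\ (mate D2 (STU_shift u v i h) = STU_shift u v i (mate D h)).

Let mem12 := STU_mem_legs uu vv l1 l2.
Let uni12 := STU_univalent uu vv l1 l2.
Let mate12 := STU_mate uu vv l1 l2 mm.
Let uv : u != v := STU_neq uu vv.

Let arc12 w : arc (legs D1) w = arc (legs D2) w.
Proof. by apply: eq_pick => k; rewrite /= !mem12. Qed.

Let arc1 w : w != v -> arc (legs D1) w = arc (legs D) w.
Proof. by move=> /negPf wv; apply: eq_pick => k; rewrite /= mem12 wv orbF. Qed.

Let arc1v : arc (legs D1) v = arc (legs D) u.
Proof. by apply: eq_pick => k; rewrite /= mem12 eqxx (negPf (STU_new_leg vv k)). Qed.

Let end12 w k : leg_end D1 w k = leg_end D2 w k.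
Proof. by rewrite /leg_end mate12 arc12. Qed.

Let match12 S : chords_match D1 S = chords_match D2 S.
Proof. by apply: eq_forallb => w; rewrite !uni12 mate12 arc12 end12. Qed.

Let before12 p q : (p, q) != (u, v) -> (p, q) != (v, u) -> before D1 p q = before D2 p q.
Proof.
move=> ne1 ne2; apply: eq_existsb => k; rewrite l1 l2.
have [uk|uk] := boolP (u \in legs D k); last by rewrite !subst2_id.
have /andP[/forallP/(_ k) + _] := legsP D; case/splitPr: uk => s1 s2.
rewrite cat_uniq /= negb_or => /and4P[_ /andP[us1 _] us2 _].
by rewrite !subst2_cat !subst2_cons eqxx !subst2_id // subseq2_swap.
Qed.

Let before_uv : [/\ before D1 u v, ~~ before D1 v u, before D2 v u & ~~ before D2 u v].
Proof.
have H (E : diagram d n) x y : x != y -> (forall k, legs E k = subst2 u x y (legs D k)) ->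
    (x == u) && (y == v) || (x == v) && (y == u) -> before E x y /\ ~~ before E y x.
  move=> xy lE xyuv.
  have key k : u \in legs D k -> exists s1 s2, legs E k = s1 ++ [:: x; y] ++ s2.
    have /andP[/forallP/(_ k) + _] := legsP D; rewrite lE => + uk; case/splitPr: uk => s1 s2.
    rewrite cat_uniq /= negb_or => /and4P[_ /andP[us1 _] us2 _].
    by exists s1, s2; rewrite subst2_cat subst2_cons eqxx !subst2_id.
  split.
    have /existsP[k uk] := uu; apply/existsP; exists k; have [s1 [s2 ->]] := key k uk.
    by rewrite !subseq2_cat /= !eqxx !orbT.
  apply/existsPn => k; apply/negP => sub.
  have uk : u \in legs D k.
    apply: contraT => uk; move: sub; rewrite lE subst2_id // => /mem_subseq sub.
    have := STU_new_leg vv k; rewrite (sub v) //.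
    by case/orP: xyuv => /andP[/eqP -> /eqP ->]; rewrite !inE eqxx ?orbT.
  have [s1 [s2 E12]] := key k uk.
  have /andP[/forallP/(_ k) + _] := legsP E; rewrite E12 in sub *.
  rewrite cat_uniq => /and3P[_ /hasPn d1]; rewrite cat_uniq => /and3P[_ /hasPn d2 _].
  have x1 : x \notin s1 by apply: d1; rewrite mem_cat !inE eqxx.
  have y1 : y \notin s1 by apply: d1; rewrite mem_cat !inE eqxx orbT.
  have x2 : x \notin s2 by apply/negP => /d2; rewrite !inE eqxx.
  have y2 : y \notin s2 by apply/negP => /d2; rewrite !inE eqxx orbT.
  have yx : subseq [:: y; x] [:: x; y] = false by rewrite /= eq_sym (negPf xy) eqxx.
  move: sub; rewrite !subseq2_cat (negPf y1) (negPf x2) andbF yx => /orP[] /mem_subseq sub.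
    by have := sub y; rewrite !inE eqxx (negPf y1) => /(_ isT).
  by have := sub y; rewrite !inE eqxx (negPf y2) => /(_ isT).
have [|b1 nb1] := H D1 u v uv l1; first by rewrite !eqxx.
have [||b2 nb2] := H D2 v u _ l2; [by rewrite eq_sym | by rewrite !eqxx orbT |].
by split.
Qed.

Let pair_weight_sym p q : arc (legs D1) p = arc (legs D1) q ->
  pair_weight D1 q p = - pair_weight D1 p q.
Proof.
move=> pq; rewrite /pair_weight pq eps_anti mulNr; congr (- (_ * (nat_of_bool _)%:R)).
apply: eq_forallb => w; rewrite /= !inE; congr (_ && (_ && ~~ _) ==> _).
by case: (w == p); case: (w == q); rewrite //= orbC.
Qed.

Let chordal_weight_diff : chordal_weight D1 - chordal_weight D2 = pair_weight D1 u v.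
Proof.
have [b1 nb1 b2 nb2] := before_uv.
have w12 p q : pair_weight D2 p q = pair_weight D1 p q.
  by rewrite /pair_weight -!end12 -arc12 -match12 !mate12.
rewrite /chordal_weight -mulrBr -sumrB.
have vu : v != u by rewrite eq_sym.
pose g p q := (before D1 p q)%:R * pair_weight D1 p q - (before D2 p q)%:R * pair_weight D2 p q.
have g0 p q : (p, q) != (u, v) -> (p, q) != (v, u) -> g p q = 0.
  by move=> ne1 ne2; rewrite /g w12 before12 ?subrr.
have -> : \sum_p (\sum_q (before D1 p q)%:R * pair_weight D1 p q
    - \sum_q (before D2 p q)%:R * pair_weight D2 p q) = g u v + g v u.
  have single (F : vertex d -> K) p0 : (forall p, p != p0 -> F p = 0) -> \sum_p F p = F p0.
    by move=> F0; rewrite (bigD1 p0) //= big1 ?addr0.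
  have double (F : vertex d -> K) : (forall p, p != u -> p != v -> F p = 0) -> \sum_p F p = F u + F v.
    move=> F0; rewrite (bigD1 u) //=; congr (_ + _); rewrite (bigD1 v) //= big1 ?addr0 //.
    by move=> p /andP[]; apply: F0.
  rewrite double => [|p pu pv]; rewrite -!sumrB -/(g _ _).
    rewrite (single (g u) v) ?(single (g v) u) // => q qw; apply: g0;
      by rewrite xpair_eqE ?(negPf qw) ?(negPf uv) ?(negPf vu) ?andbF.
  by rewrite big1 // => q _; apply: g0; rewrite xpair_eqE ?(negPf pu) ?(negPf pv).
rewrite /g !w12 b1 b2 (negPf nb1) (negPf nb2) !mul1r !mul0r subr0 sub0r.
rewrite (@pair_weight_sym u v) ?opprK; last by rewrite arc1v arc1.
by rewrite -mulr2n -(mulr_natl (pair_weight D1 u v)) mulrA mulVf // mul1r.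
Qed.

Lemma weight_STU_at : weight D = weight D1 - weight D2.
Proof.
have cE : #|[pred w | ~~ univalent (legs D) w]| = #|[pred w | ~~ univalent (legs D1) w]|.+1.
  rewrite (cardD1 v) inE vv add1n; congr S; apply: eq_card => w.
  by rewrite !inE !uni12 negb_or andbC.
have cE2 : #|[pred w | ~~ univalent (legs D2) w]| = #|[pred w | ~~ univalent (legs D1) w]|.
  by apply: eq_card => w; rewrite !inE !uni12.
rewrite /weight cE cE2; case c1: #|_| => [|[|k]]; last 2 first.
(* [D] has two trivalent vertices and weight 0; the tripod weight ignores the order of legs on an
   arc, so it agrees on [D1] and [D2]. *)
- apply/esym/eqP; rewrite subr_eq0; apply/eqP; apply: eq_big => [w|w _]; first by rewrite !uni12.
  by rewrite !end12 match12.
- by rewrite subrr.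
rewrite chordal_weight_diff.
have uD w : univalent (legs D) w = (w != v).
  have := card0_eq c1 w; rewrite !inE uni12 => /negbFE.
  by have [->|_] := eqVneq w v; rewrite ?(negPf vv) // orbF.
rewrite /tripod_weight (big_pred1 v) => [|w]; last by rewrite uD negbK.
(* Rotate so that the half-edge towards the leg [u] comes first. *)
rewrite (eps_shift _ i) /pair_weight.
have used_u : used (legs D) (u, 0) by rewrite /used uu.
have used_v k : used (legs D) (v, k) by rewrite /used (negPf vv).
have vi : mate D (v, i) = (u, 0) by have [_ _] := mate_used used_u; rewrite ui.
have mateD h : used (legs D) h -> h != (u, 0) -> h != (v, i) ->
    mate D1 (STU_shift u v i h) = STU_shift u v i (mate D h).
  by move=> uh hu hv; have [|] := @mm h; rewrite ?uh ?hu.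
have ord3 : ((i + 1 == i) = false) * ((i + 2 == i) = false) * ((i + 2 == i + 1) = false).
  by case: (i) => -[|[|[]]].
have ord3_cases (k : 'I_3) : [\/ k = i, k = i + 1 | k = i + 2].
  case: (i) k => -[|[|[|//]]] ? [[|[|[|//]]] ?];
  by [constructor 1; apply: val_inj | constructor 2; apply: val_inj | constructor 3; apply: val_inj].
have vu : v == u = false by rewrite eq_sym (negPf uv).
have mv : mate D1 (v, 0) = STU_shift u v i (mate D (v, i + 1)).
  by rewrite -mateD ?xpair_eqE ?vu ?ord3 ?andbF // /STU_shift eqxx.
have mu : mate D1 (u, 0) = STU_shift u v i (mate D (v, i + 2)).
  by rewrite -mateD ?xpair_eqE ?vu ?ord3 ?andbF // /STU_shift !xpair_eqE ord3 !eqxx.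
have arcv : arc (legs D) v = None by apply/eqP; rewrite arcN.
rewrite {1}/leg_end vi (arc1 uv).
(* If [v] carries a loop, two arguments of [eps] coincide on each side and both weights vanish. *)
have [loop|nloop] := eqVneq (mate D (v, i + 1)) (v, i + 2).
  have loop' : mate D (v, i + 2) = (v, i + 1) by have [_ _] := mate_used (used_v (i + 1)); rewrite loop.
  rewrite /leg_end mu mv loop loop' /STU_shift !xpair_eqE !eqxx ord3 /= arcv arc1v (arc1 uv).
  by rewrite !eps_diag !mul0r.
have outer k : k != i -> (mate D (v, k)).1 != v -> [/\ mate D (v, k) = ((mate D (v, k)).1, 0),
    (mate D (v, k)).1 != u & STU_shift u v i (mate D (v, k)) = mate D (v, k)].
  move=> ki; have [+ _ mk] := mate_used (used_v k).
  case: (mate D (v, k)) mk => w k' /= mk; rewrite /used uD /= => kw wv.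
  have k0 : k' = 0 by apply/eqP; rewrite wv in kw.
  rewrite {}k0 in mk *; split=> //; last by rewrite /STU_shift !xpair_eqE (negPf wv).
  by apply: contra_neqN ki => /eqP wu; move: mk; rewrite wu ui => -[->].
have n1 : (mate D (v, i + 1)).1 != v.
  apply: contraNneq nloop => E1; have [_ ne mk] := mate_used (used_v (i + 1)).
  move: ne mk; rewrite (surjective_pairing (mate D (v, i + 1))) E1.
  by case: (ord3_cases (mate D (v, i + 1)).2) => -> //; rewrite ?eqxx // vi => _ [/eqP]; rewrite (negPf uv).
have n2 : (mate D (v, i + 2)).1 != v.
  apply: contraNneq nloop => E1; have [_ ne mk] := mate_used (used_v (i + 2)).
  move: ne mk; rewrite (surjective_pairing (mate D (v, i + 2))) E1.
  case: (ord3_cases (mate D (v, i + 2)).2) => -> //; rewrite ?eqxx // ?vi; last by move=> _ ->.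
  by move=> _ [/eqP]; rewrite (negPf uv).
have [|e1 u1 s1] := outer (i + 1) _ n1; first by rewrite ord3.
have [|e2 u2 s2] := outer (i + 2) _ n2; first by rewrite ord3.
rewrite /leg_end mu mv s1 s2 !arc1 //; congr (_ * (nat_of_bool _)%:R).
apply: eq_forallb => w; rewrite !uni12 !uD !orNb /= !inE.
have [->|wv] /= := eqVneq w v; first by rewrite orbT.
rewrite andbT.
(* A leg joined to [v] is an end of the tripod, so it is exempt on both sides. *)
have [wv'|wv'] := eqVneq (mate D (w, 0)).1 v.
  have uw : used (legs D) (w, 0) by rewrite /used uD wv.
  have [_ _] := mate_used uw; rewrite (surjective_pairing (mate D (w, 0))) wv' /=.
  by case: (ord3_cases (mate D (w, 0)).2) => ->; rewrite ?vi => /(congr1 fst) /= <-; rewrite eqxx ?orbT.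
have notin y k : mate D (v, k) = (y, 0) -> w != y.
  move=> vy; apply: contra_neq wv' => ->.
  by have [_ _] := mate_used (used_v k); rewrite vy => ->.
rewrite (negPf (notin _ _ vi)) (negPf (notin _ _ e1)) (negPf (notin _ _ e2)) /=.
rewrite /leg_end; have -> : mate D1 (w, 0) = mate D (w, 0).
  have := mateD (w, 0); rewrite /used uD wv !xpair_eqE (negPf wv) (negPf (notin _ _ vi)) /=.
  move=> /(_ isT isT isT); rewrite /STU_shift !xpair_eqE (negPf wv) /= => ->.
  by rewrite (surjective_pairing (mate D (w, 0))) !xpair_eqE (negPf wv').
by rewrite !arc1.
Qed.

End Triple.

Lemma weight_STU D D1 D2 : STU D D1 D2 -> weight D = weight D1 - weight D2.
Proof.
by case/STU_witness=> u [v [i [uu vv ui [l1 l2] mm]]]; apply: (weight_STU_at uu vv l1 l2 ui mm).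
Qed.

Definition weight_map : {linear jacobi K d n -> K^o} := @jacobi_lift K d n K^o weight.

Lemma weight_map_class D : weight_map (class K D) = weight D.
Proof. exact: (@jacobi_liftE K d n K^o weight weight_iso weight_STU). Qed.

(** Exactly one ordered pair of legs shares an arc, so the double sum has a single term. *)
Lemma weight_map_chord L m p0 q0 : arrangement L -> perfect m ->
  (forall p q, [exists i, subseq [:: p; q] (L i)] = ((p, q) == (p0, q0))) ->
  weight_map (chord K L m) = 2%:R^-1 * (eps (arc L p0) (arc L (m q0)) (arc L (m p0))
    * [forall w, (w \notin [:: p0; q0; m p0; m q0]) ==> kap (arc L w) (arc L (m w))]%:R).
Proof.
move=> aL pm bE; have [D [lD mD]] := chord_exists aL pm.
rewrite (chordE K lD mD pm) weight_map_class /weight.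
have uD v : univalent (legs D) v by rewrite (eq_univalent lD); case/andP: aL => _ /forallP.
rewrite eq_card0 => [|v]; last by rewrite !inE uD.
have b0 p q : before D p q = ((p, q) == (p0, q0)).
  by rewrite -bE; apply: eq_existsb => i; rewrite lD.
congr (_ * _); rewrite (bigD1 p0) //= (bigD1 q0) //= b0 eqxx mul1r.
rewrite big1 ?addr0 => [|q /negPf qq]; last by rewrite b0 xpair_eqE qq andbF mul0r.
rewrite big1 ?addr0 => [|p /negPf pp]; last first.
  by rewrite big1 // => q _; rewrite b0 xpair_eqE pp mul0r.
rewrite /pair_weight /leg_end !(eq_arc lD) !mD /perm_mate /=; congr (_ * (nat_of_bool _)%:R).
by apply: eq_forallb => w; rewrite !uD /leg_end mD /perm_mate /= !(eq_arc lD).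
Qed.

End Weight.

(** * Indecomposability of AQ *)

Section FourTerm.
Variables (K : fieldType) (d n : nat) (dn : (d.*2 <= n)%N).

Notation B := (base_legs dn).
Notation wid := (widen_ord dn).
Notation slid beta a b := (slide_legs beta (wid a) (wid b) b B).

Let wid_eq (v w : vertex d) : (wid v == wid w) = (v == w).
Proof. exact: (inj_eq (@widen_inj _ _ dn)). Qed.

Lemma base_legs_at v : B (wid v) = [:: v].
Proof. by apply: spread_inj; apply: widen_inj. Qed.

Lemma arrangement_slid beta (a b : vertex d) : b != a -> arrangement (slid beta a b).
Proof.
move=> ba; apply: arrangement_slide; rewrite ?wid_eq ?base_legs_at //.
exact: spread_arrangement.
Qed.

(** The arc of [a] carries the two legs in one order or the other, so exchanging their labels
    exchanges the two sides of the slide. *)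
Lemma slid_swap beta (a b : vertex d) i : b != a ->
  slid beta a b i = map (tperm b a) (slid (~~ beta) a b i).
Proof.
move=> ba; rewrite /slide_legs; case: eqP => // /eqP ib; have [_|ia] := eqVneq i (wid a).
  by rewrite base_legs_at; case: beta; rewrite /= tpermL tpermR.
apply/esym/map_id_in => v; rewrite mem_spread => /eqP vi.
by rewrite tpermD // -wid_eq vi eq_sym.
Qed.

Section Tripod.
Variables (m : {perm vertex d}) (a b : vertex d).
Hypotheses (pm : perfect m) (ba : b != a) (bma : b != m a).

Let c := m a.
Let y := m b.

Let mK v : m (m v) = v. Proof. by have /perfectP/(_ v)[] := pm. Qed.
Let mN v : (m v == v) = false. Proof. by have /perfectP/(_ v)[/negPf] := pm. Qed.

(** The vertex [b] leaves its arc and becomes trivalent, with half-edges 0, 1, 2 ending at [a],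
    [m b], [m a]; the other chords of [m] stay, so the degree is unchanged. *)
Definition tripod_legs i : seq (vertex d) := [seq v <- B i | v != b].

Definition tripod_mate (h : half_edge d) : half_edge d :=
  if h.1 == b then (if h.2 == 0 then (a, 0) else if h.2 == 1 then (y, 0) else (c, 0))
  else if h.2 != 0 then h
  else if h.1 == a then (b, 0) else if h.1 == y then (b, 1) else if h.1 == c then (b, 2)
  else (m h.1, 0).

Lemma mem_tripod_legs v i : (v \in tripod_legs i) = (v != b) && (wid v == i).
Proof. by rewrite mem_filter mem_spread. Qed.

Lemma univalent_tripod v : univalent tripod_legs v = (v != b).
Proof.
apply/existsP/idP => [[i]|vb]; first by rewrite mem_tripod_legs => /andP[].
by exists (wid v); rewrite mem_tripod_legs vb eqxx.
Qed.

Lemma tripod_legs_ok : legs_ok tripod_legs.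
Proof.
apply/andP; split; apply/forallP => i.
  by rewrite filter_uniq // arrangement_uniq // spread_arrangement.
apply/forallP => j; apply/forallP => v; rewrite !mem_tripod_legs.
by apply/implyP => /andP[/andP[_ /eqP <-] /andP[_ /eqP <-]].
Qed.

Let neqs : ((a == b) = false) * ((c == b) = false) * ((y == b) = false) * ((c == a) = false)
  * ((y == a) = false) * ((y == c) = false) * ((b == a) = false) * ((b == c) = false)
  * ((b == y) = false) * ((a == c) = false) * ((a == y) = false) * ((c == y) = false).
Proof.
have e1 : (b == a) = false by apply/negbTE.
have e2 : (b == c) = false by apply/negbTE.
have e3 : (b == y) = false by rewrite eq_sym mN.
have e4 : (c == a) = false by rewrite mN.
have e5 : (y == a) = false by rewrite -(inj_eq (@perm_inj _ m)) mK.
have e6 : (y == c) = false by rewrite (inj_eq (@perm_inj _ m)).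
by do !split; rewrite // eq_sym.
Qed.

Let ord3P (k : 'I_3) : [\/ k = 0, k = 1 | k = 2].
Proof.
case: k => -[|[|[|//]]] lt;
  by [constructor 1; apply: val_inj | constructor 2; apply: val_inj | constructor 3; apply: val_inj].
Qed.

Lemma tripod_mate_ok : mate_ok tripod_legs tripod_mate.
Proof.
apply/forallP => -[w k]; rewrite /used /= univalent_tripod /tripod_mate /=.
have [->|wb] /= := eqVneq w b.
  by case: (ord3P k) => ->; rewrite /= univalent_tripod !neqs ?eqxx !xpair_eqE ?neqs //= ?eqxx.
have [->|k0] /= := eqVneq k 0; last by rewrite eqxx.
have [->|wa] := eqVneq w a; first by rewrite /= univalent_tripod !eqxx /= xpair_eqE neqs.
have [->|wy] := eqVneq w y; first by rewrite /= univalent_tripod !eqxx /= xpair_eqE neqs.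
have [->|wc] := eqVneq w c; first by rewrite /= univalent_tripod !eqxx /= xpair_eqE neqs.
have mwb : (m w == b) = false by rewrite -(inj_eq (@perm_inj _ m)) mK (negPf wy).
have mwa : (m w == a) = false by rewrite -(inj_eq (@perm_inj _ m)) mK (negPf wc).
have mwy : (m w == y) = false by rewrite (inj_eq (@perm_inj _ m)) (negPf wb).
have mwc : (m w == c) = false by rewrite (inj_eq (@perm_inj _ m)) (negPf wa).
by rewrite /= univalent_tripod mwb mwa mwy mwc xpair_eqE mN /= mK eqxx.
Qed.

Lemma tripod_grounded : grounded tripod_legs tripod_mate.
Proof.
apply/forallP => v; apply/existsP.
have [->|vb] := eqVneq v b; last by exists v; rewrite univalent_tripod vb connect0.
exists a; rewrite univalent_tripod neqs; apply: connect1; apply/existsP; exists 0.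
by rewrite /tripod_mate /= !eqxx.
Qed.

Definition tripod : diagram d n := mk_diagram tripod_legs_ok tripod_mate_ok tripod_grounded.

Lemma subst2_tripod_legs (z x1 x2 : vertex d) k : z != b ->
  subst2 z x1 x2 (tripod_legs k) =
  if k == wid b then [::] else if k == wid z then [:: x1; x2] else B k.
Proof.
move=> zb; rewrite /tripod_legs; have [->|kb] := eqVneq k (wid b).
  by rewrite base_legs_at /= eqxx.
have [->|kz] := eqVneq k (wid z); first by rewrite base_legs_at /= zb subst2_cons eqxx.
have -> : [seq v <- B k | v != b] = B k.
  apply/all_filterP/allP => v; rewrite mem_spread => /eqP vk.
  by apply: contra_neq kb => <-.
by rewrite subst2_id // mem_spread eq_sym.
Qed.

Lemma subst2_tripod_slid beta (z : vertex d) : z != b ->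
  (fun k => subst2 z (if beta then z else b) (if beta then b else z) (tripod_legs k)) =1 slid beta z b.
Proof.
move=> zb k; rewrite subst2_tripod_legs // /slide_legs.
by case: eqP => // _; case: eqP => // _; rewrite base_legs_at; case: beta.
Qed.

Let univalent_legs v : univalent (legs tripod) v = (v != b).
Proof. by rewrite (eq_univalent (legs_mk _ _ _)) univalent_tripod. Qed.

Let m_other w : w != b -> w != y -> w != a -> w != c ->
  [/\ (m w == b) = false, (m w == y) = false, (m w == a) = false & (m w == c) = false].
Proof.
move=> /negPf wb /negPf wy /negPf wa /negPf wc; split;
  by rewrite -1?(inj_eq (@perm_inj _ m)) ?mK ?(inj_eq (@perm_inj _ m)).
Qed.

Lemma class_resolved_tripod (z : vertex d) (m' : {perm vertex d}) (i : 'I_3) :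
  z != b -> perfect m' -> mate tripod (z, 0) = (b, i) ->
  resolved_mate tripod z b i =1 perm_mate m' ->
  class K tripod = chord K (slid true z b) m' - chord K (slid false z b) m'.
Proof.
move=> zb pm' zi mE.
have [||//|D1 [D2 [stu l1 l2 m1 m2]]] := @STU_resolve _ _ tripod z b i.
- by rewrite univalent_legs.
- by rewrite univalent_legs eqxx.
rewrite (class_STU K stu); congr (_ - _); apply/esym; apply: chordE => // k.
- by rewrite l1 legs_mk -(subst2_tripod_slid true zb).
- by rewrite m1 mE.
- by rewrite l2 legs_mk -(subst2_tripod_slid false zb).
- by rewrite m2 mE.
Qed.

(* Both differences resolve the tripod [tripod], at its legs on the arcs a and c. *)
Lemma four_term :
  (chord K (slid true a b) m - chord K (slid false a b) m)
  + (chord K (slid true c b) m - chord K (slid false c b) m) = 0.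
Proof.
have [i21 i22] : 2 + 1 = 0 :> 'I_3 /\ 2 + 2 = 1 :> 'I_3 by split; apply: val_inj.
rewrite -(@class_resolved_tripod a m 0) ?neqs //; first last.
- case=> w k; rewrite /resolved_mate /perm_mate /=; have [->|k0] /= := eqVneq k 0; last first.
    rewrite andbT; case: eqP => // /eqP wb; rewrite /STU_unshift !xpair_eqE (negPf k0) !andbF.
    by rewrite mate_mk /tripod_mate /= (negPf wb) k0 /STU_shift !xpair_eqE (negPf wb).
  rewrite andbF mate_mk /STU_unshift !xpair_eqE !eqxx !andbT !add0r.
  have [->|wb] := eqVneq w b; first by rewrite /tripod_mate /= eqxx /STU_shift !xpair_eqE !neqs.
  have [->|wa] := eqVneq w a; first by rewrite /tripod_mate /= eqxx /STU_shift !xpair_eqE !neqs.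
  rewrite /tripod_mate /= (negPf wb) (negPf wa).
  have [->|wy] := eqVneq w y; first by rewrite /STU_shift !xpair_eqE !eqxx mK.
  have [->|wc] := eqVneq w c; first by rewrite /STU_shift !xpair_eqE !eqxx mK.
  have [mb _ _ _] := m_other wb wy wa wc.
  by rewrite /STU_shift !xpair_eqE mb.
- by rewrite mate_mk /tripod_mate /= neqs eqxx.
(* At the leg [c], reached by half-edge 2, the resolution joins [b] to [a] by half-edge 0 and [c] to
   [m b] by half-edge 1: this is [m] with [b] and [c] exchanged. *)
pose t := tperm b c.
have tE w : (m ^ t)%g w = t (m (t w)) by rewrite -{1}[w](tpermK b c) permJ.
have ta : t a = a by rewrite tpermD ?neqs.
have ty : t y = y by rewrite tpermD ?neqs.
rewrite (@class_resolved_tripod c (m ^ t)%g 2) ?neqs ?perfectJ //; first last.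
- case=> w k; rewrite /resolved_mate /perm_mate /=; have [->|k0] /= := eqVneq k 0; last first.
    rewrite andbT; case: eqP => // /eqP wb; rewrite /STU_unshift !xpair_eqE (negPf k0) !andbF.
    by rewrite mate_mk /tripod_mate /= (negPf wb) k0 /STU_shift !xpair_eqE (negPf wb).
  rewrite andbF mate_mk /STU_unshift !xpair_eqE !eqxx !andbT i21 i22 tE.
  have [->|wb] := eqVneq w b.
    by rewrite /tripod_mate /= eqxx /STU_shift !xpair_eqE !neqs tpermL mK ta.
  have [->|wc] := eqVneq w c.
    by rewrite /tripod_mate /= eqxx /STU_shift !xpair_eqE !neqs tpermR ty.
  rewrite /tripod_mate /= (negPf wb) (negPf wc) [t w]tpermD 1?eq_sym //.
  have [->|wa] := eqVneq w a; first by rewrite /STU_shift i21 i22 !xpair_eqE !eqxx tpermR.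
  have [->|wy] := eqVneq w y; first by rewrite /STU_shift i21 i22 !xpair_eqE !eqxx mK tpermL.
  have [mb _ _ mc] := m_other wb wy wa wc.
  by rewrite /STU_shift i21 i22 !xpair_eqE mb tpermD // eq_sym ?mb ?mc.
- by rewrite mate_mk /tripod_mate /= !neqs eqxx.
(* Renaming [b] and [c] restores [m] but exchanges the two sides of the slide; hence the opposite
   sign of the two differences. *)
have slide beta : chord K (slid beta c b) (m ^ t)%g = chord K (slid (~~ beta) c b) m.
  by apply: chord_conj; [apply: arrangement_slid; rewrite neqs | move=> i; apply: slid_swap; rewrite neqs].
by rewrite !slide /= addrC addrA subrK subrr.
Qed.

End Tripod.
End FourTerm.

(** * Invariance of coefficients under transpositions *)

Section Swap.
Variables (K : fieldType) (d n : nat).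
Hypothesis charK : [pchar K]%R =i pred0.
Hypothesis dn : (d.*2 <= n)%N.
Implicit Types (m M : {perm vertex d}) (u x : {perm vertex d} -> K) (a b c : vertex d).

Notation B := (base_legs dn).
Notation wid := (widen_ord dn).
Notation slid beta a b := (slide_legs beta (wid a) (wid b) b B).

Let wid_eq (v w : vertex d) : (wid v == wid w) = (v == w).
Proof. exact: (inj_eq (@widen_inj _ _ dn)). Qed.

Let swid_eq (v w : vertex d) : (Some (wid v) == Some (wid w)) = (v == w).
Proof. exact: wid_eq. Qed.

(** Each slide is the identity plus the moved diagram; in the difference only the leg [b] after the
    leg [a], minus [b] before [a], remains. *)
Definition commutator_map a b : {linear jacobi K d n -> jacobi K d n} :=
  jacobi_map (slide_hom true (wid a) (wid b)) \- jacobi_map (slide_hom false (wid a) (wid b)).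

Lemma commutator_map_base a b x : b != a ->
  commutator_map a b (chords B x) = chords (slid true a b) x - chords (slid false a b) x.
Proof.
move=> ba; rewrite /commutator_map /=.
rewrite !(jacobi_map_slide _ x (l := b)) ?wid_eq ?base_legs_at ?spread_arrangement //.
by rewrite opprD addrACA subrr add0r.
Qed.

Lemma commutator_map_preserves a b : b != a -> preserves_submodules (commutator_map a b).
Proof.
by move=> ba U UA w wU; apply: rpredB; apply: UA => //; apply: slide_hom_bij; rewrite wid_eq.
Qed.

Lemma mem_slid beta a b v i : b != a ->
  (v \in slid beta a b i) = (i == wid (if v == b then a else v)).
Proof.
move=> /negPf ba; rewrite /slide_legs; have [->|ib] := eqVneq i (wid b).
  by rewrite in_nil wid_eq; case: ifP => [_|/negbT]; rewrite ?ba // eq_sym => /negPf ->.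
have [->|ia] := eqVneq i (wid a).
  rewrite base_legs_at wid_eq; have [->|vb] := eqVneq v b.
    by rewrite eqxx; case: beta; rewrite !inE eqxx ?orbT.
  by case: beta; rewrite !inE (negPf vb) ?orbF eq_sym.
by rewrite mem_spread; have [->|_] := eqVneq v b; rewrite eq_sym // !(negPf ib) (negPf ia).
Qed.

Lemma arc_slid beta a b v : b != a ->
  arc (slid beta a b) v = Some (wid (if v == b then a else v)).
Proof.
move=> ba; have /andP[okL _] := arrangement_slid dn beta ba.
by apply/(arcP _ _ okL); rewrite mem_slid.
Qed.

Lemma before_slid beta a b p q : b != a ->
  [exists i, subseq [:: p; q] (slid beta a b i)] = ((p, q) == if beta then (a, b) else (b, a)).
Proof.
move=> ba; have slE : slid beta a b (wid a) = if beta then [:: a; b] else [:: b; a].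
  by rewrite /slide_legs wid_eq eq_sym (negPf ba) eqxx base_legs_at; case: beta.
have sub2 (s t : vertex d) : subseq [:: p; q] [:: s; t] = ((p, q) == (s, t)).
  by rewrite xpair_eqE /=; case: (p == s); [case: (q == t) | case: (p == t)].
have sub1 i : i != wid a -> subseq [:: p; q] (slid beta a b i) = false.
  move=> ia; apply/negP => /size_subseq; apply/negP; rewrite /slide_legs (negPf ia).
  case: eqP => // _; rewrite -ltnNge ltnS.
  have [/imageP[v _ ->]|iN] := boolP (i \in codom wid); first by rewrite base_legs_at.
  by rewrite /base_legs spread_nil // => v; apply: contraNneq iN => <-; apply: codom_f.
have -> : [exists i, subseq [:: p; q] (slid beta a b i)] = subseq [:: p; q] (slid beta a b (wid a)).
  apply/existsP/idP => [[i]|]; last by exists (wid a).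
  by have [->|/sub1 ->] := eqVneq i (wid a).
by rewrite slE; case: (beta); rewrite sub2.
Qed.

Section Functional.
Variables (M : {perm vertex d}) (a b : vertex d).
Hypotheses (pM : perfect M) (ba : b != a) (Mab : M a != b).

Let at_ (t : vertex d) (o : option 'I_n) : K := (o == Some (wid t))%:R.

(** A 3x3 determinant of indicators: it detects the tripod with ends on the arcs of [a], [M b],
    [M a], the one that commuting [a] and [b] in [M] creates. *)
Definition tripod_eps (x y z : option 'I_n) : K :=
  at_ a x * at_ (M b) y * at_ (M a) z + at_ a y * at_ (M b) z * at_ (M a) x
  + at_ a z * at_ (M b) x * at_ (M a) y - at_ a x * at_ (M b) z * at_ (M a) y
  - at_ a z * at_ (M b) y * at_ (M a) x - at_ a y * at_ (M b) x * at_ (M a) z.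

Definition chord_rel : rel (option 'I_n) :=
  fun o o' => [exists w, (o == Some (wid w)) && (o' == Some (wid (M w)))].

Lemma tripod_eps_cyclic (x y z : option 'I_n) : tripod_eps x y z = tripod_eps y z x.
Proof. rewrite /tripod_eps; ring. Qed.

Lemma tripod_eps_anti (x y z : option 'I_n) : tripod_eps x z y = - tripod_eps x y z.
Proof. rewrite /tripod_eps; ring. Qed.

Lemma chord_relE w w' : chord_rel (Some (wid w)) (Some (wid w')) = (w' == M w).
Proof.
apply/existsP/eqP => [[v]|->]; last by exists w; rewrite !eqxx.
by rewrite !swid_eq => /andP[/eqP -> /eqP].
Qed.

Let two0 : 2%:R != 0 :> K.
Proof. exact: natr_char0_neq0. Qed.

Definition tripod_functional : {linear jacobi K d n -> K^o} := weight_map d tripod_eps chord_rel.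

Lemma tripod_functional_commutator a' m : b != a' -> perfect m ->
  tripod_functional (chord K (slid true a' b) m - chord K (slid false a' b) m) =
  tripod_eps (Some (wid a')) (Some (wid (if m b == b then a' else m b)))
    (Some (wid (if m a' == b then a' else m a')))
  * [forall w, (w \notin [:: a'; b; m a'; m b]) ==> (m w == M w)]%:R.
Proof.
move=> ba' pm; rewrite linearB /tripod_functional.
have b1 p q : [exists i, subseq [:: p; q] (slid true a' b i)] = ((p, q) == (a', b)).
  exact: (before_slid true p q ba').
have b2 p q : [exists i, subseq [:: p; q] (slid false a' b i)] = ((p, q) == (b, a')).
  exact: (before_slid false p q ba').
rewrite (weight_map_chord two0 chord_rel tripod_eps_cyclic tripod_eps_anti
  (arrangement_slid dn true ba') pm b1).
rewrite (weight_map_chord two0 chord_rel tripod_eps_cyclic tripod_eps_anti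
  (arrangement_slid dn false ba') pm b2).
have restE (s : seq (vertex d)) beta : s =i [:: a'; b; m a'; m b] ->
  [forall w, (w \notin s) ==> chord_rel (arc (slid beta a' b) w) (arc (slid beta a' b) (m w))]
  = [forall w, (w \notin [:: a'; b; m a'; m b]) ==> (m w == M w)].
  move=> sE; apply: eq_forallb => w; rewrite sE; case wN: (w \in _) => //=.
  move: wN; rewrite !inE => /norP[_ /norP[/negPf wb /norP[_ wmb]]].
  rewrite !arc_slid // wb ifN ?chord_relE //.
  by apply: contra wmb => /eqP <-; have /perfectP/(_ w)[_ ->] := pm.
rewrite !restE //; last by move=> w; rewrite !inE; do 4 case: (w == _).
rewrite !arc_slid // eqxx [a' == b]eq_sym (negPf ba') /=.
(* The two slides give the two orders of the pair, with opposite values; the halves add up in the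
   difference. *)
rewrite [tripod_eps _ _ (Some (wid (if m b == b then _ else _)))]tripod_eps_anti.
rewrite -mulrBr mulNr opprK -mulr2n -(mulr_natl (_ * _)) mulrA mulVf // mul1r.
by [].
Qed.

(** Two matchings produce this tripod when [a] and [b] are commuted: [M], and [M] with the partners
    of [a] and [b] exchanged, which reverses the cyclic order. *)
Lemma tripod_functional_left m : perfect m ->
  tripod_functional (chord K (slid true a b) m - chord K (slid false a b) m)
  = (m == M)%:R - (m == M ^ tperm a b)%g%:R.
Proof.
move=> pm; rewrite tripod_functional_commutator //.
have mK v : m (m v) = v by have /perfectP/(_ v)[] := pm.
have mN v : (m v == v) = false by have /perfectP/(_ v)[/negPf] := pm.
have MK v : M (M v) = v by have /perfectP/(_ v)[] := pM.
have MN v : (M v == v) = false by have /perfectP/(_ v)[/negPf] := pM.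
have Mba : (M b == a) = false by rewrite -(inj_eq (@perm_inj _ M)) MK eq_sym (negPf Mab).
rewrite mN /tripod_eps /at_ !swid_eq eqxx ![a == _]eq_sym MN Mba.
rewrite !mulr0 !mul0r !mul1r !addr0 !subr0.
have E1 : ((if m a == b then a else m a) == M a) = (m a == M a).
  by have [->|//] := eqVneq (m a) b; rewrite eq_sym MN eq_sym (negPf Mab).
have E2 : ((if m a == b then a else m a) == M b) = (m a == M b).
  by have [->|//] := eqVneq (m a) b; rewrite eq_sym Mba eq_sym MN.
rewrite E1 E2 mulrBl -!natrM !mulnb; congr ((nat_of_bool _)%:R - (nat_of_bool _)%:R).
  apply/andP/eqP => [[/andP[/eqP mb /eqP ma] /forallP r]|->].
    apply/permP => w; have := r w; rewrite !inE !negb_or.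
    have [->|wa] := eqVneq w a; first by rewrite ma.
    have [->|wb] := eqVneq w b; first by rewrite mb.
    have [->|wma] := eqVneq w (m a); first by rewrite mK ma MK.
    have [->|wmb] := eqVneq w (m b); first by rewrite mK mb MK.
    by move=> /eqP.
  by rewrite !eqxx; split=> //; apply/forallP => w; rewrite eqxx implybT.
have tE w : (M ^ tperm a b)%g w = tperm a b (M (tperm a b w)) by rewrite -{1}[w](tpermK a b) permJ.
have tpa : tperm a b (M a) = M a by rewrite tpermD // eq_sym ?MN // (negPf Mab).
have tpb : tperm a b (M b) = M b by rewrite tpermD // eq_sym ?MN ?Mba.
have tMa : (M ^ tperm a b)%g b = M a by rewrite tE tpermR tpa.
have tMb : (M ^ tperm a b)%g a = M b by rewrite tE tpermL tpb.
apply/andP/eqP => [[/andP[/eqP ma /eqP mb] /forallP r]|->].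
  apply/permP => w; have := r w; rewrite !inE !negb_or.
  have [->|wa] := eqVneq w a; first by rewrite ma tMb.
  have [->|wb] := eqVneq w b; first by rewrite mb tMa.
  have [->|wma] := eqVneq w (m a); first by rewrite mK ma tE tpb MK tpermR.
  have [->|wmb] := eqVneq w (m b); first by rewrite mK mb tE tpa MK tpermL.
  move=> /eqP ->; rewrite tE [tperm a b w]tpermD 1?eq_sym // tpermD //.
    by apply: contraNneq wmb => E; rewrite mb E MK.
  by apply: contraNneq wma => E; rewrite ma E MK.
rewrite tMa tMb !eqxx; split=> //; apply/forallP => w; rewrite !inE !negb_or.
apply/implyP => /and4P[wa wb wMb wMa]; rewrite tE [tperm a b w]tpermD 1?eq_sym // tpermD //.
  by apply: contraNneq wMa => ->; rewrite MK.
by apply: contraNneq wMb => ->; rewrite MK.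
Qed.

(** The tripod created at [c] has an end on the arc of [c], which is not among the arcs of [a],
    [M b], [M a]. *)
Lemma tripod_functional_right c m : c != a -> b != c -> M a != c -> M b != c -> perfect m ->
  tripod_functional (chord K (slid true c b) m - chord K (slid false c b) m) = 0.
Proof.
move=> /negPf ca bc /negPf Mac /negPf Mbc pm; rewrite tripod_functional_commutator //.
rewrite /tripod_eps /at_ !swid_eq ca ![c == _]eq_sym Mac Mbc.
by rewrite !(mulr0, mul0r, addr0, subr0).
Qed.

End Functional.

(** Apply [tripod_functional M a b] to the relation: it does not see the commutator at [c], and the
    one at [a] gives [u M - u (M ^ tperm a b)]. *)
Lemma tripod_constraint u a b c M : perfect M -> c != a -> b != a -> b != c ->
  M c != a -> M c != b ->
  commutator_map a b (chords B u) + commutator_map c b (chords B u) = 0 ->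
  u (M ^ tperm a b)%g = u M.
Proof.
move=> pM ca ba bc Mca Mcb E.
have MK v : M (M v) = v by have /perfectP/(_ v)[] := pM.
have [Mab|Mab] := eqVneq (M a) b; first by rewrite tperm_fix_matching.
have Mac : M a != c by rewrite -(inj_eq (@perm_inj _ M)) MK eq_sym.
have Mbc : M b != c by rewrite -(inj_eq (@perm_inj _ M)) MK eq_sym.
pose phi := tripod_functional M a b.
have key e : b != e -> phi (commutator_map e b (chords B u)) =
    \sum_(m | perfect m) u m * phi (chord K (slid true e b) m - chord K (slid false e b) m).
  move=> be; rewrite commutator_map_base // /chords -sumrB linear_sum [RHS]big_mkcond /=.
  apply: eq_bigr => m _; rewrite -scalerBr linearZ /=; case: ifP => // pm.
  by rewrite /chord pm subrr linear0 scaler0.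
have := congr1 phi E; rewrite linearD linear0 /= !key // [X in _ + X]big1 ?addr0; last first.
  by move=> m pm; rewrite /phi tripod_functional_right ?mulr0.
rewrite (eq_bigr (fun m => u m * ((m == M)%:R - (m == M ^ tperm a b)%g%:R))) => [|m pm]; last first.
  by rewrite /phi tripod_functional_left.
have pick m0 : perfect m0 -> \sum_(m | perfect m) u m * (m == m0)%:R = u m0.
  move=> pm0; rewrite (bigD1 m0) //= eqxx mulr1 big1 ?addr0 // => m /andP[_ /negPf ->].
  by rewrite mulr0.
under eq_bigr do rewrite mulrBr.
rewrite sumrB !pick ?perfectJ // => /eqP; rewrite subr_eq0 => /eqP.
by [].
Qed.

(* The transposition (x y) is the product (a x)(a y)(a x), and each factor fixes
   the coefficient. *)
Lemma coef_vanish u a c (x y : vertex d) M : perfect M -> x != y ->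
  x \notin [:: a; c] -> y \notin [:: a; c] -> c != a ->
  (forall b, b != a -> b != c ->
     commutator_map a b (chords B u) + commutator_map c b (chords B u) = 0) ->
  (forall m, u (m ^ tperm x y)%g = - u m) -> M c \notin [:: a; x; y] -> u M = 0.
Proof.
rewrite !inE !negb_or => pM xy /andP[xa xc] /andP[ya yc] ca com anti /and3P[Mca Mcx Mcy].
have step b m : perfect m -> b != a -> b != c -> m c = M c -> M c != b ->
    [/\ perfect (m ^ tperm a b)%g, (m ^ tperm a b)%g c = M c & u (m ^ tperm a b)%g = u m].
  move=> pm ba bc mc Mcb; split; first by rewrite perfectJ.
    have tc : tperm a b c = c by rewrite tpermD // eq_sym.
    by rewrite -{1}tc permJ mc tpermD // eq_sym.
  by apply: tripod_constraint (com b ba bc) => //; rewrite mc.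
have [p1 m1 u1] := step x M pM xa xc erefl Mcx.
have [p2 m2 u2] := step y _ p1 ya yc m1 Mcy.
have [_ _ u3] := step x _ p2 xa xc m2 Mcx.
have E : (tperm a x * tperm a y * tperm a x = tperm x y)%g.
  rewrite -[X in (X * _ * _)%g]tpermV -mulgA -conjgE tpermJ tpermL tpermD // eq_sym //.
have uE : u (M ^ tperm x y)%g = u M by rewrite -E !conjgM u3 u2 u1.
have /eqP := anti M; rewrite uE -addr_eq0 -mulr2n -mulr_natl mulf_eq0.
by rewrite (negPf (natr_char0_neq0 charK (isT : (0 < 2)%N))) => /eqP.
Qed.

(** The coefficients of [q] are not known to be unique, so the sign behaviour of [q] is moved to
    them by averaging; the last clause lets commuting permutations be treated in turn. *)
Lemma antisymmetrize (q : jacobi K d n) u (s : {perm vertex d}) :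
  q = chords B u -> (s * s = 1)%g -> chords B (fun m => u (m ^ s)%g) = - q ->
  exists u', [/\ q = chords B u', (forall m, u' (m ^ s)%g = - u' m)
    & forall t, commute s t -> (forall m, u (m ^ t)%g = - u m) -> forall m, u' (m ^ t)%g = - u' m].
Proof.
move=> qu ss qs; have two0 : 2%:R != 0 :> K by apply: natr_char0_neq0.
exists (fun m => 2%:R^-1 * (u m - u (m ^ s)%g)); split.
- rewrite chordsZ chordsB qs -qu opprK -mulr2n -scaler_nat scalerA mulVf // scale1r.
  by [].
- by move=> m; rewrite -conjgM ss conjg1 -mulrN opprB.
move=> t st ut m; rewrite ut -conjgM -st conjgM ut -mulrN.
by rewrite opprD.
Qed.

End Swap.

(** * The two matchings of Q on the first four legs *)

Section MatchingsQ.
Variable e : nat.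
Implicit Types (m : {perm vertex e.+2}) (w : vertex e.+2).

Definition v4 (k : nat) : vertex e.+2 := inord k.

Lemma val_v4 k : (k < 4)%N -> v4 k = k :> nat.
Proof. by move=> k4; rewrite /v4 inordK //; apply: leq_trans k4 _. Qed.

Lemma v4_eq i j : (i < 4)%N -> (j < 4)%N -> (v4 i == v4 j) = (i == j).
Proof. by move=> i4 j4; rewrite -val_eqE /= !val_v4. Qed.

Lemma v4P w : [\/ (exists2 k, (k < 4)%N & w = v4 k) | (4 <= w)%N].
Proof.
have [w4|w4] := ltnP w 4; last by right.
by left; exists w => //; apply: ord_inj; rewrite val_v4.
Qed.

Lemma matQ1_v4 k : (k < 4)%N -> matQ1 e (v4 k) = v4 (3 - k).
Proof.
move=> k4; apply: ord_inj; rewrite val_matching_perm !val_v4 /matchQ1 ?k4 //.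
by rewrite ltnS leq_subr.
Qed.

Lemma matQ2_v4 k : (k < 4)%N -> matQ2 e (v4 k) = v4 (if k < 2 then k + 2 else k - 2)%N.
Proof.
move=> k4; apply: ord_inj; rewrite val_matching_perm val_v4 // /matchQ2.
by move: k k4 => [|[|[|[|//]]]] _; rewrite /= val_v4.
Qed.

Lemma matQ_big w : (4 <= w)%N -> matQ1 e w = matQ2 e w /\ (4 <= matQ1 e w)%N.
Proof.
move=> w4; have E : matchQ1 w = matchP w by rewrite /matchQ1 ltnNge w4.
have E2 : matchQ2 w = matchP w by move: w4; rewrite /matchQ2; case: (w : nat) => [|[|[|[|]]]].
split; first by apply: ord_inj; rewrite !val_matching_perm E E2.
by rewrite val_matching_perm E; apply: matchP_ge.
Qed.

Lemma perm_v4_eq m m' : (forall k, (k < 4)%N -> m (v4 k) = m' (v4 k)) ->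
  (forall w, (4 <= w)%N -> m w = m' w) -> m = m'.
Proof. by move=> h4 hb; apply/permP => w; have [[k k4 ->]|/hb //] := v4P w; apply: h4. Qed.

Lemma perfect_matQ : perfect (matQ1 e) /\ perfect (matQ2 e).
Proof. by split; apply: perfect_matching_perm. Qed.

Lemma tperm_v4 i j k : (i < 4)%N -> (j < 4)%N -> (k < 4)%N ->
  tperm (v4 i) (v4 j) (v4 k) = v4 (if k == i then j else if k == j then i else k).
Proof. by move=> i4 j4 k4; rewrite permE /= !v4_eq //; case: ifP => // _; case: ifP. Qed.

(** With the chords {0,3},{1,2}, exchanging 0 and 1 has the same effect as exchanging 2 and 3; so Q
    is alternating under both. *)
Lemma matQ2_tperm i j : (i, j) = (0%N, 1%N) \/ (i, j) = (2, 3)%N ->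
  matQ2 e = (matQ1 e ^ tperm (v4 i) (v4 j))%g.
Proof.
move=> ij.
have tE m w : (m ^ tperm (v4 i) (v4 j))%g w = tperm (v4 i) (v4 j) (m (tperm (v4 i) (v4 j) w)).
  by rewrite -{1}[w](tpermK (v4 i) (v4 j)) permJ.
apply: perm_v4_eq => [k k4|w w4]; rewrite tE.
  case: ij => -[-> ->]; move: k k4 => [|[|[|[|//]]]] _;
    by rewrite matQ2_v4 // tperm_v4 // matQ1_v4 // tperm_v4.
have big (z : vertex e.+2) : (4 <= z)%N -> tperm (v4 i) (v4 j) z = z.
  move=> z4; have nz k : (k < 4)%N -> v4 k != z.
    by move=> k4; apply: contraTneq z4 => <-; rewrite val_v4 // -ltnNge.
  have /andP[i4 j4] : (i < 4)%N && (j < 4)%N by case: ij => -[-> ->].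
  by rewrite tpermD // nz.
by have [E b] := matQ_big w4; rewrite [tperm _ _ w]big // big.
Qed.

(** Such an [m] preserves the first four legs, and the partner of leg 0 selects one of their three
    pairings. *)
Lemma matQ_cases m : perfect m -> (forall w, (4 <= w)%N -> m w = matQ1 e w) ->
  [\/ m = matQ1 e, m = matQ2 e | m (v4 0) = v4 1].
Proof.
move=> /perfectP mP mb.
have mK w : m (m w) = w by case: (mP w).
have small k : (k < 4)%N -> exists2 j, (j < 4)%N & m (v4 k) = v4 j.
  move=> k4; have [[j j4 E]|b] := v4P (m (v4 k)); first by exists j.
  have := mb _ b; rewrite mK => E; have [_] := matQ_big b.
  by rewrite -E val_v4 // leqNgt k4.
have ne k l j : (k < 4)%N -> (l < 4)%N -> (j < 4)%N -> m (v4 k) = v4 j -> m (v4 l) = v4 j -> k = l.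
  by move=> k4 l4 j4 <- /perm_inj/eqP; rewrite v4_eq // => /eqP.
have inv k j : m (v4 k) = v4 j -> m (v4 j) = v4 k by move=> <-; rewrite mK.
have fix0 k : (k < 4)%N -> m (v4 k) <> v4 k by move=> _ /eqP; case: (mP (v4 k)) => /negPf ->.
have [j0 j04 E0] := small 0%N isT; have [j1 j14 E1] := small 1%N isT.
move: j0 j04 E0 => [|[|[|[|//]]]] _ E0; first by case: (fix0 0%N isT).
- by constructor 3.
- have F2 := inv _ _ E0; constructor 2; apply: perm_v4_eq => [k k4|w w4]; last first.
    by rewrite mb //; have [] := matQ_big w4.
  move: j1 j14 E1 => [|[|[|[|//]]]] _ E1.
  + by have := (ne 2 1 0)%N isT isT isT F2 E1.
  + by case: (fix0 1%N isT).
  + by have := (ne 0 1 2)%N isT isT isT E0 E1.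
  have F3 := inv _ _ E1.
  by move: k k4 => [|[|[|[|//]]]] _; rewrite matQ2_v4 //= ?E0 ?F2 ?E1 ?F3.
have F3 := inv _ _ E0; constructor 1; apply: perm_v4_eq => [k k4|w w4]; last exact: mb.
move: j1 j14 E1 => [|[|[|[|//]]]] _ E1.
- by have := (ne 3 1 0)%N isT isT isT F3 E1.
- by case: (fix0 1%N isT).
- have F2 := inv _ _ E1.
  by move: k k4 => [|[|[|[|//]]]] _; rewrite matQ1_v4 //= ?E0 ?F2 ?E1 ?F3.
by have := (ne 0 1 3)%N isT isT isT E0 E1.
Qed.

End MatchingsQ.

(** * Indecomposability of AQ and conclusion *)

Section IndecomposableQ.
Variables (K : fieldType) (n : nat).
Hypothesis charK : [pchar K]%R =i pred0.

Lemma scalar_Q e (dn : (e.+2.*2 <= n)%N) (q : jacobi K e.+2 n) :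
  (forall T : {linear jacobi K e.+2 n -> jacobi K e.+2 n}, preserves_submodules T ->
     T (chords (base_legs dn) (@coefQ K e.+2)) = 0 -> T q = 0) ->
  exists a, q = a *: chords (base_legs dn) (@coefQ K e.+2).
Proof.
move=> qP; have [pQ1 pQ2] := perfect_matQ e.
have [v|u0 qu0] := @flip_odd_base K e.+2 n charK dn q.
  apply/eqP; rewrite -addr_eq0; apply/eqP.
  apply: (qP (jacobi_map (flip_hom (widen_ord dn v)) \+ idfun)).
    by move=> U UA w wU; apply: rpredD => //; apply: UA => //; apply: flip_hom_bij.
  by rewrite /= flip_base addNr.
(* From index 4 on the two diagrams of Q share their chords, so the four-term relation applies to
   both with the same [a] and [c]. *)
have com (a b : vertex e.+2) : (4 <= a)%N -> b != a -> b != matQ1 e a ->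
    commutator_map K dn a b q + commutator_map K dn (matQ1 e a) b q = 0.
  move=> a4 ba bc; have [Qa _] := matQ_big a4.
  apply: (qP (commutator_map K dn a b \+ commutator_map K dn (matQ1 e a) b)).
    by move=> U UA w wU; apply: rpredD; apply: commutator_map_preserves UA _ wU.
  apply: etrans (congr2 +%R (commutator_map_base _ _ ba) (commutator_map_base _ _ bc)) _.
  rewrite !chords_coefQ.
  have bc2 : b != matQ2 e a by rewrite -Qa.
  have F1 := four_term K dn pQ1 ba bc; have := four_term K dn pQ2 ba bc2; rewrite -Qa => F2.
  have swap (V : zmodType) (x y z t : V) : x - y - (z - t) = x - z - (y - t).
    by rewrite !opprB addrACA [RHS]addrACA [- y - z]addrC.
  by rewrite [X in X + _]swap [X in _ + X]swap addrACA -opprD F1 F2 subr0.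
have anti s u : (exists i j, s = tperm (v4 e i) (v4 e j) /\
     ((i, j) = (0%N, 1%N) \/ (i, j) = (2, 3)%N)) ->
    q = chords (base_legs dn) u -> chords (base_legs dn) (fun m => u (m ^ s)%g) = - q.
  move=> [i [j [-> ij]]] qu; have [s' s'E] := perm_base K dn (tperm (v4 e i) (v4 e j)).
  rewrite -s'E -qu; apply/eqP; rewrite -addr_eq0; apply/eqP.
  apply: (qP (jacobi_map (perm_hom s') \+ idfun)).
    by move=> U UA w wU; apply: rpredD => //; apply: UA => //; apply: perm_hom_bij.
  rewrite /= s'E -[X in _ + X]opprK; apply/eqP; rewrite subr_eq0 -scaleN1r -chordsZ; apply/eqP.
  apply: eq_chords => // m _; rewrite /coefQ mulN1r opprB (matQ2_tperm _ ij) (inj_eq (conjg_inj _)).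
  congr (_ - _); congr ((nat_of_bool _)%:R).
  have {1}-> : matQ1 e = ((matQ1 e ^ tperm (v4 e i) (v4 e j)) ^ tperm (v4 e i) (v4 e j))%g.
    by rewrite -conjgM tperm2 conjg1.
  by rewrite (inj_eq (conjg_inj _)).
have ex01 : exists i j, tperm (v4 e 0) (v4 e 1) = tperm (v4 e i) (v4 e j) /\
     ((i, j) = (0%N, 1%N) \/ (i, j) = (2, 3)%N) by exists 0%N, 1%N; split=> //; left.
have ex23 : exists i j, tperm (v4 e 2) (v4 e 3) = tperm (v4 e i) (v4 e j) /\
     ((i, j) = (0%N, 1%N) \/ (i, j) = (2, 3)%N) by exists 2, 3; split=> //; right.
(* First antisymmetrize under (0 1), then under the disjoint (2 3), which keeps the first
   property. *)
have [u1 [qu1 a1 _]] := antisymmetrize charK qu0 (tperm2 _ _) (anti _ _ ex01 qu0).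
have [u [qu a23 a2]] := antisymmetrize charK qu1 (tperm2 _ _) (anti _ _ ex23 qu1).
have {a1 a2} a01 : forall m, u (m ^ tperm (v4 e 0) (v4 e 1))%g = - u m.
  by apply: a2 => //; apply/commgP/conjg_fixP; rewrite tpermJ !tperm_v4.
have cz (a : vertex e.+2) : (4 <= a)%N -> forall b, b != matQ1 e a -> b != a ->
    commutator_map K dn (matQ1 e a) b (chords (base_legs dn) u)
    + commutator_map K dn a b (chords (base_legs dn) u) = 0.
  by move=> a4 b bc ba; rewrite addrC -qu com.
have two0 : 2%:R != 0 :> K by apply: natr_char0_neq0.
have van M (w : vertex e.+2) : perfect M -> (4 <= w)%N -> M w != matQ1 e w -> u M = 0.
  move=> pM w4 ne; have [_ b4] := matQ_big w4.
  have small k (z : vertex e.+2) : (k < 4)%N -> (4 <= z)%N -> v4 e k != z.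
    by move=> k4; apply: contraTneq => <-; rewrite val_v4 // -ltnNge.
  have cM : w != matQ1 e w by have /perfectP/(_ w)[+ _] := pQ1; rewrite eq_sym.
  have out i : (i < 4)%N -> v4 e i \notin [:: matQ1 e w; w].
    by move=> i4; rewrite !inE negb_or !small.
  (* The partner of [w] in [M] meets at most one of the pairs {0,1} and {2,3}; the transposition of
     the other pair gives the vanishing. *)
  have [h01|h01] := boolP (M w \in [:: v4 e 0; v4 e 1]); last first.
    apply: (coef_vanish charK (a := matQ1 e w) (c := w) pM _ (out 0%N isT) (out 1%N isT) cM (cz w w4) a01).
      by rewrite v4_eq.
    by rewrite in_cons negb_or ne.
  apply: (coef_vanish charK (a := matQ1 e w) (c := w) pM _ (out 2 isT) (out 3 isT) cM (cz w w4) a23).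
    by rewrite v4_eq.
  by rewrite in_cons negb_or ne; move: h01; rewrite !inE => /orP[] /eqP ->; rewrite !v4_eq.
exists (u (matQ1 e)); rewrite qu -chordsZ; apply: eq_chords => // M pM.
have Q12 : (matQ1 e == matQ2 e) = false.
  by apply/eqP => /permP/(_ (v4 e 0))/eqP; rewrite matQ1_v4 // matQ2_v4 // v4_eq.
rewrite /coefQ; have [->|M1] := eqVneq M (matQ1 e); first by rewrite Q12 subr0 mulr1.
have [->|M2] := eqVneq M (matQ2 e).
  by rewrite sub0r mulrN1 (@matQ2_tperm e 0 1 (or_introl erefl)) a01.
rewrite subrr mulr0.
have [w /andP[w4 ne]|same] := pickP (fun w : vertex e.+2 => (4 <= w)%N && (M w != matQ1 e w)).
  exact: van pM w4 ne.
have [w w4|E|E|E] := matQ_cases pM.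
- by apply/eqP; have := same w; rewrite w4 => /negbFE.
- by rewrite E eqxx in M1.
- by rewrite E eqxx in M2.
(* This matching contains the chord {0,1}, so it is fixed by (0 1), while its coefficient changes
   sign. *)
have /eqP := a01 M; rewrite (tperm_fix_matching pM E) -addr_eq0 -mulr2n -mulr_natl mulf_eq0.
by rewrite (negPf two0) => /eqP.
Qed.

Lemma indecomposable_AQ d : (d.*2 <= n)%N -> AQ K d n <> 0%VS -> indecomposable (AQ K d n).
Proof.
move=> dn; rewrite generatedQ => ne0.
case: d dn ne0 => [|[|e]] dn ne0; last exact: (indecomposable_generated (scalar_Q (dn := dn)) ne0).
- case: ne0; apply/eqP; rewrite -subv0; apply: generated_ind => L _.
  by rewrite /chords big1 ?mem0v // => m _; rewrite scale0r.
- case: ne0; apply/eqP; rewrite -subv0; apply: generated_ind => L _.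
  by rewrite /chords big1 ?mem0v // => m _; rewrite scale0r.
Qed.

End IndecomposableQ.

(** An indecomposable decomposition concerns only the nonzero summands, whence the two guards; for d
    = 1, for instance, AQ is zero. *)
Theorem theorem1p4 (K : fieldType) (charK : [pchar K]%R =i pred0)
    (d n : nat) (d_ge1 : (1 <= d)%N) (n_ge1 : (1 <= n)%N) :
  @direct_decomposition K d n fullv (AP K d n) (AQ K d n)
  /\ ((d.*2 <= n)%N ->
        (AP K d n <> 0%VS -> indecomposable (AP K d n))
        /\ (AQ K d n <> 0%VS -> indecomposable (AQ K d n))).
Proof.
split; first exact: AP_AQ_decomposition.
by move=> dn; split; [apply: indecomposable_AP | apply: indecomposable_AQ].
Qed.
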